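(* There is a finite first-order language $L$ such that the property of $\omega$-categoricity distinguishes a $\Pi^0_3$-complete subset of the set of all decidable complete $L$-theories. That is, the set of all $e\in\omega$ such that $\mathrm{sgn}(\varphi_e(x))$ is (total and is) the characteristic function of the set of Gödel numbers of the sentences of a decidable complete $\omega$-categorical $L$-theory is a $\Pi^0_3$-complete set.
   Context: $(\varphi_e)_{e\in\omega}$ is a standard enumeration of the unary partial computable functions. $\mathrm{sgn}(x)=1$ for $x\neq 0$ and $\mathrm{sgn}(0)=0$. A Gödel numbering of the sentences of the finite language $L$ is fixed, and a decidable complete $L$-theory (a consistent, deductively closed, complete set of $L$-sentences) is identified with the computable characteristic function, of the form $\mathrm{sgn}(\varphi_e(x))$, of the set of Gödel numbers of its sentences. A complete theory is $\omega$-categorical (countably categorical) if it has, up to isomorphism, exactly one countably infinite model (and no finite models). A set $X\subseteq\omega$ is $\Pi^0_3$-complete if $X\in\Pi^0_3$ and every $\Pi^0_3$ subset of $\omega$ is many-one reducible to $X$. *)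

(* Defs.v *)
From Stdlib Require Import List.
From Stdlib Require Vector Fin Cantor.
Import ListNotations.

Set Implicit Arguments.

Notation "⟨ x , y ⟩" := (Cantor.to_nat (x, y)) (at level 0).

(** Codes of unary partial computable functions. Several arguments are packed
    with Cantor's bijection [nat * nat -> nat], so that
    [pc_pair pc_left pc_right] computes the identity. *)

Inductive pcode : Type :=
| pc_zero : pcode
| pc_succ : pcode
| pc_left : pcode
| pc_right : pcode
| pc_pair : pcode -> pcode -> pcode
| pc_comp : pcode -> pcode -> pcode
| pc_prec : pcode -> pcode -> pcode
| pc_mu : pcode -> pcode.

Inductive pc_eval : pcode -> nat -> nat -> Prop :=
| ev_zero x : pc_eval pc_zero x 0
| ev_succ x : pc_eval pc_succ x (S x)
| ev_left x y : pc_eval pc_left ⟨x, y⟩ x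
| ev_right x y : pc_eval pc_right ⟨x, y⟩ y
| ev_pair c d x a b :
    pc_eval c x a -> pc_eval d x b -> pc_eval (pc_pair c d) x ⟨a, b⟩
| ev_comp c d x a b :
    pc_eval d x a -> pc_eval c a b -> pc_eval (pc_comp c d) x b
| ev_prec0 c d x a :
    pc_eval c x a -> pc_eval (pc_prec c d) ⟨x, 0⟩ a
| ev_precS c d x n r a :
    pc_eval (pc_prec c d) ⟨x, n⟩ r ->
    pc_eval d ⟨x, ⟨n, r⟩⟩ a ->
    pc_eval (pc_prec c d) ⟨x, S n⟩ a
| ev_mu c x n :
    pc_eval c ⟨x, n⟩ 0 ->
    (forall m, m < n -> exists k, pc_eval c ⟨x, m⟩ (S k)) ->
    pc_eval (pc_mu c) x n.

Fixpoint pc_index (c : pcode) : nat :=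
  match c with
  | pc_zero => ⟨0, 0⟩
  | pc_succ => ⟨1, 0⟩
  | pc_left => ⟨2, 0⟩
  | pc_right => ⟨3, 0⟩
  | pc_pair c d => ⟨4, ⟨pc_index c, pc_index d⟩⟩
  | pc_comp c d => ⟨5, ⟨pc_index c, pc_index d⟩⟩
  | pc_prec c d => ⟨6, ⟨pc_index c, pc_index d⟩⟩
  | pc_mu c => ⟨7, pc_index c⟩
  end.

(** The graph of the [e]-th partial computable function; it is the nowhere
    defined function when [e] is not the index of a code. *)
Definition phi (e x y : nat) : Prop :=
  exists c : pcode, pc_index c = e /\ pc_eval c x y.

Definition sgn (x : nat) : nat := match x with 0 => 0 | S _ => 1 end.

Definition sgn_phi (e x z : nat) : Prop :=
  exists y, phi e x y /\ z = sgn y.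

(** For a single-valued [g], this includes totality of the function with
    graph [g]. *)
Definition is_char_fun (g : nat -> nat -> Prop) (A : nat -> Prop) : Prop :=
  forall x, (A x /\ g x 1) \/ (~ A x /\ g x 0).

Definition computable_fun (f : nat -> nat) : Prop :=
  exists e, forall x, phi e x (f x).

Definition computable_set (A : nat -> Prop) : Prop :=
  exists e, is_char_fun (phi e) A.

Definition Pi03 (X : nat -> Prop) : Prop :=
  exists A, computable_set A /\
    forall x, X x <-> forall a, exists b, forall c, A ⟨x, ⟨a, ⟨b, c⟩⟩⟩.

Definition many_one_reducible (X Y : nat -> Prop) : Prop :=
  exists f, computable_fun f /\ forall x, X x <-> Y (f x).

Definition Pi03_complete (X : nat -> Prop) : Prop :=
  Pi03 X /\ forall Y, Pi03 Y -> many_one_reducible Y X.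

(** A finite language with equality; constants are function symbols of
    arity 0. *)

Record language : Type := Language {
  fun_num : nat;
  fun_arity : Fin.t fun_num -> nat;
  rel_num : nat;
  rel_arity : Fin.t rel_num -> nat
}.

(** Variables are de Bruijn indices: [all phi] binds index 0 of [phi]. *)

Inductive term (L : language) : Type :=
| var : nat -> term L
| app : forall f : Fin.t (fun_num L),
    Vector.t (term L) (fun_arity L f) -> term L.

Arguments var {L} _.
Arguments app {L} f _.

Inductive form (L : language) : Type :=
| bot : form L
| eqn : term L -> term L -> form L
| rel : forall R : Fin.t (rel_num L),
    Vector.t (term L) (rel_arity L R) -> form L
| imp : form L -> form L -> form L
| all : form L -> form L.

Arguments bot {L}.
Arguments eqn {L} _ _.
Arguments rel {L} R _.
Arguments imp {L} _ _.
Arguments all {L} _.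

Definition neg {L : language} (p : form L) : form L := imp p bot.

(** All free variables are [< n]. *)
Inductive term_bounded {L : language} (n : nat) : term L -> Prop :=
| tb_var x : x < n -> term_bounded n (var x)
| tb_app f v : Vector.Forall (term_bounded n) v -> term_bounded n (app f v).

Fixpoint form_bounded {L : language} (n : nat) (p : form L) : Prop :=
  match p with
  | bot => True
  | eqn s t => term_bounded n s /\ term_bounded n t
  | rel R v => Vector.Forall (term_bounded n) v
  | imp p q => form_bounded n p /\ form_bounded n q
  | all p => form_bounded (S n) p
  end.

Definition sentence {L : language} (p : form L) : Prop := form_bounded 0 p.

Fixpoint subst_term {L : language} (s : nat -> term L) (t : term L) : term L :=
  match t with
  | var x => s x
  | app f v => app f (Vector.map (subst_term s) v)
  end.

Definition shift_term {L : language} : term L -> term L :=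
  subst_term (fun x => var (S x)).

Definition scons {L : language} (t : term L) (s : nat -> term L) :
    nat -> term L :=
  fun x => match x with 0 => t | S y => s y end.

Fixpoint subst_form {L : language} (s : nat -> term L) (p : form L) : form L :=
  match p with
  | bot => bot
  | eqn t u => eqn (subst_term s t) (subst_term s u)
  | rel R v => rel R (Vector.map (subst_term s) v)
  | imp p q => imp (subst_form s p) (subst_form s q)
  | all p => all (subst_form (scons (var 0) (fun x => shift_term (s x))) p)
  end.

Definition shift_form {L : language} : form L -> form L :=
  subst_form (fun x => var (S x)).

Definition inst {L : language} (t : term L) : form L -> form L :=
  subst_form (scons t var).

Inductive derives {L : language} : list (form L) -> form L -> Prop :=
| d_ax G p : In p G -> derives G p
| d_imp_intro G p q : derives (p :: G) q -> derives G (imp p q)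
| d_imp_elim G p q : derives G (imp p q) -> derives G p -> derives G q
| d_raa G p : derives (neg p :: G) bot -> derives G p
| d_all_intro G p : derives (map shift_form G) p -> derives G (all p)
| d_all_elim G p t : derives G (all p) -> derives G (inst t p)
| d_eq_refl G t : derives G (eqn t t)
| d_eq_subst G p s t :
    derives G (eqn s t) -> derives G (inst s p) -> derives G (inst t p).

Definition provable {L : language} (T : form L -> Prop) (p : form L) : Prop :=
  exists G, (forall q, In q G -> T q) /\ derives G p.

Record complete_theory {L : language} (T : form L -> Prop) : Prop := {
  ct_sentences : forall p, T p -> sentence p;
  ct_consistent : ~ provable T bot;
  ct_closed : forall p, sentence p -> provable T p -> T p;
  ct_complete : forall p, sentence p -> T p \/ T (neg p)
}.

Definition symbol_index {n : nat} (i : Fin.t n) : nat :=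
  proj1_sig (Fin.to_nat i).

Definition vector_index {A : Type} (g : A -> nat) {n : nat}
    (v : Vector.t A n) : nat :=
  Vector.fold_right (fun a m => S ⟨g a, m⟩) v 0.

Fixpoint term_index {L : language} (t : term L) : nat :=
  match t with
  | var x => ⟨0, x⟩
  | app f v => ⟨S (symbol_index f), vector_index term_index v⟩
  end.

Fixpoint form_index {L : language} (p : form L) : nat :=
  match p with
  | bot => ⟨0, 0⟩
  | eqn s t => ⟨1, ⟨term_index s, term_index t⟩⟩
  | imp p q => ⟨2, ⟨form_index p, form_index q⟩⟩
  | all p => ⟨3, form_index p⟩
  | rel R v => ⟨4 + symbol_index R, vector_index term_index v⟩
  end.

Definition index_set {L : language} (T : form L -> Prop) (x : nat) : Prop :=
  exists p, T p /\ form_index p = x.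

Record structure (L : language) : Type := Structure {
  carrier : Type;
  carrier_nonempty : inhabited carrier;
  fun_interp : forall f : Fin.t (fun_num L),
    Vector.t carrier (fun_arity L f) -> carrier;
  rel_interp : forall R : Fin.t (rel_num L),
    Vector.t carrier (rel_arity L R) -> Prop
}.

Fixpoint eval {L : language} (M : structure L) (rho : nat -> carrier M)
    (t : term L) : carrier M :=
  match t with
  | var x => rho x
  | app f v => fun_interp M f (Vector.map (eval M rho) v)
  end.

Definition env_cons {D : Type} (d : D) (rho : nat -> D) : nat -> D :=
  fun x => match x with 0 => d | S y => rho y end.

Fixpoint sat {L : language} (M : structure L) (rho : nat -> carrier M)
    (p : form L) : Prop :=
  match p with
  | bot => False
  | eqn s t => eval M rho s = eval M rho t
  | rel R v => rel_interp M R (Vector.map (eval M rho) v)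
  | imp p q => sat M rho p -> sat M rho q
  | all p => forall d, sat M (env_cons d rho) p
  end.

(** The assignment is irrelevant when [T] consists of sentences. *)
Definition models {L : language} (M : structure L) (T : form L -> Prop) : Prop :=
  forall p, T p -> forall rho, sat M rho p.

Definition bijection {A B : Type} (h : A -> B) : Prop :=
  (forall x y, h x = h y -> x = y) /\ (forall y, exists x, h x = y).

Definition isomorphic {L : language} (M N : structure L) : Prop :=
  exists h : carrier M -> carrier N,
    bijection h /\
    (forall f v, h (fun_interp M f v) = fun_interp N f (Vector.map h v)) /\
    (forall R v, rel_interp M R v <-> rel_interp N R (Vector.map h v)).

Definition finite_type (A : Type) : Prop := exists l : list A, forall x, In x l.

Definition countably_infinite (A : Type) : Prop :=
  exists h : nat -> A, bijection h.

Record omega_categorical {L : language} (T : form L -> Prop) : Prop := {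
  oc_no_finite_model :
    forall M : structure L, models M T -> ~ finite_type (carrier M);
  oc_exists :
    exists M : structure L, models M T /\ countably_infinite (carrier M);
  oc_unique :
    forall M N : structure L,
      models M T -> countably_infinite (carrier M) ->
      models N T -> countably_infinite (carrier N) ->
      isomorphic M N
}.

(* Main.v *)
(** The language has a single binary relation.

    Upper bound: by the Ryll-Nardzewski theorem a complete theory [T] is omega-categorical iff
    for every [n] finitely many formulas represent all formulas on [n]-tuples of distinct
    elements, a condition with three alternations over the decidable [T]. That [T] is the
    theory of an infinite structure is expressed, without coding derivations, by closure
    conditions on [T] under which "the formulas [l] are true of [n] distinct elements" is a
    consistency property.

    Hardness: for [g : nat -> nat] take a generic graph in which every clique [X] extends to a
    clique of some maximal finite size [t], only allowed when [g t + 2 <= |X|], or to cliques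
    of all sizes. The sizes attached to the subsets of a tuple determine its type, so the
    theory is omega-categorical iff [g] tends to infinity, a Pi03-complete property of [g].
    A sentence of quantifier depth at most [B] cannot distinguish sizes above [B] from
    infinity, hence it is decided by a recursion over finite tables of truncated sizes. *)

From Stdlib Require Import List Arith Lia Bool Cantor Classical ClassicalEpsilon
  FunctionalExtensionality PropExtensionality.
From Stdlib Require Vector Fin.
Require Import Defs.
Import ListNotations.
Set Implicit Arguments.

(** * Typed computability *)

(** The language sees only edges, yet for a clique [X] of finite rank the relation [t <= rank X] is
    first-order: it says that [X] lies in a clique of size [t]. So if [g t <= a] for infinitely many
    [t], tuples of length [a + 2] realise infinitely many types; if [g] tends to infinity, tuples of
    a fixed length take only finitely many finite ranks. The obstacle is that the theory must be
    decided uniformly in an input whose limit behaviour is not computable. A table truncated at [B]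
    depends on [g] only below [B], since the value [B] itself is exempt from the constraint
    involving [g]. The function [g] comes from [forall a, exists b, forall c] thus: for fixed [a],
    the lists of least counterexamples [c] for [b = 0, 1, ...] are initial segments of one sequence,
    infinite exactly when no [b] is good for [a]. Each such list codes an argument where [g] has
    value [a]; elsewhere [g] is the identity. For the upper bound, variables of a condition name
    distinct elements, so the constructed model has universe [nat] without a quotient, and a
    condition counts as consistent when the theory rejects the sentence [refuted n l]; failures of
    closure are then recursively enumerable. *)

Class Enc (A : Type) := { enc : A -> nat; enc_inj : forall x y, enc x = enc y -> x = y }.

#[global] Instance Enc_nat : Enc nat := {| enc := fun n => n; enc_inj := fun x y H => H |}.

Lemma to_nat_inj a b c d : ⟨a, b⟩ = ⟨c, d⟩ -> a = c /\ b = d.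
Proof.
  intros H. apply (f_equal Cantor.of_nat) in H.
  rewrite !Cantor.cancel_of_to in H. injection H. auto.
Qed.

#[global] Instance Enc_prod {A B} `{Enc A} `{Enc B} : Enc (A * B).
Proof.
  refine {| enc := fun p => ⟨enc (fst p), enc (snd p)⟩ |}.
  intros [a b] [c d] E. apply to_nat_inj in E. simpl in E. destruct E as [E1 E2].
  apply enc_inj in E1. apply enc_inj in E2. congruence.
Defined.

Fixpoint enc_list {A} (f : A -> nat) (l : list A) : nat :=
  match l with [] => 0 | x :: l => S ⟨f x, enc_list f l⟩ end.

#[global] Instance Enc_list {A} `{Enc A} : Enc (list A).
Proof.
  refine {| enc := enc_list enc |}.
  induction x as [|a x IH]; intros [|b y] E; simpl in E; try congruence.
  injection E as E. apply to_nat_inj in E. destruct E as [E1 E2].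
  apply enc_inj in E1. apply IH in E2. congruence.
Defined.

#[global] Instance Enc_bool : Enc bool.
Proof.
  refine {| enc := fun b : bool => if b then 1 else 0 |}.
  intros [] []; congruence.
Defined.

Lemma enc_pair {A B} `{Enc A} `{Enc B} (a : A) (b : B) : enc (a, b) = ⟨enc a, enc b⟩.
Proof. reflexivity. Qed.

Definition computable {A B} `{Enc A} `{Enc B} (f : A -> B) : Prop :=
  exists c, forall a, pc_eval c (enc a) (enc (f a)).

Definition pc_id := pc_pair pc_left pc_right.

Lemma pair_surj x : exists a b, x = ⟨a, b⟩.
Proof.
  exists (fst (Cantor.of_nat x)), (snd (Cantor.of_nat x)).
  rewrite <- surjective_pairing. symmetry. apply Cantor.cancel_to_of.
Qed.

Lemma ev_id x : pc_eval pc_id x x.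
Proof. destruct (pair_surj x) as (a & b & ->). repeat constructor. Qed.

Section Basic.
Context {A B C D : Type} `{Enc A} `{Enc B} `{Enc C} `{Enc D}.

Lemma cmp_id : computable (fun a : A => a).
Proof. exists pc_id. intros. apply ev_id. Qed.

Lemma cmp_ext (f g : A -> B) : (forall a, f a = g a) -> computable f -> computable g.
Proof. intros E [c Hc]. exists c. intros a. rewrite <- E. auto. Qed.

Fixpoint pc_const (n : nat) : pcode :=
  match n with 0 => pc_zero | S n => pc_comp pc_succ (pc_const n) end.

Lemma ev_const n x : pc_eval (pc_const n) x n.
Proof. induction n; simpl; econstructor; eauto. constructor. Qed.

Lemma cmp_const (b : B) : computable (fun _ : A => b).
Proof. exists (pc_const (enc b)). intros. apply ev_const. Qed.

Lemma cmp_pair (f : A -> B) (g : A -> C) :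
  computable f -> computable g -> computable (fun a => (f a, g a)).
Proof.
  intros [c Hc] [d Hd]. exists (pc_pair c d). intros a. rewrite enc_pair. constructor; auto.
Qed.

Lemma cmp_comp (f : B -> C) (g : A -> B) :
  computable f -> computable g -> computable (fun a => f (g a)).
Proof. intros [c Hc] [d Hd]. exists (pc_comp c d). intros a. econstructor; eauto. Qed.

Lemma cmp_fst (f : A -> B * C) : computable f -> computable (fun a => fst (f a)).
Proof.
  intros [c Hc]. exists (pc_comp pc_left c). intros a.
  econstructor; eauto. simpl. constructor.
Qed.

Lemma cmp_snd (f : A -> B * C) : computable f -> computable (fun a => snd (f a)).
Proof.
  intros [c Hc]. exists (pc_comp pc_right c). intros a.
  econstructor; eauto. simpl. constructor.
Qed.

Lemma cmp_succ (f : A -> nat) : computable f -> computable (fun a => S (f a)).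
Proof. intros [c Hc]. exists (pc_comp pc_succ c). intros a. econstructor; eauto. constructor. Qed.

Lemma cmp_nat_rect (b : A -> B) (s : A -> nat -> B -> B) (n : A -> nat) :
  computable b ->
  computable (fun p : A * (nat * B) => s (fst p) (fst (snd p)) (snd (snd p))) ->
  computable n ->
  computable (fun a => nat_rect (fun _ => B) (b a) (s a) (n a)).
Proof.
  intros [cb Hb] [cs Hs] [cn Hn].
  exists (pc_comp (pc_prec cb cs) (pc_pair pc_id cn)). intros a.
  econstructor.
  - constructor. apply ev_id. apply Hn.
  - simpl. induction (n a) as [|m IH]; simpl.
    + constructor. apply Hb.
    + econstructor. apply IH. apply (Hs (a, (m, _))).
Qed.

(** Only the selected branch is evaluated: the recursion runs [sgn] steps. *)
Lemma cmp_list_case (l : A -> list B) (f : A -> C) (g : A -> B -> list B -> C) :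
  computable l -> computable f ->
  computable (fun p : A * (B * list B) => g (fst p) (fst (snd p)) (snd (snd p))) ->
  computable (fun a => match l a with [] => f a | x :: t => g a x t end).
Proof.
  intros [cl Hl] [cf Hf] [cg Hg].
  pose (pred := pc_prec pc_zero (pc_comp pc_left pc_right)).
  assert (Hp : forall x n, pc_eval pred ⟨x, S n⟩ n).
  { intros x n.
    assert (E : exists r, pc_eval pred ⟨x, n⟩ r).
    { induction n as [|n [r IH]].
      - exists 0. repeat constructor.
      - exists n. econstructor. apply IH. repeat econstructor. }
    destruct E as [r E]. econstructor. apply E. repeat econstructor. }
  pose (sg := pc_prec pc_zero (pc_const 1)).
  assert (Hs0 : forall x, pc_eval sg ⟨x, 0⟩ 0) by (intros; repeat constructor).
  assert (Hs : forall x n, pc_eval sg ⟨x, S n⟩ 1).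
  { intros x n. assert (E : exists r, pc_eval sg ⟨x, n⟩ r).
    { induction n as [|n [r IH]]. exists 0; auto.
      exists 1. econstructor. apply IH. apply ev_const. }
    destruct E as [r E]. econstructor. apply E. apply ev_const. }
  exists (pc_comp (pc_prec (pc_comp cf pc_left) (pc_comp cg (pc_pair (pc_comp pc_left pc_left) (pc_comp pred pc_left))))
     (pc_pair (pc_pair pc_id cl) (pc_comp sg (pc_pair pc_id cl)))).
  intros a. specialize (Hl a). destruct (l a) as [|x t] eqn:E; simpl in Hl.
  - econstructor.
    + constructor. constructor. apply ev_id. apply Hl.
      econstructor. constructor. apply ev_id. apply Hl. apply Hs0.
    + constructor. econstructor. constructor. apply Hf.
  - econstructor.
    + constructor. constructor. apply ev_id. apply Hl.
      econstructor. constructor. apply ev_id. apply Hl. apply Hs.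
    + econstructor. constructor. econstructor. constructor. apply Hf.
      econstructor. constructor. econstructor. constructor. constructor.
      econstructor. constructor. apply Hp.
      apply (Hg (a, (x, t))).
Qed.

Lemma cmp_cons (f : A -> B) (l : A -> list B) :
  computable f -> computable l -> computable (fun a => f a :: l a).
Proof.
  intros [c Hc] [d Hd]. exists (pc_comp pc_succ (pc_pair c d)). intros a.
  econstructor. constructor; eauto. constructor.
Qed.

Lemma cmp_enc (f : A -> B) : computable f -> computable (fun a => enc (f a)).
Proof. intros [c Hc]. exists c. apply Hc. Qed.

End Basic.

Lemma cmp_if {A B} `{Enc A} `{Enc B} (b : A -> bool) (f g : A -> B) :
  computable b -> computable f -> computable g ->
  computable (fun a => if b a then f a else g a).
Proof.
  intros Hb Hf Hg.
  apply cmp_ext with (f := fun a => nat_rect (fun _ => B) (g a) (fun _ _ => f a) (enc (b a))).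
  - intros a. destruct (b a); reflexivity.
  - apply cmp_nat_rect; auto using cmp_enc.
    apply cmp_comp with (f := f) (g := fst); auto. apply cmp_fst, cmp_id.
Qed.

Create HintDb cmp.
#[global] Hint Resolve cmp_id cmp_const cmp_pair cmp_fst cmp_snd cmp_succ cmp_nat_rect
  cmp_list_case cmp_cons cmp_enc cmp_if : cmp.
#[global] Hint Extern 2 (computable _) => progress cbn beta : cmp.
Ltac cmp := cbn beta; eauto 60 with cmp nocore.

Section Nat.
Context {A : Type} `{Enc A}.

Lemma cmp_pred (f : A -> nat) : computable f -> computable (fun a => pred (f a)).
Proof.
  intros. apply cmp_ext with (f := fun a => nat_rect (fun _ => nat) 0 (fun n _ => n) (f a)).
  - intros a. destruct (f a); reflexivity.
  - cmp.
Qed.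

Lemma cmp_add (f g : A -> nat) : computable f -> computable g -> computable (fun a => f a + g a).
Proof.
  intros. apply cmp_ext with (f := fun a => nat_rect (fun _ => nat) (g a) (fun _ r => S r) (f a)).
  - intros a. induction (f a); simpl; congruence.
  - cmp.
Qed.
End Nat.
#[global] Hint Resolve cmp_pred cmp_add : cmp.

Section Nat2.
Context {A : Type} `{Enc A}.
Lemma cmp_sub (f g : A -> nat) : computable f -> computable g -> computable (fun a => f a - g a).
Proof.
  intros. apply cmp_ext with (f := fun a => nat_rect (fun _ => nat) (f a) (fun _ r => pred r) (g a)).
  - intros a. induction (g a); simpl; lia.
  - cmp.
Qed.

Lemma cmp_negb (f : A -> bool) : computable f -> computable (fun a => negb (f a)).
Proof. intros. unfold negb. cmp. Qed.
Lemma cmp_andb (f g : A -> bool) : computable f -> computable g -> computable (fun a => andb (f a) (g a)).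
Proof. intros. unfold andb. cmp. Qed.
Lemma cmp_orb (f g : A -> bool) : computable f -> computable g -> computable (fun a => orb (f a) (g a)).
Proof. intros. unfold orb. cmp. Qed.

Lemma cmp_is_zero (f : A -> nat) : computable f -> computable (fun a => Nat.eqb (f a) 0).
Proof.
  intros. apply cmp_ext with (f := fun a => nat_rect (fun _ => bool) true (fun _ _ => false) (f a)).
  - intros a. destruct (f a); reflexivity.
  - cmp.
Qed.
End Nat2.
#[global] Hint Resolve cmp_sub cmp_negb cmp_andb cmp_orb | 1 : cmp.


Lemma cmp_leb {A} `{Enc A} (f g : A -> nat) :
  computable f -> computable g -> computable (fun a => Nat.leb (f a) (g a)).
Proof.
  intros. apply cmp_ext with (f := fun a => Nat.eqb (f a - g a) 0).
  - intros a. destruct (Nat.leb_spec (f a) (g a)); apply eq_true_iff_eq; rewrite Nat.eqb_eq.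
    + intuition lia.
    + split; intros; try discriminate; lia.
  - apply cmp_is_zero. cmp.
Qed.
#[global] Hint Resolve cmp_leb : cmp.

Lemma cmp_eqb {A} `{Enc A} (f g : A -> nat) :
  computable f -> computable g -> computable (fun a => Nat.eqb (f a) (g a)).
Proof.
  intros. apply cmp_ext with (f := fun a => andb (Nat.leb (f a) (g a)) (Nat.leb (g a) (f a))).
  - intros a. apply eq_true_iff_eq. rewrite Bool.andb_true_iff, !Nat.leb_le, Nat.eqb_eq. lia.
  - cmp.
Qed.
#[global] Hint Resolve cmp_eqb : cmp.

Definition enc_eqb {A} `{Enc A} (x y : A) : bool := Nat.eqb (enc x) (enc y).

Lemma enc_eqb_spec {A} `{Enc A} (x y : A) : enc_eqb x y = true <-> x = y.
Proof.
  unfold enc_eqb. rewrite Nat.eqb_eq. split. apply enc_inj. congruence.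
Qed.

Lemma cmp_enc_eqb {A B} `{Enc A} `{Enc B} (f g : A -> B) :
  computable f -> computable g -> computable (fun a => enc_eqb (f a) (g a)).
Proof. intros. unfold enc_eqb. cmp. Qed.
#[global] Hint Resolve cmp_enc_eqb : cmp.

Definition cpi1 (x : nat) := fst (Cantor.of_nat x).
Definition cpi2 (x : nat) := snd (Cantor.of_nat x).

Lemma cpi1_pair x y : cpi1 ⟨x, y⟩ = x.
Proof. unfold cpi1. rewrite Cantor.cancel_of_to. reflexivity. Qed.
Lemma cpi2_pair x y : cpi2 ⟨x, y⟩ = y.
Proof. unfold cpi2. rewrite Cantor.cancel_of_to. reflexivity. Qed.
Lemma cpi_eta x : ⟨cpi1 x, cpi2 x⟩ = x.
Proof. unfold cpi1, cpi2. rewrite <- surjective_pairing. apply Cantor.cancel_to_of. Qed.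

Lemma cmp_cpi1 {A} `{Enc A} (f : A -> nat) : computable f -> computable (fun a => cpi1 (f a)).
Proof.
  intros. apply cmp_comp with (f := cpi1); auto. exists pc_left. intros a. simpl.
  rewrite <- (cpi_eta a) at 1. constructor.
Qed.
Lemma cmp_cpi2 {A} `{Enc A} (f : A -> nat) : computable f -> computable (fun a => cpi2 (f a)).
Proof.
  intros. apply cmp_comp with (f := cpi2); auto. exists pc_right. intros a. simpl.
  rewrite <- (cpi_eta a) at 1. constructor.
Qed.
#[global] Hint Resolve cmp_cpi1 cmp_cpi2 : cmp.

Lemma cmp_to_nat {A} `{Enc A} (f g : A -> nat) :
  computable f -> computable g -> computable (fun a => ⟨f a, g a⟩).
Proof. intros. change (computable (fun a => enc (f a, g a))). cmp. Qed.
#[global] Hint Resolve cmp_to_nat : cmp.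

Lemma enc_list_length {A} `{Enc A} (l : list A) : length l <= enc l.
Proof.
  simpl. induction l as [|a l IH]; simpl. lia.
  pose proof (Cantor.to_nat_non_decreasing (enc a) (enc_list enc l)). lia.
Qed.

(** A step on pairs (rest of the list, accumulator) is iterated as often as the code of the list
    says. That code bounds the length, and surplus steps on an empty rest change nothing. *)
Lemma cmp_fold_left {D A B} `{Enc D} `{Enc A} `{Enc B} (f : D -> A -> B -> A) (l : D -> list B) (a0 : D -> A) :
  computable (fun p : D * (A * B) => f (fst p) (fst (snd p)) (snd (snd p))) ->
  computable l -> computable a0 ->
  computable (fun d => fold_left (f d) (l d) (a0 d)).
Proof.
  intros Hf Hl Ha.
  pose (step := fun d (q : list B * A) =>
     match fst q with [] => ([] : list B, snd q) | x :: t => (t, f d (snd q) x) end).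
  apply cmp_ext with (f := fun d => snd (nat_rect (fun _ => (list B * A)%type) (l d, a0 d) (fun _ q => step d q) (enc (l d)))).
  - intros d. pose proof (enc_list_length (l d)) as E. revert E. generalize (enc (l d)) as n.
    assert (G : forall n l a, (nat_rect (fun _ => (list B * A)%type) (l, a) (fun _ q => step d q) (S n)) =
       nat_rect (fun _ => (list B * A)%type) (step d (l, a)) (fun _ q => step d q) n).
    { intros n l' a. induction n as [|n IHn]; [reflexivity|]. cbn [nat_rect] in *. f_equal. f_equal. exact (IHn). }
    generalize (a0 d). induction (l d) as [|x t IH]; intros a n E; simpl.
    + induction n; simpl; auto. unfold step.
      assert (Q : forall n, fst (nat_rect (fun _ => (list B * A)%type) ([], a) (fun _ q => step d q) n) = []).
      { induction n0; simpl; auto. unfold step at 1. rewrite IHn0. reflexivity. }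
      rewrite Q. simpl. apply IHn. simpl; lia.
    + simpl in E. destruct n as [|n]; [lia|]. rewrite G. unfold step at 1. simpl. apply IH. lia.
  - apply cmp_snd. apply cmp_nat_rect; cmp. unfold step.
    apply cmp_list_case with (g := fun (p : D * (nat * (list B * A))) x (t : list B) => (t, f (fst p) (snd (snd (snd p))) x)); cmp.
    apply cmp_pair; cmp.
    apply (cmp_comp (f := fun p : D * (A * B) => f (fst p) (fst (snd p)) (snd (snd p)))
      (g := fun p : (D * (nat * (list B * A))) * (B * list B) => (fst (fst p), (snd (snd (snd (fst p))), fst (snd p)))));
    cmp.
Qed.


Lemma cmp_rev {D A} `{Enc D} `{Enc A} (l : D -> list A) : computable l -> computable (fun d => rev (l d)).
Proof.
  intros. apply cmp_ext with (f := fun d => fold_left (fun a x => x :: a) (l d) []).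
  - intros d. rewrite <- (fold_left_rev_right (fun x a => x :: a)). induction (rev (l d)); simpl; f_equal; auto.
  - apply cmp_fold_left with (f := fun _ a x => x :: a); cmp.
Qed.
#[global] Hint Resolve cmp_rev : cmp.

Section Lists.
Context {D A B : Type} `{Enc D} `{Enc A} `{Enc B}.

Lemma cmp_fold_right (f : D -> B -> A -> A) (l : D -> list B) (a0 : D -> A) :
  computable (fun p : D * (B * A) => f (fst p) (fst (snd p)) (snd (snd p))) ->
  computable l -> computable a0 ->
  computable (fun d => fold_right (f d) (a0 d) (l d)).
Proof.
  intros Hf Hl Ha. apply cmp_ext with (f := fun d => fold_left (fun a x => f d x a) (rev (l d)) (a0 d)).
  - intros d. rewrite <- fold_left_rev_right, rev_involutive. reflexivity.
  - apply cmp_fold_left with (f := fun d a x => f d x a); cmp.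
    apply (cmp_comp (f := fun p : D * (B * A) => f (fst p) (fst (snd p)) (snd (snd p)))
        (g := fun p : D * (A * B) => (fst p, (snd (snd p), fst (snd p))))); cmp.
Qed.

Lemma cmp_weak (f : D -> B -> A) :
  computable (fun p : D * B => f (fst p) (snd p)) ->
  forall C `{Enc C}, computable (fun p : D * (B * C) => f (fst p) (fst (snd p))).
Proof.
  intros Hf C HC.
  apply (cmp_comp (f := fun p : D * B => f (fst p) (snd p)) (g := fun p : D * (B * C) => (fst p, fst (snd p)))); cmp.
Qed.
End Lists.

Lemma skipn_nat_rect {B} n (l : list B) :
  nat_rect (fun _ => list B) l (fun _ r => match r with [] => [] | x :: t => t end) n = skipn n l.
Proof.
  revert l. induction n as [|n IH]; intros l; [reflexivity|]. cbn [nat_rect]. rewrite IH. clear.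
  revert l; induction n as [|n IH]; intros [|x l]; auto. change (skipn (S n) (x :: l)) with (skipn n l).
  rewrite IH. destruct l; auto.
Qed.

Section Lists2.
Context {D A B : Type} `{Enc D} `{Enc A} `{Enc B}.

Lemma cmp_app (l m : D -> list B) : computable l -> computable m -> computable (fun d => l d ++ m d).
Proof.
  intros. apply cmp_ext with (f := fun d => fold_right (fun x r => x :: r) (m d) (l d)).
  - intros d. induction (l d) as [|x t IH]; simpl; [|rewrite IH]; reflexivity.
  - apply cmp_fold_right with (f := fun _ x r => x :: r); cmp.
Qed.

Lemma cmp_map (f : D -> B -> A) (l : D -> list B) :
  computable (fun p : D * B => f (fst p) (snd p)) -> computable l ->
  computable (fun d => map (f d) (l d)).
Proof.
  intros Hf Hl. apply cmp_ext with (f := fun d => fold_right (fun x r => f d x :: r) [] (l d)).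
  - intros d. induction (l d) as [|x t IH]; simpl; [|rewrite IH]; reflexivity.
  - apply cmp_fold_right with (f := fun d x r => f d x :: r); cmp. apply cmp_cons; cmp.
    apply cmp_weak; auto.
Qed.

Lemma cmp_forallb (f : D -> B -> bool) (l : D -> list B) :
  computable (fun p : D * B => f (fst p) (snd p)) -> computable l ->
  computable (fun d => forallb (f d) (l d)).
Proof.
  intros Hf Hl. apply cmp_ext with (f := fun d => fold_right (fun x r => andb (f d x) r) true (l d)).
  - intros d. induction (l d) as [|x t IH]; simpl; [|rewrite IH]; reflexivity.
  - apply cmp_fold_right with (f := fun d x r => andb (f d x) r); cmp. apply cmp_andb; cmp.
    apply cmp_weak; auto.
Qed.

Lemma cmp_existsb (f : D -> B -> bool) (l : D -> list B) :
  computable (fun p : D * B => f (fst p) (snd p)) -> computable l ->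
  computable (fun d => existsb (f d) (l d)).
Proof.
  intros Hf Hl. apply cmp_ext with (f := fun d => fold_right (fun x r => orb (f d x) r) false (l d)).
  - intros d. induction (l d) as [|x t IH]; simpl; [|rewrite IH]; reflexivity.
  - apply cmp_fold_right with (f := fun d x r => orb (f d x) r); cmp. apply cmp_orb; cmp.
    apply cmp_weak; auto.
Qed.

Lemma cmp_filter (f : D -> B -> bool) (l : D -> list B) :
  computable (fun p : D * B => f (fst p) (snd p)) -> computable l ->
  computable (fun d => filter (f d) (l d)).
Proof.
  intros Hf Hl. apply cmp_ext with (f := fun d => fold_right (fun x r => if f d x then x :: r else r) [] (l d)).
  - intros d. induction (l d) as [|x t IH]; simpl; [|rewrite IH]; reflexivity.
  - apply cmp_fold_right with (f := fun d x r => if f d x then x :: r else r); cmp. apply cmp_if; cmp.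
    apply cmp_weak; auto.
Qed.

Lemma cmp_length (l : D -> list B) : computable l -> computable (fun d => length (l d)).
Proof.
  intros Hl. apply cmp_ext with (f := fun d => fold_right (fun x r => S r) 0 (l d)).
  - intros d. induction (l d) as [|x t IH]; simpl; [|rewrite IH]; reflexivity.
  - apply cmp_fold_right with (f := fun d x r => S r); cmp.
Qed.

Lemma cmp_seq (f g : D -> nat) : computable f -> computable g -> computable (fun d => seq (f d) (g d)).
Proof.
  intros Hf Hl. apply cmp_ext with (f := fun d => nat_rect (fun _ => list nat) [] (fun n r => r ++ [f d + n]) (g d)).
  - intros d. induction (g d); simpl; auto. rewrite IHn, <- seq_S. reflexivity.
  - apply cmp_nat_rect with (s := fun d n r => r ++ [f d + n]); cmp.
    apply cmp_ext with (f := fun p : D * (nat * list nat) => fold_right (fun x r => x :: r) [f (fst p) + fst (snd p)] (snd (snd p))).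
    + intros d. induction (snd (snd d)) as [|x t IH]; simpl; [|rewrite <- IH]; reflexivity.
    + apply cmp_fold_right with (f := fun _ x r => x :: r); cmp. apply cmp_cons; cmp. apply cmp_add; cmp.
      apply cmp_comp with (f := f) (g := fst); cmp.
Qed.

Lemma cmp_nth (l : D -> list B) (n : D -> nat) (b : D -> B) :
  computable l -> computable n -> computable b -> computable (fun d => nth (n d) (l d) (b d)).
Proof.
  intros Hl Hn Hb.
  apply cmp_ext with (f := fun d => match nat_rect (fun _ => list B) (l d) (fun _ r => match r with [] => [] | x :: t => t end) (n d)
     with [] => b d | x :: _ => x end).
  - intros d. rewrite skipn_nat_rect. generalize (n d). induction (l d) as [|x t IH]; intros [|m]; auto. apply IH.
  - apply cmp_list_case; cmp.
Qed.
End Lists2.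
#[global] Hint Resolve cmp_app cmp_map cmp_fold_right cmp_forallb cmp_existsb cmp_filter cmp_length cmp_seq cmp_nth : cmp.

Lemma cmp_flat_map {D A B} `{Enc D} `{Enc A} `{Enc B} (f : D -> B -> list A) (l : D -> list B) :
  computable (fun p : D * B => f (fst p) (snd p)) -> computable l ->
  computable (fun d => flat_map (f d) (l d)).
Proof.
  intros Hf Hl. apply cmp_ext with (f := fun d => fold_right (fun x r => f d x ++ r) [] (l d)).
  - intros d. induction (l d) as [|x t IH]; simpl; [|rewrite IH]; reflexivity.
  - apply cmp_fold_right with (f := fun d x r => f d x ++ r); cmp. apply cmp_app; cmp.
    apply cmp_weak; auto.
Qed.
Lemma cmp_skipn {D B} `{Enc D} `{Enc B} (l : D -> list B) (n : D -> nat) :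
  computable l -> computable n -> computable (fun d => skipn (n d) (l d)).
Proof.
  intros Hl Hn.
  apply cmp_ext with (f := fun d => nat_rect (fun _ => list B) (l d) (fun _ r => match r with [] => [] | x :: t => t end) (n d)).
  - intros d. apply skipn_nat_rect.
  - apply cmp_nat_rect; cmp.
Qed.
Lemma cmp_firstn {D B} `{Enc D} `{Enc B} (l : D -> list B) (n : D -> nat) :
  computable l -> computable n -> computable (fun d => firstn (n d) (l d)).
Proof.
  intros Hl Hn.
  apply cmp_ext with (f := fun d => rev (skipn (length (l d) - n d) (rev (l d)))).
  - intros d. rewrite skipn_rev, rev_involutive.
    destruct (Nat.le_gt_cases (n d) (length (l d))).
    + f_equal. lia.
    + rewrite !firstn_all2; auto; lia.
  - apply cmp_rev, cmp_skipn; cmp.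
Qed.
#[global] Hint Resolve cmp_flat_map cmp_skipn cmp_firstn : cmp.

(** * Recursion on fuel over a computable tree of dependencies *)

Section Fueled.
Context {A B : Type} `{Enc A} `{Enc B}.
Variables (b0 : A -> B) (deps : A -> list A) (step : A -> list B -> B).

Fixpoint frec (s : nat) (a : A) : B :=
  match s with
  | 0 => b0 a
  | S s => step a (map (frec s) (deps a))
  end.

(** The nodes at depth [i] of the dependency tree of [a], in order and with repetitions. *)
Definition level (a : A) (i : nat) : list A :=
  nat_rect (fun _ => list A) [a] (fun _ l => flat_map deps l) i.

(** Passes from the values of one level to those of the level above: each node of [l] consumes as
    many entries of [vals] as it has dependencies. *)
Definition collapse (l : list A) (vals : list B) : list B :=
  snd (fold_left (fun st x => (skipn (length (deps x)) (fst st),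
    snd st ++ [step x (firstn (length (deps x)) (fst st))])) l (vals, [])).

Lemma collapse_frec s l : collapse l (map (frec s) (flat_map deps l)) = map (frec (S s)) l.
Proof.
  unfold collapse. change (map (frec (S s)) l) with ([] ++ map (frec (S s)) l).
  generalize (@nil B) at 2 3. induction l as [|x l IH]; intros out; simpl.
  - rewrite app_nil_r. reflexivity.
  - rewrite map_app, skipn_app, firstn_app, length_map, Nat.sub_diag.
    rewrite skipn_all2, firstn_all2 by (rewrite length_map; auto).
    simpl. rewrite app_nil_r, IH. rewrite <- app_assoc. reflexivity.
Qed.

Lemma frec_levels s a j : j <= s ->
  nat_rect (fun _ => list B) (map b0 (level a s)) (fun j r => collapse (level a (s - S j)) r) j
  = map (frec j) (level a (s - j)).
Proof.
  induction j as [|j IH]; intros Hj.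
  - rewrite Nat.sub_0_r. reflexivity.
  - cbn [nat_rect]. rewrite IH by lia. replace (s - j) with (S (s - S j)) by lia.
    apply collapse_frec.
Qed.

(** The tree recursion becomes primitive recursion by working level by level from the bottom: level
    [s] gets default values, and [s] collapses bring the values up to the root. *)
Lemma cmp_frec D `{Enc D} (s : D -> nat) (a : D -> A) :
  computable b0 -> computable deps ->
  computable (fun p : A * list B => step (fst p) (snd p)) ->
  computable s -> computable a -> computable (fun d => frec (s d) (a d)).
Proof.
  intros Hb Hd Hst Hs Ha.
  assert (Hlev : computable (fun p : A * nat => level (fst p) (snd p))).
  { unfold level. apply cmp_nat_rect with (s := fun _ _ l => flat_map deps l); cmp.
    apply cmp_flat_map with (f := fun _ => deps); cmp. apply cmp_comp; cmp. }
  assert (Hlev2 : forall E (HE : Enc E) (f : E -> A) (g : E -> nat), computable f -> computable g -> computable (fun e => level (f e) (g e))).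
  { intros. apply (cmp_comp (f := fun p : A * nat => level (fst p) (snd p)) (g := fun e => (f e, g e))); cmp. }
  apply cmp_ext with (f := fun d => match
    nat_rect (fun _ => list B) (map b0 (level (a d) (s d))) (fun j r => collapse (level (a d) (s d - S j)) r) (s d)
    with [] => b0 (a d) | x :: _ => x end).
  - intros d. rewrite frec_levels by auto. rewrite Nat.sub_diag. reflexivity.
  - apply cmp_list_case; cmp; [|apply cmp_comp; auto].
    apply cmp_nat_rect with (s := fun d j r => collapse (level (a d) (s d - S j)) r); auto.
    + apply cmp_map; cmp. apply cmp_comp with (f := b0) (g := snd); cmp.
    + unfold collapse. apply cmp_snd.
      apply cmp_fold_left with (f := fun (_ : D * (nat * list B)) st x => (skipn (length (deps x)) (fst st),
         snd st ++ [step x (firstn (length (deps x)) (fst st))])).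
      * assert (Hl : computable (fun p : D * (nat * list B) * (list B * list B * A) => length (deps (snd (snd p))))).
        { apply cmp_length. apply cmp_comp; cmp. }
        apply cmp_pair; cmp. apply cmp_app; cmp. apply cmp_cons; cmp.
        apply (cmp_comp (f := fun p : A * list B => step (fst p) (snd p))
          (g := fun p : D * (nat * list B) * (list B * list B * A) => (snd (snd p), firstn (length (deps (snd (snd p)))) (fst (fst (snd p)))))); cmp.
      * apply Hlev2. apply cmp_comp; cmp. apply cmp_sub; cmp. apply cmp_comp; cmp.
      * cmp.
Qed.
End Fueled.

(** Boolean variant: the step sees the list of those dependencies that hold. *)
Section FueledBool.
Context {A : Type} `{Enc A}.
Variables (deps : A -> list A) (step : A -> list A -> bool).

Fixpoint brec (s : nat) (a : A) : bool :=
  match s with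
  | 0 => false
  | S s => step a (filter (brec s) (deps a))
  end.

Lemma cmp_brec D `{Enc D} (s : D -> nat) (a : D -> A) :
  computable deps ->
  computable (fun p : A * list A => step (fst p) (snd p)) ->
  computable s -> computable a -> computable (fun d => brec (s d) (a d)).
Proof.
  intros Hd Hst Hs Ha.
  (* Each value carries its own argument along, so that filtering the results recovers which
     dependencies hold. *)
  apply cmp_ext with (f := fun d => snd (frec (fun a => (a, false)) deps
     (fun a rs => (a, step a (map fst (filter snd rs)))) (s d) (a d))).
  - intros d. generalize (a d). induction (s d) as [|n IH]; intros x; simpl; auto.
    f_equal. assert (G : forall y, fst (frec (fun a => (a, false)) deps
     (fun a rs => (a, step a (map fst (filter snd rs)))) n y) = y) by (destruct n; auto).
    induction (deps x) as [|y l IHl]; simpl; auto. rewrite IH.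
    destruct (brec n y); simpl; rewrite IHl; auto. rewrite G. auto.
  - apply cmp_snd. apply cmp_frec with (step := fun a (rs : list (A * bool)) => (a, step a (map fst (filter snd rs)))); cmp.
    apply cmp_pair; cmp.
    apply (cmp_comp (f := fun p : A * list A => step (fst p) (snd p))
      (g := fun p : A * list (A * bool) => (fst p, map fst (filter snd (snd p))))); cmp.
Qed.
End FueledBool.

Definition mem {A} `{Enc A} (x : A) (l : list A) : bool := existsb (enc_eqb x) l.

Lemma mem_In {A} `{Enc A} (x : A) l : mem x l = true <-> In x l.
Proof.
  unfold mem. rewrite existsb_exists. split.
  - intros (y & Hy & E). apply (enc_eqb_spec x y) in E. subst. auto.
  - intros Hx. exists x. split; auto. apply (enc_eqb_spec x x). auto.
Qed.

Lemma cmp_mem {A D} `{Enc A} `{Enc D} (x : D -> A) (l : D -> list A) :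
  computable x -> computable l -> computable (fun d => mem (x d) (l d)).
Proof.
  intros. unfold mem. apply cmp_existsb with (f := fun d => enc_eqb (x d)); cmp.
  apply cmp_enc_eqb; cmp. apply cmp_comp; cmp.
Qed.
#[global] Hint Resolve cmp_mem : cmp.

(** Surjectivity of a computable decoding is what turns an existential quantifier over [B] into one
    over [nat]. Several numbers may decode to the same object, and [dcd] need not invert [enc]. *)
Class Cod (B : Type) `{Enc B} := {
  dcd : nat -> B;
  dcd_cmp : computable dcd;
  dcd_surj : forall b, exists n, dcd n = b }.

Arguments Cod B {_}.

Lemma cmp_dcd {B D} `{Cod B} `{Enc D} (f : D -> nat) : computable f -> computable (fun d => dcd (f d)).
Proof. intros. apply cmp_comp; auto. apply dcd_cmp. Qed.
#[global] Hint Resolve cmp_dcd : cmp.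

#[global] Instance Cod_nat : Cod nat.
Proof.
  refine {| dcd := fun n => n |}. apply cmp_id. eauto.
Defined.

#[global] Instance Cod_prod {A B} `{Cod A} `{Cod B} : Cod (A * B).
Proof.
  refine {| dcd := fun n => (dcd (cpi1 n), dcd (cpi2 n)) |}.
  - cmp.
  - intros [a b]. destruct (dcd_surj a) as [n Hn], (dcd_surj b) as [m Hm].
    exists ⟨n, m⟩. rewrite cpi1_pair, cpi2_pair. congruence.
Defined.

(** The code itself serves as the number of iterations, as it is at least the length of the list;
    [0] codes the empty list and stops the unpacking. *)
Definition unlist (n : nat) : list nat :=
  snd (nat_rect (fun _ => (nat * list nat)%type) (n, [])
    (fun _ q => if Nat.eqb (fst q) 0 then q
      else (cpi2 (pred (fst q)), snd q ++ [cpi1 (pred (fst q))])) n).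

Lemma unlist_enc (l : list nat) : unlist (enc l) = l.
Proof.
  unfold unlist. set (st := fun q : nat * list nat => if Nat.eqb (fst q) 0 then q
      else (cpi2 (pred (fst q)), snd q ++ [cpi1 (pred (fst q))])).
  assert (G : forall n q, nat_rect (fun _ => (nat * list nat)%type) q (fun _ => st) (S n)
     = nat_rect (fun _ => (nat * list nat)%type) (st q) (fun _ => st) n).
  { induction n as [|n IH]; intros q; [reflexivity|]. cbn [nat_rect] in *. rewrite IH. auto. }
  assert (G0 : forall n l, nat_rect (fun _ => (nat * list nat)%type) (0, l) (fun _ => st) n = (0, l)).
  { induction n as [|n IH]; intros l'; auto. rewrite G. apply IH. }
  cut (forall n acc, length l <= n -> snd (nat_rect (fun _ => (nat * list nat)%type) (enc l, acc) (fun _ => st) n) = acc ++ l).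
  { intros Q. apply Q. apply enc_list_length. }
  induction l as [|x l IH]; intros n acc Hn.
  - change (enc []) with 0. rewrite G0, app_nil_r. reflexivity.
  - simpl in Hn. destruct n as [|n]; [lia|]. rewrite G.
    assert (E : st (enc (x :: l), acc) = (enc l, acc ++ [x])).
    { unfold st. change (enc (x :: l)) with (S ⟨x, enc l⟩). cbn [fst snd Nat.eqb pred].
      rewrite cpi1_pair, cpi2_pair. reflexivity. }
    rewrite E, IH by lia. rewrite <- app_assoc. reflexivity.
Qed.

Lemma cmp_unlist {D} `{Enc D} (f : D -> nat) : computable f -> computable (fun d => unlist (f d)).
Proof.
  intros. apply cmp_comp; auto. unfold unlist. apply cmp_snd.
  apply cmp_nat_rect with (s := fun _ _ q => if Nat.eqb (fst q) 0 then q
      else (cpi2 (pred (fst q)), snd q ++ [cpi1 (pred (fst q))])); cmp.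
Qed.
#[global] Hint Resolve cmp_unlist : cmp.

#[global] Instance Cod_list {A} `{Cod A} : Cod (list A).
Proof.
  refine {| dcd := fun n => map dcd (unlist n) |}.
  - apply cmp_map with (f := fun _ => dcd); cmp.
  - intros l. assert (E : exists m, map dcd m = l).
    { induction l as [|a l [m <-]]. exists []; auto.
      destruct (dcd_surj a) as [n <-]. exists (n :: m). auto. }
    destruct E as [m <-]. exists (enc m). rewrite unlist_enc. auto.
Defined.

(** * Recursively enumerable predicates and their closure properties *)

Definition RE {A} `{Enc A} (P : A -> Prop) : Prop :=
  exists f : A * nat -> bool, computable f /\ forall a, P a <-> exists w, f (a, w) = true.

Section RE.
Context {A : Type} `{Enc A}.

Lemma re_ext (P Q : A -> Prop) : (forall a, P a <-> Q a) -> RE P -> RE Q.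
Proof. intros E (f & Hf & Hs). exists f. split; auto. intros a. rewrite <- E. auto. Qed.

Lemma re_dec (f : A -> bool) : computable f -> RE (fun a => f a = true).
Proof.
  intros Hf. exists (fun p => f (fst p)). split.
  - apply cmp_comp; cmp.
  - intros a. simpl. split; [exists 0; auto | intros [w E]; auto].
Qed.

Lemma re_sub {B} `{Enc B} (P : B -> Prop) (g : A -> B) : computable g -> RE P -> RE (fun a => P (g a)).
Proof.
  intros Hg (f & Hf & Hs). exists (fun p => f (g (fst p), snd p)). split.
  - apply (cmp_comp (f := f) (g := fun p : A * nat => (g (fst p), snd p))); auto.
    apply cmp_pair; cmp. apply cmp_comp; cmp.
  - intros a. rewrite Hs. reflexivity.
Qed.

Lemma re_and (P Q : A -> Prop) : RE P -> RE Q -> RE (fun a => P a /\ Q a).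
Proof.
  intros (f & Hf & Hs) (g & Hg & Ht).
  exists (fun p => f (fst p, cpi1 (snd p)) && g (fst p, cpi2 (snd p))). split.
  - apply cmp_andb; apply cmp_comp; cmp.
  - intros a. rewrite Hs, Ht. simpl. split.
    + intros [[w Hw] [v Hv]]. exists ⟨w, v⟩. rewrite cpi1_pair, cpi2_pair, Hw, Hv. auto.
    + intros [w Hw]. apply andb_true_iff in Hw. destruct Hw; eauto.
Qed.

Lemma re_or (P Q : A -> Prop) : RE P -> RE Q -> RE (fun a => P a \/ Q a).
Proof.
  intros (f & Hf & Hs) (g & Hg & Ht).
  exists (fun p => f p || g p). split.
  - cmp.
  - intros a. rewrite Hs, Ht. simpl. split.
    + intros [[w Hw]|[w Hw]]; exists w; rewrite Hw; auto. apply orb_true_r.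
    + intros [w Hw]. apply orb_true_iff in Hw. destruct Hw; eauto.
Qed.

Lemma re_ex {B} `{Cod B} (P : A -> B -> Prop) :
  RE (fun p : A * B => P (fst p) (snd p)) -> RE (fun a => exists b, P a b).
Proof.
  intros (f & Hf & Hs).
  exists (fun p => f ((fst p, dcd (cpi1 (snd p))), cpi2 (snd p))). split.
  - apply cmp_comp; cmp.
  - intros a. simpl. split.
    + intros [b Hb]. apply (Hs (a, b)) in Hb. destruct Hb as [w Hw].
      destruct (dcd_surj b) as [n Hn]. exists ⟨n, w⟩. rewrite cpi1_pair, cpi2_pair, Hn. auto.
    + intros [w Hw]. exists (dcd (cpi1 w)). apply (Hs (a, _)). eauto.
Qed.

(** Finitely many witnesses have a common strict bound, and this bound is the witness for the
    bounded quantifier. *)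
Lemma re_all_list {B} `{Enc B} (l : A -> list B) (P : A -> B -> Prop) :
  computable l -> RE (fun p : A * B => P (fst p) (snd p)) ->
  RE (fun a => forall b, In b (l a) -> P a b).
Proof.
  intros Hl (f & Hf & Hs).
  exists (fun p => forallb (fun b => existsb (fun w => f ((fst p, b), w)) (seq 0 (snd p))) (l (fst p))).
  split.
  - apply cmp_forallb with (f := fun p b => existsb (fun w => f ((fst p, b), w)) (seq 0 (snd p))).
    + apply cmp_existsb with (f := fun (p : A * nat * B) w => f ((fst (fst p), snd p), w)); cmp.
      apply cmp_comp; cmp.
    + apply cmp_comp; cmp.
  - intros a. simpl. split.
    + intros HP. assert (E : exists w, forall b, In b (l a) -> exists v, v < w /\ f (a, b, v) = true).
      { induction (l a) as [|b l' IH].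
        - exists 0. intros b [].
        - destruct IH as [w Hw]. intros; apply HP; simpl; auto.
          destruct (proj1 (Hs (a, b)) (HP b (or_introl eq_refl))) as [v Hv].
          exists (S v + w). intros b' [<-|Hb]. exists v; split; auto; lia.
          destruct (Hw b' Hb) as (u & Hu & E). exists u; split; auto; lia. }
      destruct E as [w Hw]. exists w. apply forallb_forall. intros b Hb. apply existsb_exists.
      destruct (Hw b Hb) as (v & Hv & E). exists v. split; auto. apply in_seq. lia.
    + intros [w Hw] b Hb. rewrite forallb_forall in Hw. specialize (Hw b Hb).
      apply existsb_exists in Hw. destruct Hw as (v & _ & Hv). apply (Hs (a, b)). eauto.
Qed.
End RE.

(** * Automation for computability, and bounded simulation of all codes *)

Ltac cmp_more := fail.
Ltac cmp_step := cbn beta; first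
  [ assumption | simple apply cmp_const | simple apply cmp_id | simple apply cmp_pair
  | simple apply cmp_cons | simple apply cmp_to_nat | simple eapply cmp_fst | simple eapply cmp_snd
  | simple apply cmp_succ | simple apply cmp_pred | simple apply cmp_add | simple apply cmp_sub
  | simple apply cmp_cpi1 | simple apply cmp_cpi2 | simple apply cmp_negb
  | simple apply cmp_andb | simple apply cmp_orb | simple apply cmp_leb | simple apply cmp_eqb
  | simple eapply cmp_enc_eqb | simple eapply cmp_mem | simple apply cmp_app | simple apply cmp_seq
  | simple eapply cmp_length | simple apply cmp_nth | simple apply cmp_if
  | simple eapply cmp_dcd | simple apply cmp_unlist | simple apply cmp_rev
  | simple eapply cmp_map | simple eapply cmp_flat_map | simple eapply cmp_filter
  | simple eapply cmp_existsb | simple eapply cmp_forallb | simple eapply cmp_fold_right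
  | simple eapply cmp_list_case | simple apply cmp_nat_rect | cmp_more ].
Ltac cmps := repeat cmp_step.

(** A query is [(k, (b, (e, (x, y))))]: for [k = 0] it asks whether [e] is the index of a
    code, otherwise whether [phi e x y] has a derivation with intermediate values at most [b]. *)
Notation query := (nat * (nat * (nat * (nat * nat))))%type.

Definition qcode (b e : nat) : query := (0, (b, (e, (0, 0)))).
Definition qrun (b e x y : nat) : query := (1, (b, (e, (x, y)))).

Section Steps.
Variables (b e x y : nat).
Let t := cpi1 e.
Let c := cpi1 (cpi2 e).
Let d := cpi2 (cpi2 e).

Definition code_deps : list query := [qcode b c; qcode b d; qcode b (cpi2 e)].

Definition code_step (l : list query) : bool :=
  Nat.leb t 3 && Nat.eqb (cpi2 e) 0
  || Nat.leb 4 t && Nat.leb t 6 && (mem (qcode b c) l && mem (qcode b d) l)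
  || Nat.eqb t 7 && mem (qcode b (cpi2 e)) l.

(** Every subquery that some constructor of codes could need, whatever the tag of [e] is.
    Intermediate values of compositions and recursions, and the predecessors of the nonzero values
    in a minimisation, range over [0 .. b]. *)
Definition run_deps : list query :=
  [qcode b d; qrun b c x (cpi1 y); qrun b d x (cpi2 y); qrun b c (cpi1 x) y; qrun b (cpi2 e) ⟨x, y⟩ 0]
  ++ flat_map (fun a => [qrun b d x a; qrun b c a y; qrun b e ⟨cpi1 x, pred (cpi2 x)⟩ a;
       qrun b d ⟨cpi1 x, ⟨pred (cpi2 x), a⟩⟩ y]) (seq 0 (S b))
  ++ flat_map (fun m => map (fun k => qrun b (cpi2 e) ⟨x, m⟩ (S k)) (seq 0 (S b))) (seq 0 y).

(** The base case of primitive recursion never runs [d], so whether [d] is the index of a code has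
    to be asked separately; this is what the queries with first component [0] serve for. *)
Definition run_step (l : list query) : bool :=
  Nat.eqb e ⟨0, 0⟩ && Nat.eqb y 0
  || Nat.eqb e ⟨1, 0⟩ && Nat.eqb y (S x)
  || Nat.eqb e ⟨2, 0⟩ && Nat.eqb y (cpi1 x)
  || Nat.eqb e ⟨3, 0⟩ && Nat.eqb y (cpi2 x)
  || Nat.eqb t 4 && (mem (qrun b c x (cpi1 y)) l && mem (qrun b d x (cpi2 y)) l)
  || Nat.eqb t 5 && existsb (fun a => mem (qrun b d x a) l && mem (qrun b c a y) l) (seq 0 (S b))
  || Nat.eqb t 6 && Nat.eqb (cpi2 x) 0 && (mem (qcode b d) l && mem (qrun b c (cpi1 x) y) l)
  || Nat.eqb t 6 && negb (Nat.eqb (cpi2 x) 0) &&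
       existsb (fun a => mem (qrun b e ⟨cpi1 x, pred (cpi2 x)⟩ a) l
         && mem (qrun b d ⟨cpi1 x, ⟨pred (cpi2 x), a⟩⟩ y) l) (seq 0 (S b))
  || Nat.eqb t 7 && mem (qrun b (cpi2 e) ⟨x, y⟩ 0) l &&
       forallb (fun m => existsb (fun k => mem (qrun b (cpi2 e) ⟨x, m⟩ (S k)) l) (seq 0 (S b))) (seq 0 y).
End Steps.

Definition phi_deps (q : query) : list query :=
  let b := fst (snd q) in let e := fst (snd (snd q)) in
  let x := fst (snd (snd (snd q))) in let y := snd (snd (snd (snd q))) in
  if Nat.eqb (fst q) 0 then code_deps b e else run_deps b e x y.

Definition phi_step (q : query) (l : list query) : bool :=
  let b := fst (snd q) in let e := fst (snd (snd q)) in
  let x := fst (snd (snd (snd q))) in let y := snd (snd (snd (snd q))) in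
  if Nat.eqb (fst q) 0 then code_step b e l else run_step b e x y l.

Definition runs : nat -> query -> bool := brec phi_deps phi_step.

Lemma runs_code s b e : runs s (qcode b e) = true -> exists c, pc_index c = e.
Proof.
  revert e. induction s as [|s IH]; intros e E; [discriminate|].
  change (code_step b e (filter (runs s) (code_deps b e)) = true) in E.
  assert (Q : forall e', mem (qcode b e') (filter (runs s) (code_deps b e)) = true -> exists c, pc_index c = e').
  { intros e' Hm. apply mem_In, filter_In in Hm. apply IH, Hm. }
  unfold code_step in E. rewrite !orb_true_iff, !andb_true_iff, !Nat.leb_le, !Nat.eqb_eq in E.
  destruct E as [[[H1 H2]|[[H1 H2] [H3 H4]]]|[H1 H2]].
  - rewrite <- (cpi_eta e), H2. destruct (cpi1 e) as [|[|[|[|]]]]; [exists pc_zero|exists pc_succ|exists pc_left|exists pc_right|lia]; reflexivity.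
  - apply Q in H3, H4. destruct H3 as [c Hc], H4 as [d Hd].
    rewrite <- (cpi_eta e), <- (cpi_eta (cpi2 e)), <- Hc, <- Hd.
    destruct (cpi1 e) as [|[|[|[|[|[|[|]]]]]]]; try lia;
      [exists (pc_pair c d)|exists (pc_comp c d)|exists (pc_prec c d)]; reflexivity.
  - apply Q in H2. destruct H2 as [c Hc]. rewrite <- (cpi_eta e), H1, <- Hc. exists (pc_mu c). reflexivity.
Qed.

Lemma code_tag c : cpi1 (pc_index c) = match c with pc_zero => 0 | pc_succ => 1 | pc_left => 2
  | pc_right => 3 | pc_pair _ _ => 4 | pc_comp _ _ => 5 | pc_prec _ _ => 6 | pc_mu _ => 7 end.
Proof. destruct c; cbn [pc_index]; apply cpi1_pair. Qed.

Lemma code_arg c : cpi2 (pc_index c) = match c with pc_pair c d | pc_comp c d | pc_prec c d => ⟨pc_index c, pc_index d⟩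
  | pc_mu c => pc_index c | _ => 0 end.
Proof. destruct c; cbn [pc_index]; apply cpi2_pair. Qed.

Lemma pc_index_inj c d : pc_index c = pc_index d -> c = d.
Proof.
  revert d. induction c; intros d E; pose proof (f_equal cpi1 E) as E1; pose proof (f_equal cpi2 E) as E2;
    rewrite !code_tag in E1; rewrite !code_arg in E2; destruct d; try discriminate; auto;
    try (apply to_nat_inj in E2; destruct E2; f_equal; auto); try (f_equal; auto).
Qed.

Lemma runs_phi s b e x y : runs s (qrun b e x y) = true -> phi e x y.
Proof.
  revert e x y. induction s as [|s IH]; intros e x y E; [discriminate|].
  change (run_step b e x y (filter (runs s) (run_deps b e x y)) = true) in E.
  set (L := run_deps b e x y) in E. clearbody L.
  unfold run_step in E. rewrite !orb_true_iff in E.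
  assert (M : forall e' x' y', mem (qrun b e' x' y') (filter (runs s) L) = true -> phi e' x' y').
  { intros e' x' y' Hm. apply mem_In, filter_In in Hm. apply IH, Hm. }
  assert (V : forall e', mem (qcode b e') (filter (runs s) L) = true -> exists c, pc_index c = e').
  { intros e' Hm. apply mem_In, filter_In in Hm. destruct Hm as [_ Hm]. eapply runs_code. apply Hm. }
  rewrite !andb_true_iff, !Nat.eqb_eq, !existsb_exists in E.
  destruct E as [[[[[[[[[E1 E2]|[E1 E2]]|[E1 E2]]|[E1 E2]]|[E1 [E2 E3]]]|[E1 (a & _ & E2)]]|[[E1 E2] [E3 E4]]]|[[E1 E2] (a & _ & E3)]]|[[E1 E2] E3]].
  - subst. exists pc_zero. split; auto. constructor.
  - subst. exists pc_succ. split; auto. constructor.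
  - subst. exists pc_left. split; auto. rewrite <- (cpi_eta x) at 1. constructor.
  - subst. exists pc_right. split; auto. rewrite <- (cpi_eta x) at 1. constructor.
  - apply M in E2, E3. destruct E2 as (c & Hc & E2), E3 as (d & Hd & E3).
    exists (pc_pair c d). split.
    + cbn [pc_index]. rewrite Hc, Hd, cpi_eta, <- E1, cpi_eta. auto.
    + rewrite <- (cpi_eta y). constructor; auto.
  - apply andb_true_iff in E2. destruct E2 as [E2 E3].
    apply M in E2, E3. destruct E2 as (d & Hd & E2), E3 as (c & Hc & E3).
    exists (pc_comp c d). split.
    + cbn [pc_index]. rewrite Hc, Hd, cpi_eta, <- E1, cpi_eta. auto.
    + econstructor; eauto.
  - apply V in E3. apply M in E4. destruct E3 as (d & Hd), E4 as (c & Hc & E4).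
    exists (pc_prec c d). split.
    + cbn [pc_index]. rewrite Hc, Hd, cpi_eta, <- E1, cpi_eta. auto.
    + rewrite <- (cpi_eta x), E2. constructor; auto.
  - apply andb_true_iff in E3. destruct E3 as [E3 E4].
    apply M in E3, E4. destruct E3 as (c & Hc & E3), E4 as (d & Hd & E4).
    apply negb_true_iff, Nat.eqb_neq in E2.
    (* The recursive call concerns [e] itself, so it already supplies a code for [e]; its tag is 6,
       and injectivity of indices identifies its step part with [d]. *)
    assert (Q : exists c', c = pc_prec c' d).
    { pose proof (f_equal cpi1 Hc) as T1. pose proof (f_equal cpi2 Hc) as T2.
      rewrite code_tag, E1 in T1. rewrite code_arg in T2. destruct c; try discriminate.
      rewrite <- T2, cpi2_pair in Hd. apply pc_index_inj in Hd. subst. eauto. }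
    destruct Q as [c' ->]. exists (pc_prec c' d). split; auto.
    rewrite <- (cpi_eta x). destruct (cpi2 x) as [|n]; [lia|]. econstructor; eauto.
  - apply M in E2. destruct E2 as (c & Hc & E2).
    exists (pc_mu c). split.
    + cbn [pc_index]. rewrite Hc, <- E1, cpi_eta. auto.
    + constructor; auto. intros m Hm. rewrite forallb_forall in E3.
      specialize (E3 m). rewrite in_seq, existsb_exists in E3.
      destruct (E3 ltac:(lia)) as (k & _ & Hk). apply M in Hk. destruct Hk as (c' & Hc' & Hk).
      exists k. replace c with c'; auto. apply pc_index_inj. congruence.
Qed.

Lemma runs_code_complete c : exists s0, forall s b, s0 <= s -> runs s (qcode b (pc_index c)) = true.
Proof.
  assert (St : forall s b e, runs (S s) (qcode b e) = code_step b e (filter (runs s) (code_deps b e))) by reflexivity.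
  induction c as [| | | |c [s1 H1] d [s2 H2]|c [s1 H1] d [s2 H2]|c [s1 H1] d [s2 H2]|c [s1 H1]];
    [exists 1|exists 1|exists 1|exists 1|exists (S (s1+s2))|exists (S (s1+s2))|exists (S (s1+s2))|exists (S s1)];
    intros [|s] b Hs; try lia; rewrite St; unfold code_step, code_deps; rewrite code_tag, code_arg, ?cpi1_pair, ?cpi2_pair;
    auto.
  1-3: rewrite !orb_true_iff, !andb_true_iff, !mem_In, !filter_In; left; right;
    (repeat split); simpl; auto; first [apply H1|apply H2]; lia.
  rewrite !orb_true_iff, !andb_true_iff, !mem_In, !filter_In; right; simpl; auto. repeat split; auto. apply H1. lia.
Qed.

(** Fuel [s] and value bound [b] may both be raised freely, so finitely many successful runs can be
    given common bounds. *)
Definition eventually (P : nat -> nat -> Prop) := exists n, forall s b, n <= s -> n <= b -> P s b.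

Lemma ev_and P Q : eventually P -> eventually Q -> eventually (fun s b => P s b /\ Q s b).
Proof. intros [n Hn] [m Hm]. exists (n + m). intros. split; [apply Hn|apply Hm]; lia. Qed.

Lemma ev_impl (P Q : nat -> nat -> Prop) : (forall s b, P s b -> Q s b) -> eventually P -> eventually Q.
Proof. intros H [n Hn]. exists n. auto. Qed.

Lemma ev_bound (P : nat -> nat -> Prop) : forall v, eventually P -> eventually (fun s b => P s b /\ v <= b).
Proof. intros v [n Hn]. exists (n + v). intros. split; [apply Hn|]; lia. Qed.

Lemma ev_forall n (P : nat -> nat -> nat -> Prop) : (forall m, m < n -> eventually (P m)) ->
  eventually (fun s b => forall m, m < n -> P m s b).
Proof.
  induction n as [|n IH]; intros H.
  - exists 0. lia.
  - destruct (ev_and (IH ltac:(auto)) (H n ltac:(auto))) as [k Hk]. exists k. intros s b Hs Hb m Hm.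
    destruct (Hk s b Hs Hb). assert (m = n \/ m < n) as [->|] by lia; auto.
Qed.

Lemma ev_S (P : nat -> nat -> Prop) : eventually (fun s b => P (S s) b) -> eventually P.
Proof. intros [n Hn]. exists (S n). intros [|s] b Hs Hb; [lia|]. apply Hn; lia. Qed.

(** Induction on derivations that also supplies the hypothesis under the [exists] in the premise of
    the minimisation rule. *)
Lemma pc_eval_strong (P : pcode -> nat -> nat -> Prop) :
  (forall x, P pc_zero x 0) -> (forall x, P pc_succ x (S x)) ->
  (forall x y, P pc_left ⟨x, y⟩ x) -> (forall x y, P pc_right ⟨x, y⟩ y) ->
  (forall c d x a b, P c x a -> P d x b -> P (pc_pair c d) x ⟨a, b⟩) ->
  (forall c d x a b, P d x a -> P c a b -> P (pc_comp c d) x b) ->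
  (forall c d x a, P c x a -> P (pc_prec c d) ⟨x, 0⟩ a) ->
  (forall c d x n r a, P (pc_prec c d) ⟨x, n⟩ r -> P d ⟨x, ⟨n, r⟩⟩ a -> P (pc_prec c d) ⟨x, S n⟩ a) ->
  (forall c x n, P c ⟨x, n⟩ 0 -> (forall m, m < n -> exists k, P c ⟨x, m⟩ (S k)) -> P (pc_mu c) x n) ->
  forall c x y, pc_eval c x y -> P c x y.
Proof.
  intros H0 H1 H2 H3 H4 H5 H6 H7 H8. fix IH 4. intros c x y E. destruct E.
  - apply H0.
  - apply H1.
  - apply H2.
  - apply H3.
  - apply H4; auto.
  - eapply H5; eauto.
  - apply H6; auto.
  - eapply H7; eauto.
  - apply H8; auto. intros m Hm. destruct (H m Hm) as [k Hk]. exists k. auto.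
Qed.

Lemma runs_complete c x y : pc_eval c x y -> eventually (fun s b => runs s (qrun b (pc_index c) x y) = true).
Proof.
  assert (St : forall s b e x y, runs (S s) (qrun b e x y) = run_step b e x y (filter (runs s) (run_deps b e x y))) by reflexivity.
  assert (Fl : forall s b e x y a l, In a (seq 0 (S b)) -> runs s l = true ->
     In l [qrun b (cpi2 (cpi2 e)) x a; qrun b (cpi1 (cpi2 e)) a y; qrun b e ⟨cpi1 x, pred (cpi2 x)⟩ a;
       qrun b (cpi2 (cpi2 e)) ⟨cpi1 x, ⟨pred (cpi2 x), a⟩⟩ y] -> mem l (filter (runs s) (run_deps b e x y)) = true).
  { intros s b e x' y' a l Ha Hr Hl. apply mem_In, filter_In. split; auto.
    unfold run_deps. apply in_or_app. right. apply in_or_app. left.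
    apply in_flat_map. eauto. }
  assert (F0 : forall s b e x y l, runs s l = true -> In l [qcode b (cpi2 (cpi2 e)); qrun b (cpi1 (cpi2 e)) x (cpi1 y); qrun b (cpi2 (cpi2 e)) x (cpi2 y); qrun b (cpi1 (cpi2 e)) (cpi1 x) y; qrun b (cpi2 e) ⟨x, y⟩ 0] -> mem l (filter (runs s) (run_deps b e x y)) = true).
  { intros. apply mem_In, filter_In. split; auto. unfold run_deps. apply in_or_app. auto. }
  intros E. pattern c, x, y. revert c x y E. apply pc_eval_strong; intros; apply ev_S.
  - exists 0. intros. rewrite St. unfold run_step. reflexivity.
  - exists 0. intros. rewrite St. unfold run_step. rewrite (Nat.eqb_refl (S x)). reflexivity.
  - exists 0. intros. rewrite St. unfold run_step. rewrite cpi1_pair, (Nat.eqb_refl x), !orb_true_iff. tauto.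
  - exists 0. intros. rewrite St. unfold run_step. rewrite cpi2_pair, (Nat.eqb_refl y), !orb_true_iff. tauto.
  - generalize (ev_and H H0). apply ev_impl. intros s bb [E1 E2]. rewrite St. unfold run_step.
    rewrite !orb_true_iff, !andb_true_iff. do 4 left. right. rewrite code_tag. split; auto.
    split; apply F0; rewrite code_arg, ?cpi1_pair, ?cpi2_pair; simpl; auto.
  - generalize (ev_bound a (ev_and H H0)). apply ev_impl. intros s bb [[E1 E2] Hb]. rewrite St. unfold run_step.
    rewrite !orb_true_iff, !andb_true_iff, !existsb_exists. do 3 left. right. rewrite code_tag. split; auto.
    assert (I : In a (seq 0 (S bb))) by (apply in_seq; lia).
    exists a. split; auto. apply andb_true_iff.
    split; eapply Fl; eauto; rewrite code_arg, ?cpi1_pair, ?cpi2_pair; simpl; auto.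
  - generalize (ev_and H (let (n, Hn) := runs_code_complete d in ex_intro _ n (fun s b Hs _ => Hn s b Hs))).
    apply ev_impl. intros s bb [E1 E2]. rewrite St. unfold run_step.
    rewrite !orb_true_iff, !andb_true_iff. do 2 left. right. rewrite code_tag, cpi2_pair. split; auto.
    split; apply F0; rewrite ?code_arg, ?cpi1_pair, ?cpi2_pair; simpl; auto.
  - generalize (ev_bound r (ev_and H H0)). apply ev_impl. intros s bb [[E1 E2] Hb]. rewrite St. unfold run_step.
    rewrite !orb_true_iff, !andb_true_iff, !existsb_exists. left. right. rewrite code_tag, cpi2_pair. split; auto.
    assert (I : In r (seq 0 (S bb))) by (apply in_seq; lia).
    exists r. split; auto. apply andb_true_iff.
    split; eapply Fl; eauto; rewrite ?code_arg, ?cpi1_pair, ?cpi2_pair; simpl; auto.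
  - assert (K : eventually (fun s b => forall m, m < n -> exists k, k <= b /\ runs s (qrun b (pc_index c) ⟨x, m⟩ (S k)) = true)).
    { apply ev_forall. intros m Hm. destruct (H0 m Hm) as [k Hk]. generalize (ev_bound k Hk).
      apply ev_impl. intros s b [E1 E2]. eauto. }
    generalize (ev_and H K). apply ev_impl. intros s b [E1 E2]. rewrite St. unfold run_step.
    rewrite !orb_true_iff, !andb_true_iff. right. rewrite code_tag. split; [split; auto|].
    + apply F0; rewrite ?code_arg; simpl; auto 6.
    + apply forallb_forall. intros m Hm. apply in_seq in Hm. apply existsb_exists.
      destruct (E2 m ltac:(lia)) as (k & Hk & Hr). exists k. split. apply in_seq; lia.
      apply mem_In, filter_In. rewrite code_arg. split; auto. unfold run_deps.
      apply in_or_app. right. apply in_or_app. right. apply in_flat_map. exists m. split. apply in_seq; lia.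
      rewrite code_arg. apply in_map_iff. exists k. split; auto. apply in_seq; lia.
Qed.

Lemma cmp_runs {A} `{Enc A} (s : A -> nat) (q : A -> query) :
  computable s -> computable q -> computable (fun a => runs (s a) (q a)).
Proof.
  intros. apply cmp_brec; auto.
  - unfold phi_deps, code_deps, run_deps, qcode, qrun. cmps.
  - unfold phi_step, code_step, run_step, qcode, qrun. cmps.
Qed.

Lemma re_phi {A} `{Enc A} (e x y : A -> nat) :
  computable e -> computable x -> computable y -> RE (fun a => phi (e a) (x a) (y a)).
Proof.
  intros. exists (fun p => runs (snd p) (qrun (snd p) (e (fst p)) (x (fst p)) (y (fst p)))). split.
  - unfold qrun. apply cmp_runs; cmp. repeat apply cmp_pair; cmp.
    + apply cmp_comp with (f := e); cmp.
    + apply cmp_comp with (f := x); cmp.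
    + apply cmp_comp with (f := y); cmp.
  - intros a. split.
    + intros (c & Hc & E). apply runs_complete in E. destruct E as [n Hn]. exists n.
      cbn [fst snd]. rewrite <- Hc. apply Hn; auto.
    + intros [w Hw]. eapply runs_phi. apply Hw.
Qed.

Lemma phi_fun e x y z : phi e x y -> phi e x z -> y = z.
Proof.
  intros (c & Hc & E1) (d & Hd & E2). assert (c = d) by (apply pc_index_inj; congruence). subst d. clear Hc Hd.
  revert z E2. pattern c, x, y. revert c x y E1. apply pc_eval_strong; intros.
  (* The inputs are values of [Cantor.to_nat], not constructor terms. Naming them lets [inversion]
     leave equations between pairs, which injectivity of pairing then resolves. *)
  all: match goal with Q : pc_eval _ ?w _ |- _ => remember w as v eqn:Ev in Q end;
    inversion E2; subst v;
    repeat match goal with Q : ⟨_, _⟩ = ⟨_, _⟩ |- _ => apply to_nat_inj in Q; destruct Q end;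
    subst; auto; try discriminate.
  - apply (f_equal Cantor.to_nat), f_equal2; auto.
  - match goal with Q : pc_eval d _ _ |- _ => apply H in Q; subst; auto end.
  - match goal with Q : S _ = S _ |- _ => injection Q as -> end.
    match goal with Q : pc_eval (pc_prec _ _) _ _ |- _ => apply H in Q; subst; auto end.
  - assert (R : forall m, m < z -> exists k, pc_eval c ⟨x, m⟩ (S k)) by assumption.
    assert (Q : pc_eval c ⟨x, z⟩ 0) by assumption.
    destruct (Nat.lt_trichotomy n z) as [L|[L|L]]; auto.
    + destruct (R n L) as [k Hk]. apply H in Hk. discriminate.
    + destruct (H0 z L) as [k Hk]. apply Hk in Q. discriminate.
Qed.

(** * Formulas of the language of one binary relation *)

Definition digraph : language :=
  Language (fun_num := 0) (fun _ => 0) (rel_num := 1) (fun _ => 2).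

(** Formulas of [digraph], whose only terms are variables. *)
Inductive fm : Type :=
| FBot | FEq (x y : nat) | FRel (x y : nat) | FImp (p q : fm) | FAll (p : fm).

Definition FNeg p := FImp p FBot.

Fixpoint fsat {D} (R : D -> D -> Prop) (rho : nat -> D) (p : fm) : Prop :=
  match p with
  | FBot => False
  | FEq x y => rho x = rho y
  | FRel x y => R (rho x) (rho y)
  | FImp p q => fsat R rho p -> fsat R rho q
  | FAll p => forall d, fsat R (env_cons d rho) p
  end.

Fixpoint fbd (n : nat) (p : fm) : Prop :=
  match p with
  | FBot => True
  | FEq x y | FRel x y => x < n /\ y < n
  | FImp p q => fbd n p /\ fbd n q
  | FAll p => fbd (S n) p
  end.

Fixpoint fcode (p : fm) : nat :=
  match p with
  | FBot => ⟨0, 0⟩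
  | FEq x y => ⟨1, ⟨⟨0, x⟩, ⟨0, y⟩⟩⟩
  | FImp p q => ⟨2, ⟨fcode p, fcode q⟩⟩
  | FAll p => ⟨3, fcode p⟩
  | FRel x y => ⟨4, S ⟨⟨0, x⟩, S ⟨⟨0, y⟩, 0⟩⟩⟩
  end.

Lemma fcode_inj p q : fcode p = fcode q -> p = q.
Proof.
  revert q. induction p; intros [] E; cbn [fcode] in E; apply to_nat_inj in E; destruct E as [E0 E];
    try discriminate; auto.
  - apply to_nat_inj in E. destruct E as [E1 E2]. apply to_nat_inj in E1, E2. f_equal; tauto.
  - apply eq_add_S, to_nat_inj in E. destruct E as [E1 E2]. apply eq_add_S in E2.
    apply to_nat_inj in E2. destruct E2 as [E2 _]. apply to_nat_inj in E1, E2. f_equal; tauto.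
  - apply to_nat_inj in E. destruct E as [E1 E2]. f_equal; auto.
  - f_equal; auto.
Qed.

Lemma fsat_agree {D} (R : D -> D -> Prop) p : forall n rho sg, fbd n p ->
  (forall i, i < n -> rho i = sg i) -> fsat R rho p <-> fsat R sg p.
Proof.
  induction p; intros n rho sg Hb He; simpl in *.
  - tauto.
  - rewrite !He by tauto. tauto.
  - rewrite !He by tauto. tauto.
  - rewrite (IHp1 n rho sg), (IHp2 n rho sg) by tauto. tauto.
  - split; intros H d; specialize (H d); revert H; apply (IHp (S n)); auto;
      intros [|i] Hi; simpl; auto; first [apply He | symmetry; apply He]; lia.
Qed.

Lemma fbd_mono p : forall n m, n <= m -> fbd n p -> fbd m p.
Proof.
  induction p; intros n m Hn; simpl; intros; auto; try lia.
  - destruct H. split; [eapply IHp1|eapply IHp2]; eauto.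
  - eapply IHp; [|eauto]. lia.
Qed.

Lemma fbd_ex p : exists n, fbd n p.
Proof.
  induction p as [|x y|x y|p [n Hn] q [m Hm]|p [n Hn]].
  - exists 0; simpl; auto.
  - exists (S (x + y)); simpl; lia.
  - exists (S (x + y)); simpl; lia.
  - exists (n + m). simpl. split; (eapply fbd_mono; [|eassumption]; lia).
  - exists n. simpl. (eapply fbd_mono; [|eassumption]; lia).
Qed.

Lemma fsat_ext {D} (R : D -> D -> Prop) p rho sg :
  (forall i, rho i = sg i) -> fsat R rho p <-> fsat R sg p.
Proof. intros. destruct (fbd_ex p) as [n Hn]. eapply fsat_agree; eauto. Qed.

Definition up (f : nat -> nat) (i : nat) : nat := match i with 0 => 0 | S i => S (f i) end.

Fixpoint ren (f : nat -> nat) (p : fm) : fm :=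
  match p with
  | FBot => FBot
  | FEq x y => FEq (f x) (f y)
  | FRel x y => FRel (f x) (f y)
  | FImp p q => FImp (ren f p) (ren f q)
  | FAll p => FAll (ren (up f) p)
  end.

Lemma fsat_ren {D} (R : D -> D -> Prop) p : forall f rho,
  fsat R rho (ren f p) <-> fsat R (fun i => rho (f i)) p.
Proof.
  induction p; intros f rho; simpl; try tauto.
  - rewrite IHp1, IHp2. tauto.
  - split; intros H d; specialize (H d).
    + apply IHp in H. revert H. apply fsat_ext. intros [|i]; auto.
    + apply IHp. revert H. apply fsat_ext. intros [|i]; auto.
Qed.

Lemma fbd_ren p : forall f n m, fbd n p -> (forall i, i < n -> f i < m) -> fbd m (ren f p).
Proof.
  induction p; intros f n m Hb Hf; simpl in *; auto.
  - split; apply Hf; tauto.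
  - split; apply Hf; tauto.
  - split; [eapply IHp1|eapply IHp2]; eauto; tauto.
  - eapply IHp; eauto. intros [|i] Hi; simpl. lia. assert (f i < m) by (apply Hf; lia). lia.
Qed.

Definition instf (x i : nat) : nat := match i with 0 => x | S i => i end.
Definition finst (x : nat) (p : fm) : fm := ren (instf x) p.

Lemma fsat_finst {D} (R : D -> D -> Prop) p x rho :
  fsat R rho (finst x p) <-> fsat R (env_cons (rho x) rho) p.
Proof. unfold finst. rewrite fsat_ren. apply fsat_ext. intros [|i]; auto. Qed.

Lemma fbd_finst n x p : fbd (S n) p -> x < n -> fbd n (finst x p).
Proof. intros. eapply fbd_ren; eauto. intros [|i]; simpl; lia. Qed.

(** * Translation to the official syntax *)

Fixpoint to_form (p : fm) : form digraph :=
  match p with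
  | FBot => bot
  | FEq x y => eqn (var x) (var y)
  | FRel x y => @rel digraph Fin.F1 (Vector.cons _ (var x) _ (Vector.cons _ (var y) _ (Vector.nil _)))
  | FImp p q => imp (to_form p) (to_form q)
  | FAll p => all (to_form p)
  end.

Definition to_var (t : term digraph) : nat :=
  match t with
  | var x => x
  | app f _ => Fin.case0 (fun _ => nat) f
  end.

Fixpoint of_form (p : form digraph) : fm :=
  match p with
  | bot => FBot
  | eqn s t => FEq (to_var s) (to_var t)
  | rel R v => FRel (to_var (Vector.hd v)) (to_var (Vector.hd (Vector.tl v)))
  | imp p q => FImp (of_form p) (of_form q)
  | all p => FAll (of_form p)
  end.

Lemma var_to_var (t : term digraph) : t = var (to_var t).
Proof. destruct t as [x|f v]; auto. simpl in f. inversion f. Qed.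

Lemma of_to p : of_form (to_form p) = p.
Proof. induction p; simpl; congruence. Qed.

Lemma vec2 {A} (v : Vector.t A 2) :
  v = Vector.cons _ (Vector.hd v) _ (Vector.cons _ (Vector.hd (Vector.tl v)) _ (Vector.nil _)).
Proof.
  rewrite (Vector.eta v) at 1. f_equal.
  rewrite (Vector.eta (Vector.tl v)) at 1. f_equal.
  apply (Vector.case0 (fun w => w = Vector.nil A)). reflexivity.
Qed.

Lemma fin1 (i : Fin.t 1) : i = Fin.F1.
Proof. apply (Fin.caseS' i); auto. intros j. inversion j. Qed.

Lemma to_of p : to_form (of_form p) = p.
Proof.
  induction p as [|s t|R v|p IHp q IHq|p IHp]; simpl.
  - auto.
  - rewrite <- !var_to_var. auto.
  - rewrite <- !var_to_var. simpl in R. pose proof (fin1 R). subst R. f_equal. symmetry. apply (vec2 (A := term digraph)).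
  - congruence.
  - congruence.
Qed.

Lemma form_index_to p : form_index (to_form p) = fcode p.
Proof. induction p; cbn [to_form form_index fcode]; auto; rewrite ?IHp, ?IHp1, ?IHp2; auto. Qed.

Lemma term_bounded_var n x : @term_bounded digraph n (var x) <-> x < n.
Proof. split; intros H. inversion H; auto. constructor; auto. Qed.

Lemma form_bounded_to p : forall n, form_bounded n (to_form p) <-> fbd n p.
Proof.
  induction p; intros n; simpl.
  - tauto.
  - rewrite !term_bounded_var. tauto.
  - rewrite !Vector.Forall_cons_iff, !term_bounded_var. intuition auto. constructor.
  - rewrite IHp1, IHp2. tauto.
  - apply IHp.
Qed.

Definition str {D} (i : inhabited D) (R : D -> D -> Prop) : structure digraph :=
  Structure digraph i (fun f _ => Fin.case0 (fun _ => D) f)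
    (fun _ v => R (Vector.hd v) (Vector.hd (Vector.tl v))).

Definition edge (M : structure digraph) (x y : carrier M) : Prop :=
  @rel_interp digraph M Fin.F1 (Vector.cons _ x _ (Vector.cons _ y _ (Vector.nil _))).

Lemma sat_to (M : structure digraph) p : forall rho, sat M rho (to_form p) <-> fsat (@edge M) rho p.
Proof.
  induction p; intros rho; simpl; try tauto.
  - rewrite IHp1, IHp2. tauto.
  - split; intros H d; apply IHp, H.
Qed.

Lemma eval_subst (M : structure digraph) rho s t :
  eval M rho (subst_term s t) = eval M (fun x => eval M rho (s x)) t.
Proof. rewrite (var_to_var t). reflexivity. Qed.

Lemma sat_ext (M : structure digraph) p rho sg : (forall i, rho i = sg i) -> sat M rho p <-> sat M sg p.
Proof. intros. rewrite <- (to_of p), !sat_to. apply fsat_ext; auto. Qed.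

Lemma sat_subst (M : structure digraph) p : forall s rho,
  sat M rho (subst_form s p) <-> sat M (fun x => eval M rho (s x)) p.
Proof.
  induction p as [|u t|R v|p IHp q IHq|p IHp]; intros s rho; simpl.
  - tauto.
  - rewrite !eval_subst. tauto.
  - rewrite Vector.map_map. erewrite Vector.map_ext. reflexivity. intros t. apply eval_subst.
  - rewrite IHp, IHq. tauto.
  - assert (E : forall d, sat M (env_cons d rho) (subst_form (scons (var 0) (fun x => shift_term (s x))) p)
       <-> sat M (env_cons d (fun x => eval M rho (s x))) p).
    { intros d. rewrite IHp. apply sat_ext. intros [|i]; simpl; auto.
      unfold shift_term. rewrite eval_subst. reflexivity. }
    split; intros H d; apply E, H.
Qed.

Lemma sat_inst (M : structure digraph) p t rho :
  sat M rho (inst t p) <-> sat M (env_cons (eval M rho t) rho) p.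
Proof. unfold inst. rewrite sat_subst. apply sat_ext. intros [|i]; auto. Qed.

(** Soundness is what makes the theory of a structure consistent and deductively closed in the sense
    of [complete_theory]. *)
Lemma derives_sound (M : structure digraph) G p : derives G p ->
  forall rho, (forall q, In q G -> sat M rho q) -> sat M rho p.
Proof.
  induction 1; intros rho HG.
  - auto.
  - intros Hp. apply IHderives. intros r [<-|Hr]; auto.
  - exact (IHderives1 rho HG (IHderives2 rho HG)).
  - apply NNPP. intros Hn. apply (IHderives rho). intros r [<-|Hr]; auto.
  - intros d. apply IHderives. intros q Hq. apply in_map_iff in Hq. destruct Hq as (r & <- & Hr).
    apply sat_subst. apply HG in Hr. revert Hr. apply sat_ext. auto.
  - apply sat_inst. apply (IHderives rho HG).
  - reflexivity.
  - apply sat_inst. rewrite <- (IHderives1 rho HG). apply sat_inst. auto.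
Qed.

Definition theory {D} (R : D -> D -> Prop) (p : form digraph) : Prop :=
  sentence p /\ forall rho, fsat R rho (of_form p).

Lemma fsat_sentence {D} (R : D -> D -> Prop) p rho sg : fbd 0 p -> fsat R rho p -> fsat R sg p.
Proof. intros Hb. apply (fsat_agree R p (n := 0)); auto. lia. Qed.

Lemma sentence_of p : @sentence digraph p <-> fbd 0 (of_form p).
Proof. unfold sentence. rewrite <- (to_of p) at 1. apply form_bounded_to. Qed.

Lemma sat_str {D} (i : inhabited D) (R : D -> D -> Prop) rho p : sat (str i R) rho p <-> fsat R rho (of_form p).
Proof. rewrite <- (to_of p) at 1. rewrite sat_to. reflexivity. Qed.

Lemma theory_complete {D} (d : D) (R : D -> D -> Prop) : complete_theory (theory R).
Proof.
  constructor.
  - intros p Hp; apply Hp.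
  - intros (G & HG & Hd). apply (derives_sound (str (inhabits d) R) Hd (fun _ => d)).
    intros q Hq. apply sat_str. apply HG; auto.
  - intros p Hs (G & HG & Hd). split; auto. intros rho. rewrite <- (sat_str (inhabits d)).
    apply (derives_sound _ Hd). intros q Hq. apply sat_str. apply HG; auto.
  - intros p Hs. destruct (classic (fsat R (fun _ => d) (of_form p))) as [H|H]; [left|right].
    + split; auto. intros rho. revert H. apply fsat_sentence. apply sentence_of; auto.
    + split. unfold neg, sentence. simpl. auto. intros rho. simpl. intros Hn. apply H. revert Hn.
      apply fsat_sentence. apply sentence_of; auto.
Qed.

(** Dependent choice with one requirement met per step. The same scheme drives the construction of
    models, the back-and-forth argument and the generic system of ranks. *)
Lemma generic_sequence (S : Type) (le : S -> S -> Prop) (D : nat -> S -> Prop) (s0 : S) :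
  (forall j s, exists s', le s s' /\ D j s') ->
  exists f : nat -> S, f 0 = s0 /\ (forall i, le (f i) (f (Datatypes.S i))) /\ (forall j, D j (f (Datatypes.S j))).
Proof.
  intros H. pose (next := fun j s => constructive_indefinite_description _ (H j s)).
  exists (fix f i := match i with 0 => s0 | Datatypes.S i => proj1_sig (next i (f i)) end).
  split; [reflexivity|]. split; intros i; destruct (next i _) as [s' [H1 H2]]; simpl; auto.
Qed.

Lemma chain_le (S : Type) (le : S -> S -> Prop) (f : nat -> S) :
  (forall s, le s s) -> (forall a b c, le a b -> le b c -> le a c) ->
  (forall i, le (f i) (f (Datatypes.S i))) -> forall i j, i <= j -> le (f i) (f j).
Proof. intros Hr Ht Hs i j Hij. induction Hij; eauto. Qed.

Definition inj_below {D} (n : nat) (rho : nat -> D) : Prop :=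
  forall i j, i < n -> j < n -> rho i = rho j -> i = j.

Definition FEx p := FNeg (FAll (FNeg p)).
Definition FAnd p q := FNeg (FImp p (FNeg q)).
Definition FConj (l : list fm) : fm := fold_right FAnd (FNeg FBot) l.
Fixpoint exn (r : nat) (p : fm) : fm := match r with 0 => p | S r => exn r (FEx p) end.
Definition envl {D} (l : list D) (rho : nat -> D) : nat -> D := fold_right env_cons rho l.
Definition dist (n : nat) : list fm :=
  flat_map (fun i => map (fun j => FNeg (FEq i j)) (seq 0 i)) (seq 0 n).

Section Sat.
Context {D : Type} (R : D -> D -> Prop).

Lemma fsat_ex rho p : fsat R rho (FEx p) <-> exists d, fsat R (env_cons d rho) p.
Proof.
  simpl. split.
  - intros H. apply NNPP. intros Hn. apply H. intros d Hd. eauto.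
  - intros [d Hd] H. exact (H d Hd).
Qed.

Lemma fsat_FConj rho l : fsat R rho (FConj l) <-> forall p, In p l -> fsat R rho p.
Proof.
  induction l as [|p l IH]; simpl.
  - tauto.
  - unfold FConj in IH. split.
    + intros H q [<-|Hq].
      * apply NNPP. intros Hn. tauto.
      * apply IH; auto. apply NNPP. intros Hn. tauto.
    + intros H H1. apply H1; auto. apply IH. auto.
Qed.

Lemma fsat_exn r : forall rho p,
  fsat R rho (exn r p) <-> exists l, length l = r /\ fsat R (envl l rho) p.
Proof.
  induction r as [|r IH]; intros rho p.
  - cbn [exn]. split.
    + intros H. exists []. auto.
    + intros ([|] & Hl & H); [auto|discriminate].
  - cbn [exn]. rewrite IH. split.
    + intros (l & Hl & H). apply fsat_ex in H. destruct H as [d H]. exists (d :: l). simpl. auto.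
    + intros ([|d l] & Hl & H); [discriminate|]. exists l. split; auto. apply fsat_ex. eauto.
Qed.

Lemma envl_lt (l : list D) rho i d : i < length l -> envl l rho i = nth i l d.
Proof.
  revert i. induction l as [|x l IH]; intros [|i] Hi; simpl in *; try lia; auto. apply IH. lia.
Qed.

Lemma envl_ge (l : list D) rho i : envl l rho (length l + i) = rho i.
Proof. induction l; simpl; auto. Qed.

Lemma In_dist n p : In p (dist n) <-> exists i j, j < i /\ i < n /\ p = FNeg (FEq i j).
Proof.
  unfold dist. rewrite in_flat_map. split.
  - intros (i & Hi & Hp). apply in_map_iff in Hp. destruct Hp as (j & <- & Hj).
    apply in_seq in Hi, Hj. exists i, j. repeat split; auto; lia.
  - intros (i & j & H1 & H2 & ->). exists i. split. apply in_seq; lia.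
    apply in_map_iff. exists j. split; auto. apply in_seq; lia.
Qed.

Lemma fsat_dist n rho : (forall p, In p (dist n) -> fsat R rho p) <-> inj_below n rho.
Proof.
  split.
  - intros H i j Hi Hj E. destruct (Nat.lt_trichotomy i j) as [L|[L|L]]; auto; exfalso.
    + apply (H (FNeg (FEq j i))). apply In_dist. exists j, i. auto. simpl. auto.
    + apply (H (FNeg (FEq i j))). apply In_dist. exists i, j. auto. simpl. auto.
  - intros H p Hp. apply In_dist in Hp. destruct Hp as (i & j & H1 & H2 & ->). intros E.
    simpl in E. apply H in E; lia.
Qed.
End Sat.

Lemma fbd_dist n : Forall (fbd n) (dist n).
Proof.
  apply Forall_forall. intros p Hp. apply In_dist in Hp. destruct Hp as (i & j & H1 & H2 & ->).
  simpl. lia.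
Qed.

Lemma fbd_FConj n l : Forall (fbd n) l -> fbd n (FConj l).
Proof. induction 1; simpl; auto. Qed.

Lemma fbd_exn r : forall n p, fbd (r + n) p -> fbd n (exn r p).
Proof. induction r as [|r IH]; intros n p H; simpl; auto. apply IH. simpl. auto. Qed.

Definition infinite (D : Type) : Prop := forall l : list D, exists d, ~ In d l.

Definition upd {D} (rho : nat -> D) (n : nat) (d : D) (i : nat) : D := if Nat.eqb i n then d else rho i.

Lemma upd_eq {D} (rho : nat -> D) n d : upd rho n d n = d.
Proof. unfold upd. rewrite Nat.eqb_refl. auto. Qed.
Lemma upd_lt {D} (rho : nat -> D) n d i : i < n -> upd rho n d i = rho i.
Proof. intros. unfold upd. destruct (Nat.eqb_spec i n); auto; lia. Qed.

Lemma inj_upd {D} n (rho : nat -> D) d : inj_below n rho -> (forall i, i < n -> rho i <> d) ->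
  inj_below (S n) (upd rho n d).
Proof.
  intros Hi Hd i j Hin Hjn. assert (i < n \/ i = n) as [L| ->] by lia; assert (j < n \/ j = n) as [L'| ->] by lia;
  rewrite ?upd_eq, ?upd_lt by auto; auto; intros E; exfalso.
  - eapply Hd; eauto.
  - eapply Hd; eauto.
Qed.

(** * Consistency properties *)

(** In a condition [(n, l)] the variables below [n] name distinct elements of the
    model under construction, and the formulas of [l] are promised to be true of them. *)
Definition clash (n : nat) (l : list fm) : Prop :=
  In FBot l \/
  (exists q, In q l /\ In (FNeg q) l) \/
  (exists a b, In (FImp a b) l /\ In a l /\ In (FNeg b) l) \/
  (exists a b, In (FNeg (FImp a b)) l /\ (In (FNeg a) l \/ In b l)) \/
  (exists q x, In (FAll q) l /\ x < n /\ In (FNeg (finst x q)) l) \/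
  (exists x y, In (FEq x y) l /\ x <> y) \/
  (exists x, In (FNeg (FEq x x)) l).

(** Since distinct numbers name distinct elements, a witness in [cp_wit] is either an element
    already named or the next number [n]. By [cp_ext] another element can always be named, so in the
    end every number is a name. *)
Record consistency (Con : nat -> list fm -> Prop) : Prop := {
  cp_dec n l q : Con n l -> fbd n q -> Con n (q :: l) \/ Con n (FNeg q :: l);
  cp_wit n l q : Con n l -> In (FNeg (FAll q)) l ->
    (exists x, x < n /\ Con n (FNeg (finst x q) :: l)) \/ Con (S n) (FNeg (finst n q) :: l);
  cp_ext n l : Con n l -> Con (S n) l;
  cp_clash n l : Con n l -> ~ clash n l
}.

Lemma cp_le Con n m l : consistency Con -> n <= m -> Con n l -> Con m l.
Proof. intros C Hm Hc. induction Hm; auto. apply (cp_ext C); auto. Qed.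

Fixpoint fsize (p : fm) : nat :=
  match p with
  | FImp p q => S (fsize p + fsize q) | FAll p => S (fsize p) | _ => 0
  end.

Lemma fsize_ren p : forall f, fsize (ren f p) = fsize p.
Proof. induction p; intros; simpl; auto. Qed.

(** A Henkin construction on the universe [nat]: the relation is read off the atomic formulas that
    are ever promised. The predicate [D j] is an additional requirement met along the way, by which
    types can be omitted. *)
Theorem model_existence (Con : nat -> list fm -> Prop) (D : nat -> nat -> list fm -> Prop) n0 l0 :
  consistency Con ->
  (forall j n l, Con n l -> exists n' l', n <= n' /\ incl l l' /\ Con n' l' /\ D j n' l') ->
  Con n0 l0 ->
  exists (R : nat -> nat -> Prop) (N : nat -> nat) (G : nat -> list fm),
    N 0 = n0 /\ G 0 = l0 /\ (forall i, Con (N i) (G i)) /\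
    (forall i j, i <= j -> N i <= N j /\ incl (G i) (G j)) /\
    (forall j, exists i, D j (N i) (G i)) /\
    (forall p, exists i, In p (G i) \/ In (FNeg p) (G i)) /\
    (forall i p, In p (G i) -> fsat R (fun x => x) p).
Proof.
  intros C HD HC.
  (* Step [j] names the number [j] and decides the formula with code [j], adding a witness when it
     refutes a universal formula. *)
  pose (req := fun j n l => j < n /\ forall p, fcode p = j -> In p l \/ (In (FNeg p) l /\
     forall q, p = FAll q -> exists x, x < n /\ In (FNeg (finst x q)) l)).
  assert (Hreq : forall j n l, Con n l -> exists n' l', n <= n' /\ incl l l' /\ Con n' l' /\ req j n' l').
  { intros j n l H. destruct (classic (exists p, fcode p = j)) as [[p Hp]|Hn].
    - destruct (fbd_ex p) as [k Hk]. set (m := n + k + j + 1).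
      assert (C2 : Con m l) by (apply cp_le with (n := n); auto; lia).
      assert (B2 : fbd m p) by (eapply fbd_mono; [|exact Hk]; lia).
      assert (U : forall p', fcode p' = j -> p' = p) by (intros p' Hp'; apply fcode_inj; congruence).
      destruct (cp_dec C _ _ _ C2 B2) as [C3|C3].
      + exists m, (p :: l). repeat split; auto; try lia.
        * apply incl_tl, incl_refl.
        * intros p' Hp'. rewrite (U p' Hp'). simpl. auto.
      + destruct (classic (exists q, p = FAll q)) as [[q ->]|Hq].
        * assert (I : In (FNeg (FAll q)) (FNeg (FAll q) :: l)) by (simpl; auto).
          destruct (cp_wit C _ _ _ C3 I) as [(x & Hx & C4)|C4].
          -- exists m. eexists. repeat split; [lia| |exact C4|lia|].
             ++ do 2 apply incl_tl. apply incl_refl.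
             ++ intros p' Hp'. rewrite (U p' Hp'). right. split. simpl; auto.
                intros q' Eq. injection Eq as <-. exists x. simpl. auto.
          -- exists (S m). eexists. repeat split; [lia| |exact C4|lia|].
             ++ do 2 apply incl_tl. apply incl_refl.
             ++ intros p' Hp'. rewrite (U p' Hp'). right. split. simpl; auto.
                intros q' Eq. injection Eq as <-. exists m. simpl. auto.
        * exists m. eexists. repeat split; [lia| |exact C3|lia|].
          -- apply incl_tl, incl_refl.
          -- intros p' Hp'. rewrite (U p' Hp'). right. split. simpl; auto.
             intros q Eq. exfalso. eauto.
    - exists (n + j + 1), l. repeat split; try lia.
      + apply incl_refl.
      + apply cp_le with (n := n); auto; lia.
      + intros p Hp. exfalso. eauto. }
  pose (St := {s : nat * list fm | Con (fst s) (snd s)}).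
  pose (nn := fun s : St => fst (proj1_sig s)). pose (ll := fun s : St => snd (proj1_sig s)).
  pose (le := fun s t : St => nn s <= nn t /\ incl (ll s) (ll t)).
  destruct (@generic_sequence St le (fun j s => D j (nn s) (ll s) /\ req j (nn s) (ll s)) (exist _ (n0, l0) HC))
    as (f & F0 & Fs & FD).
  { intros j [[n l] H]. simpl in H. destruct (Hreq j n l H) as (n1 & l1 & L1 & I1 & C1 & D1).
    destruct (HD j n1 l1 C1) as (n2 & l2 & L2 & I2 & C2 & D2).
    exists (exist _ (n2, l2) C2). unfold le, nn, ll. simpl. split; [split|split; auto].
    - lia.
    - eapply incl_tran; eauto.
    - destruct D1 as [Q1 Q2]. split; [lia|]. intros p Hp. destruct (Q2 p Hp) as [A|[A B]]; auto.
      right. split; auto. intros q Eq. destruct (B q Eq) as (x & Hx & Hi). exists x. split; auto. lia. }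
  pose (N := fun i => nn (f i)). pose (G := fun i => ll (f i)).
  assert (Mono : forall i j, i <= j -> N i <= N j /\ incl (G i) (G j)).
  { apply (@chain_le St le); auto.
    - intros s. split; auto. apply incl_refl.
    - intros a b c [] []. split. lia. eapply incl_tran; eauto. }
  assert (HCon : forall i, Con (N i) (G i)) by (intros i; exact (proj2_sig (f i))).
  assert (Up : forall i j p, In p (G i) -> In p (G (i + j))).
  { intros i j p Hp. apply (Mono i (i + j)); auto. lia. }
  assert (Up' : forall i j p, In p (G i) -> In p (G (j + i))).
  { intros i j p Hp. rewrite Nat.add_comm. auto. }
  assert (Dec : forall p, exists i, In p (G i) \/ (In (FNeg p) (G i) /\
     forall q, p = FAll q -> exists x, In (FNeg (finst x q)) (G i))).
  { intros p. exists (S (fcode p)). destruct (FD (fcode p)) as [_ [_ Q]].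
    destruct (Q p eq_refl) as [A|[A B]]; auto. right. split; auto. intros q Eq.
    destruct (B q Eq) as (x & Hx & Hi). eauto. }
  assert (Dec' : forall p, exists i, In p (G i) \/ In (FNeg p) (G i)).
  { intros p. destruct (Dec p) as [i [H|[H _]]]; exists i; auto. }
  pose (R := fun x y => exists i, In (FRel x y) (G i)).
  assert (No : forall i, ~ clash (N i) (G i)) by (intros i; exact (cp_clash C (HCon i))).
  (* Induction is on [fsize], which renaming preserves, since the instances [finst x q] are not
     subformulas. Truth of promised formulas and falsity of refuted ones are proved together, as
     implications exchange them. *)
  assert (Truth : forall k p, fsize p <= k -> forall i,
     (In p (G i) -> fsat R (fun x => x) p) /\ (In (FNeg p) (G i) -> ~ fsat R (fun x => x) p)).
  { assert (Two : forall i j q, In q (G i) -> In (FNeg q) (G j) -> False).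
    { intros i j q H1 H2. apply (No (i + j)). right; left. exists q. split; auto. }
    induction k as [k IH] using lt_wf_ind. intros p Hk i. destruct p as [|x y|x y|a b|q]; simpl.
    - split; auto. intros H. apply (No i). left; auto.
    - split; intros H.
      + apply NNPP. intros Hn. apply (No i). do 5 right. left. eauto.
      + intros ->. apply (No i). do 6 right. eauto.
    - split; intros H.
      + exists i. auto.
      + intros [j Hj]. eapply Two; eauto.
    - simpl in Hk.
      assert (Sa : fsat R (fun x => x) a -> exists j, In a (G j)).
      { intros Ha. destruct (Dec' a) as [j [Hj|Hj]]; eauto. exfalso. revert Ha.
        eapply (IH (fsize a)); eauto; lia. }
      assert (Sb : exists j, (In b (G j) /\ fsat R (fun x => x) b) \/ (In (FNeg b) (G j) /\ ~ fsat R (fun x => x) b)).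
      { destruct (Dec' b) as [j [Hj|Hj]]; exists j; [left|right]; split; auto; eapply (IH (fsize b)); eauto; lia. }
      destruct Sb as [j Sb]. split; intros H.
      + intros Ha. destruct (Sa Ha) as [j' Hj']. destruct Sb as [[_ Sb]|[Sb _]]; auto. exfalso.
        apply (No (i + (j + j'))). do 2 right. left. exists a, b. repeat split; auto.
      + intros Hi. destruct (Dec' a) as [j' [Hj'|Hj']].
        * assert (Hb : fsat R (fun x => x) b) by (apply Hi; eapply (IH (fsize a)); eauto; lia).
          destruct Sb as [[Sb _]|[_ Sb]]; auto.
          apply (No (i + j)). do 3 right. left. exists a, b. split; auto.
        * apply (No (i + j')). do 3 right. left. exists a, b. split; auto.
    - simpl in Hk. split; intros H.
      + intros d. apply (fsat_finst R q d (fun x => x)).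
        destruct (Dec' (finst d q)) as [j [Hj|Hj]].
        * eapply (IH (fsize (finst d q))); eauto; unfold finst; rewrite fsize_ren; lia.
        (* The clash between [FAll q] and a negated instance concerns only named elements; from
           stage [S d] on, [d] is named. *)
        * exfalso. apply (No (i + (j + S d))). do 4 right. left. exists q, d. split; [auto|split; auto].
          destruct (FD d) as [_ [Hd _]]. fold (N (S d)) in Hd.
          assert (N (S d) <= N (i + (j + S d))) by (apply Mono; lia). lia.
      + intros Hs. destruct (Dec (FAll q)) as [j [Hj|[Hj Hw]]].
        * eapply Two; eauto.
        * destruct (Hw q eq_refl) as [x Hx].
          assert (Q : ~ fsat R (fun x => x) (finst x q)).
          { eapply (IH (fsize (finst x q))); eauto; unfold finst; rewrite fsize_ren; lia. }
          apply Q, fsat_finst, Hs. }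
  exists R, N, G. split; [|split; [|split; [|split; [|split; [|split]]]]]; auto.
  - unfold N. rewrite F0. reflexivity.
  - unfold G. rewrite F0. reflexivity.
  - intros j. exists (S j). apply FD.
  - intros i p Hp. eapply Truth; eauto.
Qed.

Definition cond {D} (R : D -> D -> Prop) (n : nat) (l : list fm) : Prop :=
  Forall (fbd n) l /\ exists rho, inj_below n rho /\ forall p, In p l -> fsat R rho p.

Lemma infinite_inhabited D : infinite D -> inhabited D.
Proof. intros H. destruct (H []) as [d _]. constructor. auto. Qed.

Lemma cond_incl {D} (R : D -> D -> Prop) n l l' : incl l l' -> cond R n l' -> cond R n l.
Proof.
  intros I [B (rho & Hi & H)]. split.
  - rewrite Forall_forall in *. auto.
  - exists rho. auto.
Qed.

Lemma cond_S {D} (R : D -> D -> Prop) n l rho d : Forall (fbd n) l -> inj_below n rho ->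
  (forall p, In p l -> fsat R rho p) -> (forall i, i < n -> rho i <> d) ->
  Forall (fbd (S n)) l /\ inj_below (S n) (upd rho n d) /\ forall p, In p l -> fsat R (upd rho n d) p.
Proof.
  intros B Hi H Hd. repeat split.
  - eapply Forall_impl; [|exact B]. intros p. apply fbd_mono. lia.
  - apply inj_upd; auto.
  - intros p Hp. rewrite Forall_forall in B. eapply fsat_agree; [apply B; auto| |apply H; auto].
    intros i Hin. apply upd_lt; auto.
Qed.

Lemma cond_consistency {D} (R : D -> D -> Prop) : infinite D -> consistency (cond R).
Proof.
  intros Inf. constructor.
  - intros n l q [B (rho & Hi & H)] Hq. destruct (classic (fsat R rho q)) as [Hs|Hs]; [left|right]; split;
    try (constructor; auto; simpl; auto); exists rho; split; auto; intros p [<-|Hp]; auto.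
  - intros n l q [B (rho & Hi & H)] Hq.
    assert (Bq : fbd (S n) q) by (rewrite Forall_forall in B; apply (B _ Hq)).
    assert (E : exists d, ~ fsat R (env_cons d rho) q).
    { apply NNPP. intros Hn. apply (H _ Hq). intros d. apply NNPP. eauto. }
    destruct E as [d Hd]. destruct (classic (exists x, x < n /\ rho x = d)) as [(x & Hx & <-)|Hn].
    + left. exists x. split; auto. split.
      * constructor; auto. simpl. split; auto. apply fbd_finst; auto.
      * exists rho. split; auto. intros p [<-|Hp]; auto. simpl. rewrite fsat_finst. auto.
    + right. destruct (@cond_S D R n l rho d) as (B' & Hi' & H'); auto.
      { intros i Hin E. apply Hn. eauto. }
      split.
      * constructor; auto. simpl. split; auto. apply fbd_finst; auto. eapply fbd_mono; [|exact Bq]. lia.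
      * exists (upd rho n d). split; auto. intros p [<-|Hp]; auto. simpl. rewrite fsat_finst, upd_eq.
        intros Hs. apply Hd. revert Hs. apply (fsat_agree R q (n := S n)); auto.
        intros [|i] Hin; simpl; auto. symmetry. apply upd_lt. lia.
  - intros n l [B (rho & Hi & H)]. destruct (Inf (map rho (seq 0 n))) as [d Hd].
    destruct (@cond_S D R n l rho d) as (B' & Hi' & H'); auto.
    { intros i Hin E. apply Hd. apply in_map_iff. exists i. split; auto. apply in_seq; lia. }
    split; eauto.
  - intros n l [B (rho & Hi & H)] K. rewrite Forall_forall in B.
    destruct K as [K|[(q & K1 & K2)|[(a & b & K1 & K2 & K3)|[(a & b & K1 & K2)|[(q & x & K1 & K2 & K3)|[(x & y & K1 & K2)|(x & K1)]]]]]].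
    + exact (H _ K).
    + exact (H _ K2 (H _ K1)).
    + exact (H _ K3 (H _ K1 (H _ K2))).
    + pose proof (H _ K1) as Q. simpl in Q. destruct K2 as [K2|K2]; apply H in K2; simpl in K2; tauto.
    + apply H in K1, K3. simpl in K1, K3. apply K3, fsat_finst, K1.
    + apply K2. pose proof (B _ K1) as Q. simpl in Q. apply Hi; try tauto. exact (H _ K1).
    + exact (H _ K1 eq_refl).
Qed.

(** * Finitely many types *)

Definition few_types {D} (R : D -> D -> Prop) : Prop :=
  forall n, exists F, Forall (fbd n) F /\ forall p, fbd n p -> exists q, In q F /\
    forall rho, inj_below n rho -> (fsat R rho p <-> fsat R rho q).

Definition elem_equiv {D E} (R : D -> D -> Prop) (R' : E -> E -> Prop) : Prop :=
  forall p, fbd 0 p -> forall rho rho', fsat R rho p <-> fsat R' rho' p.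

(** The predicate [S p] restricted to the finite list [C] takes finitely many values, and one
    formula satisfying [Q] is picked for each value that occurs. *)
Lemma finite_classes {K} (C : list K) (S : fm -> K -> Prop) : forall Q : fm -> Prop,
  exists F, (forall q, In q F -> Q q) /\
    forall p, Q p -> exists q, In q F /\ forall c, In c C -> (S p c <-> S q c).
Proof.
  induction C as [|c C IH]; intros Q.
  - destruct (classic (exists p, Q p)) as [[p Hp]|Hn].
    + exists [p]. split. intros q [<-|[]]; auto. intros p' _. exists p. simpl. split; auto. tauto.
    + exists []. split. intros q []. intros p Hp. exfalso. eauto.
  - destruct (IH (fun p => Q p /\ S p c)) as (F1 & A1 & B1).
    destruct (IH (fun p => Q p /\ ~ S p c)) as (F2 & A2 & B2).
    exists (F1 ++ F2). split.
    + intros q Hq. apply in_app_or in Hq. destruct Hq as [Hq|Hq]; [apply A1|apply A2]; auto.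
    + intros p Hp. destruct (classic (S p c)) as [Hs|Hs].
      * destruct (B1 p (conj Hp Hs)) as (q & Hq & E). exists q. split. apply in_or_app; auto.
        intros c' [<-|Hc]; auto. specialize (A1 q Hq). tauto.
      * destruct (B2 p (conj Hp Hs)) as (q & Hq & E). exists q. split. apply in_or_app; auto.
        intros c' [<-|Hc]; auto. specialize (A2 q Hq). tauto.
Qed.

Section Types.
Context {D : Type} (R : D -> D -> Prop).
Hypothesis Inf : infinite D.
Variable n : nat.

(** A principal formula: it generates a complete type of [n] distinct elements. *)
Definition isolating (a : fm) : Prop :=
  fbd n a /\ (exists rho, inj_below n rho /\ fsat R rho a) /\
  forall p, fbd n p ->
    (forall rho, inj_below n rho -> fsat R rho a -> fsat R rho p) \/
    (forall rho, inj_below n rho -> fsat R rho a -> ~ fsat R rho p).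

(** Every formula is decided by every member of [A], so it is determined on all tuples by the set of
    members that imply it. *)
Lemma finitely_many_isolating A : (forall a, In a A -> isolating a) ->
  (forall rho, inj_below n rho -> exists a, In a A /\ fsat R rho a) ->
  exists F, Forall (fbd n) F /\ forall p, fbd n p -> exists q, In q F /\
    forall rho, inj_below n rho -> (fsat R rho p <-> fsat R rho q).
Proof.
  intros HA HC.
  destruct (@finite_classes fm A (fun p a => forall rho, inj_below n rho -> fsat R rho a -> fsat R rho p) (fbd n))
    as (F & HF & HB).
  exists F. split. apply Forall_forall; auto. intros p Hp. destruct (HB p Hp) as (q & Hq & E).
  exists q. split; auto. intros rho Hr. destruct (HC rho Hr) as (a & Ha & Hs).
  specialize (E a Ha). destruct (HA a Ha) as (_ & _ & Dc).
  pose proof (Dc p Hp) as Dp. pose proof (Dc q (HF q Hq)) as Dq.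
  split; intros H.
  - apply E; auto. destruct Dp as [Dp|Dp]; auto. exfalso. eapply Dp; eauto.
  - apply E; auto. destruct Dq as [Dq|Dq]; auto. exfalso. eapply Dq; eauto.
Qed.

(** The variables [0 .. n-1] are to name a tuple satisfying no isolating formula; the
    quantifier over finite [A] builds compactness into the condition. *)
Definition avoiding (m : nat) (l : list fm) : Prop :=
  n <= m /\ forall A, (forall a, In a A -> isolating a) -> cond R m (map FNeg A ++ l).

(** Finitely many failures, each caused by its own finite set of isolating formulas, are all caused
    by the union of these sets. *)
Lemma avoiding_fail m f k : (forall x, x < k -> ~ avoiding m (f x)) -> n <= m ->
  exists A, (forall a, In a A -> isolating a) /\ forall x, x < k -> ~ cond R m (map FNeg A ++ f x).
Proof.
  intros H Hm. induction k as [|k IH].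
  - exists []. split. intros a []. lia.
  - destruct IH as (A & HA & HB); auto.
    assert (E : exists B, (forall a, In a B -> isolating a) /\ ~ cond R m (map FNeg B ++ f k)).
    { apply NNPP. intros Hn. apply (H k); auto. split; auto. intros B HBi. apply NNPP. eauto. }
    destruct E as (B & HBi & Hk). exists (A ++ B). split.
    + intros a Ha. apply in_app_or in Ha. destruct Ha; auto.
    + intros x Hx Hc. assert (x < k \/ x = k) as [L| ->] by lia.
      * apply (HB x L). revert Hc. apply cond_incl. apply incl_app_app; [|apply incl_refl].
        rewrite map_app. apply incl_appl, incl_refl.
      * apply Hk. revert Hc. apply cond_incl. apply incl_app_app; [|apply incl_refl].
        rewrite map_app. apply incl_appr, incl_refl.
Qed.

Lemma incl_push {A} (x : A) l m : incl (l ++ x :: m) (x :: l ++ m).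
Proof. intros y Hy. apply in_app_or in Hy. simpl in *. rewrite in_app_iff. tauto. Qed.

(** If all finitely many candidate extensions failed, the union of the sets [A] responsible would
    contradict the same property of [cond R]. For [cp_wit] the candidates are the [m] old names and
    one new name, handled by two unions. *)
Lemma avoiding_consistency : consistency avoiding.
Proof.
  pose proof (cond_consistency R Inf) as C. constructor.
  - intros m l q [Hm H] Hq. apply NNPP. intros Hn.
    destruct (@avoiding_fail m (fun x => match x with 0 => q :: l | _ => FNeg q :: l end) 2) as (A & HA & HB); auto.
    { intros [|x] _; tauto. }
    destruct (cp_dec C _ _ _ (H A HA) Hq) as [K|K].
    + apply (HB 0); auto. revert K. apply cond_incl, incl_push.
    + apply (HB 1); auto. revert K. apply cond_incl, incl_push.
  - intros m l q [Hm H] Hq. apply NNPP. intros Hn.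
    destruct (@avoiding_fail m (fun x => FNeg (finst x q) :: l) m) as (A & HA & HB); auto.
    { intros x Hx K. apply Hn. left. eauto. }
    destruct (@avoiding_fail (S m) (fun x => FNeg (finst m q) :: l) 1) as (B & HA' & HB'); auto.
    assert (I : forall a, In a (A ++ B) -> isolating a).
    { intros a Ha. apply in_app_or in Ha. destruct Ha; auto. }
    destruct (cp_wit C _ _ q (H (A ++ B) I)) as [(x & Hx & K)|K].
    + apply in_or_app. auto.
    + apply (HB x Hx). revert K. apply cond_incl. rewrite map_app. intros y Hy. apply in_app_or in Hy.
      simpl in *. rewrite !in_app_iff. tauto.
    + apply (HB' 0); auto. revert K. apply cond_incl. rewrite map_app. intros y Hy. apply in_app_or in Hy.
      simpl in *. rewrite !in_app_iff. tauto.
  - intros m l [Hm H]. split; [lia|]. intros A HA. apply (cp_ext C). auto.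
  - intros m l [Hm H]. exact (cp_clash C (H [] (fun a Ha => False_ind _ Ha))).
Qed.

Lemma elem_equiv_of_conditions (Con : nat -> list fm -> Prop) (R' : nat -> nat -> Prop) (N : nat -> nat) G :
  (forall m l, Con m l -> cond R m l) -> (forall i, Con (N i) (G i)) ->
  (forall p, exists i : nat, In p (G i) \/ In (FNeg p) (G i)) ->
  (forall i p, In p (G i) -> fsat R' (fun x => x) p) -> elem_equiv R R'.
Proof.
  intros HC HN Hd Ht p Hp rho rho'.
  assert (T : forall q, fbd 0 q -> forall i, In q (G i) -> fsat R rho q /\ fsat R' rho' q).
  { intros q Hq i Hi. split.
    - destruct (HC _ _ (HN i)) as [_ (sg & _ & Hs)]. generalize (Hs _ Hi). apply fsat_sentence; auto.
    - generalize (Ht _ _ Hi). apply fsat_sentence; auto. }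
  destruct (Hd p) as [i [Hi|Hi]]; apply T in Hi; simpl in *; tauto.
Qed.

(** The compactness half: when no finite set of isolating formulas covers all tuples, the
    construction started from the condition [(n, [])] makes [0 .. n-1] a tuple that satisfies none
    of them. *)
Lemma isolating_avoided :
  (forall A, (forall a, In a A -> isolating a) -> exists rho, inj_below n rho /\ forall a, In a A -> ~ fsat R rho a) ->
  exists R' : nat -> nat -> Prop, elem_equiv R R' /\
    forall a, isolating a -> ~ fsat R' (fun x => x) a.
Proof.
  intros H.
  destruct (@model_existence avoiding (fun _ _ _ => True) n []) as (R' & N & G & N0 & G0 & HC & _ & _ & Hd & Ht).
  - apply avoiding_consistency.
  - intros _ m l Hc. exists m, l. split; auto. split; auto. apply incl_refl.
  - split; auto. intros A HA. destruct (H A HA) as (rho & Hi & Hr). split.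
    + rewrite app_nil_r. apply Forall_forall. intros p Hp. apply in_map_iff in Hp.
      destruct Hp as (a & <- & Ha). simpl. split; auto. apply HA; auto.
    + exists rho. split; auto. intros p Hp. rewrite app_nil_r in Hp. apply in_map_iff in Hp.
      destruct Hp as (a & <- & Ha). simpl. apply Hr; auto.
  - exists R'. split.
    + apply elem_equiv_of_conditions with (Con := avoiding) (N := N) (G := G); auto.
      intros m l [_ Hc]. apply (Hc []). intros a [].
    + intros a Ha Hs. destruct (Hd a) as [i [Hi|Hi]].
      * destruct (HC i) as [_ Hc]. destruct (Hc [a]) as [_ (rho & _ & Hr)].
        { intros b [<-|[]]; auto. }
        apply (Hr (FNeg a)). simpl; auto. apply Hr. simpl; auto.
      * apply (Ht _ _ Hi Hs).
Qed.

Definition tuple (s : list nat) (i : nat) : nat := nth i s 0.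

(** The omitting types theorem for the type of [rho0]. Every tuple [s] must at some stage be
    promised to fail a formula of this type; a condition that cannot be extended in this way would
    yield a formula isolating the type. *)
Lemma nonisolated_omitted (rho0 : nat -> D) :
  inj_below n rho0 -> (forall a, isolating a -> ~ fsat R rho0 a) ->
  exists R' : nat -> nat -> Prop, elem_equiv R R' /\
    forall s, length s = n -> NoDup s ->
      exists p, fbd n p /\ fsat R rho0 p /\ ~ fsat R' (tuple s) p.
Proof.
  intros Hr0 Hno.
  pose (om := fun s (l : list fm) => exists p, fbd n p /\ fsat R rho0 p /\ In (FNeg (ren (tuple s) p)) l).
  pose proof (cond_consistency R Inf) as C.
  destruct (@model_existence (cond R) (fun j _ l => forall s, s = unlist j -> length s = n -> NoDup s -> om s l) 0 [])
    as (R' & N & G & N0 & G0 & HC & _ & HD & Hd & Ht); auto.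
  - intros j m l Hc.
    destruct (classic (length (unlist j) = n /\ NoDup (unlist j))) as [[Hl Hnd]|Hn].
    2: { exists m, l. split; auto. split. apply incl_refl. split; auto. intros s -> H1 H2. tauto. }
    set (s := unlist j) in *.
    assert (E : exists m', m <= m' /\ forall i, i < n -> tuple s i < m').
    { exists (m + S (list_max s)). split; [lia|]. intros i Hi.
      assert (tuple s i <= list_max s); [|lia].
      pose proof (proj1 (list_max_le s (list_max s)) (le_n _)) as Q. rewrite Forall_forall in Q. apply Q.
      apply nth_In. lia. }
    destruct E as (m' & Hm & Hs).
    apply NNPP. intros Hfail.
    assert (Hc' : cond R m' l) by (eapply cp_le; eauto).
    (* As no extension by a negated formula of the type is possible, every realisation of the
       condition makes [s] name a tuple satisfying the whole type. *)
    assert (HF : forall p, fbd n p -> fsat R rho0 p -> forall rho, inj_below m' rho ->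
       (forall q, In q l -> fsat R rho q) -> fsat R (fun i => rho (tuple s i)) p).
    { intros p Hp Hsat rho Hi Hq. rewrite <- fsat_ren. apply NNPP. intros Hneg. apply Hfail.
      exists m', (FNeg (ren (tuple s) p) :: l). split; auto. split. apply incl_tl, incl_refl. split.
      - split.
        + constructor; [|apply Hc']. simpl. split; auto. eapply fbd_ren; eauto.
        + exists rho. split; auto. intros q [<-|Hq']; auto.
      - intros s' -> _ _. exists p. simpl. auto. }
    (* [theta] says of an [n]-tuple that it sits at the positions [s] of some realisation of the
       condition. The [m'] quantified elements occupy the variables [0 .. m'-1], so free variable
       [i] appears as [m' + i]. *)
    pose (theta := exn m' (FConj (l ++ dist m' ++ map (fun i => FEq (tuple s i) (m' + i)) (seq 0 n)))).
    assert (Bt : fbd n theta).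
    { apply fbd_exn, fbd_FConj. apply Forall_app. split; [|apply Forall_app; split].
      - eapply Forall_impl; [|apply Hc']. intros q. apply fbd_mono. lia.
      - eapply Forall_impl; [|apply fbd_dist]. intros q. apply fbd_mono. lia.
      - apply Forall_forall. intros q Hq. apply in_map_iff in Hq. destruct Hq as (i & <- & Hi).
        apply in_seq in Hi. simpl. specialize (Hs i). lia. }
    assert (St : forall rho, fsat R rho theta <-> exists sg, inj_below m' sg /\ (forall q, In q l -> fsat R sg q) /\
       forall i, i < n -> sg (tuple s i) = rho i).
    { intros rho. unfold theta. rewrite fsat_exn. split.
      - intros (w & Hw & Hc2). rewrite fsat_FConj in Hc2. exists (envl w rho). split; [|split].
        + apply (fsat_dist R). intros q Hq. apply Hc2. rewrite !in_app_iff. auto.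
        + intros q Hq. apply Hc2. rewrite !in_app_iff. auto.
        + intros i Hi. rewrite <- (envl_ge w rho i), Hw.
          apply (Hc2 (FEq (tuple s i) (m' + i))). rewrite !in_app_iff. do 2 right. apply in_map_iff.
          exists i. split; auto. apply in_seq; lia.
      - intros (sg & Hi & Hq & He). exists (map sg (seq 0 m')).
        assert (Hlen : length (map sg (seq 0 m')) = m') by (rewrite length_map, length_seq; auto).
        split; auto. rewrite fsat_FConj.
        assert (Ag : forall i, i < m' -> sg i = envl (map sg (seq 0 m')) rho i).
        { intros i Him. rewrite envl_lt with (d := sg 0) by (rewrite Hlen; auto).
          rewrite map_nth, seq_nth by auto. auto. }
        intros q Hqin. rewrite !in_app_iff in Hqin. destruct Hqin as [Hqin|[Hqin|Hqin]].
        + assert (Bq : fbd m' q) by (destruct Hc' as [B _]; rewrite Forall_forall in B; auto).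
          apply (fsat_agree R q _ _ Bq Ag); auto.
        + revert q Hqin. apply (fsat_dist R). intros x y Hx Hy. rewrite <- !Ag by auto. apply Hi; auto.
        + apply in_map_iff in Hqin. destruct Hqin as (i & <- & Hin). apply in_seq in Hin. simpl.
          rewrite <- Ag by (apply Hs; lia). rewrite He by lia.
          rewrite <- Hlen at 2. rewrite envl_ge. auto. }
    assert (Iso : isolating theta).
    { split; auto. split.
      - destruct Hc' as [_ (sg & Hi & Hq)]. exists (fun i => sg (tuple s i)). split.
        + intros x y Hx Hy E. apply Hi in E; auto. unfold tuple in E. eapply NoDup_nth with (d := 0); eauto; lia.
        + apply St. exists sg. auto.
      - intros p Hp. destruct (classic (fsat R rho0 p)) as [Hsat|Hsat]; [left|right]; intros rho _ Hth;
          apply St in Hth; destruct Hth as (sg & Hi & Hq & He).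
        + generalize (HF p Hp Hsat sg Hi Hq). apply (fsat_agree R p (n := n)); auto; intros; symmetry; auto.
        + assert (Hp' : fbd n (FNeg p)) by (simpl; auto).
          generalize (HF (FNeg p) Hp' Hsat sg Hi Hq). apply (fsat_agree R (FNeg p) (n := n)); auto; intros; symmetry; auto. }
    (* If [theta] failed at [rho0], its negation would belong to the type, and [HF] would make it
       true of a tuple that satisfies [theta]. *)
    apply (Hno theta Iso). apply NNPP. intros Hnt.
    assert (Bn : fbd n (FNeg theta)) by (simpl; auto).
    destruct Iso as (_ & (rho & Hi & Hth) & _).
    apply St in Hth as Hth'. destruct Hth' as (sg & Hi' & Hq & He).
    pose proof (HF _ Bn Hnt sg Hi' Hq) as K.
    assert (K' : fsat R rho (FNeg theta)) by (revert K; apply (fsat_agree R (FNeg theta) (n := n)); auto; intros; symmetry; auto).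
    apply K', Hth.
  - split; auto. destruct (infinite_inhabited Inf) as [d].
    exists (fun _ => d). split. intros i j; lia. intros p [].
  - exists R'. split.
    + apply elem_equiv_of_conditions with (Con := cond R) (N := N) (G := G); auto.
    + intros s Hl Hnd. destruct (HD (enc s)) as [i Hi].
      destruct (Hi s) as (p & Hp & Hs & Hin); auto. { rewrite unlist_enc. auto. }
      exists p. split; auto. split; auto. apply Ht in Hin. simpl in Hin.
      rewrite fsat_ren in Hin. exact Hin.
Qed.
End Types.

Definition graph_iso {D E} (R : D -> D -> Prop) (R' : E -> E -> Prop) (h : D -> E) : Prop :=
  bijection h /\ forall x y, R x y <-> R' (h x) (h y).

Lemma fsat_iso {D E} (R : D -> D -> Prop) (R' : E -> E -> Prop) h : graph_iso R R' h ->
  forall p rho, fsat R rho p <-> fsat R' (fun i => h (rho i)) p.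
Proof.
  intros [[Hi Hsu] HR]. induction p; intros rho; simpl.
  - tauto.
  - split; intros H. congruence. auto.
  - apply HR.
  - rewrite IHp1, IHp2. tauto.
  - split; intros H.
    + intros e. destruct (Hsu e) as [d <-]. specialize (H d). rewrite IHp in H. revert H.
      apply fsat_ext. intros [|i]; auto.
    + intros d. rewrite IHp. specialize (H (h d)). revert H. apply fsat_ext. intros [|i]; auto.
Qed.

(** A tuple satisfying no isolating formula has a type omitted in some elementarily equivalent [R'],
    although an isomorphism would carry the tuple there. If there is no such tuple and yet no finite
    set of isolating formulas suffices, some [R'] does contain one, and an isomorphism brings it
    back. *)
Theorem few_types_of_categorical {D} (R : D -> D -> Prop) : infinite D ->
  (forall R' : nat -> nat -> Prop, elem_equiv R R' -> exists h, graph_iso R R' h) -> few_types R.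
Proof.
  intros Inf U n. apply NNPP. intros Hno.
  destruct (classic (exists rho, inj_below n rho /\ forall a, isolating R n a -> ~ fsat R rho a)) as [(rho & Hi & Hr)|Hn].
  - destruct (nonisolated_omitted Inf Hi Hr) as (R' & He & Hom).
    destruct (U R' He) as [h Hh]. set (s := map (fun i => h (rho i)) (seq 0 n)).
    assert (Hs : forall i, i < n -> tuple s i = h (rho i)).
    { intros i Hin. unfold tuple, s. rewrite nth_indep with (d' := h (rho 0)) by (rewrite length_map, length_seq; auto).
      rewrite (map_nth (fun i => h (rho i))), seq_nth; auto. }
    destruct (Hom s) as (p & Hp & Hsat & Hns).
    + unfold s. rewrite length_map, length_seq. auto.
    + apply NoDup_nth with (d := 0). unfold s at 1 2. rewrite length_map, length_seq.
      intros i j Hin Hjn E. change (tuple s i = tuple s j) in E. rewrite !Hs in E by auto.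
      apply Hh in E. apply Hi; auto.
    + apply Hns. apply (fsat_agree R' p _ _ Hp Hs). apply (fsat_iso Hh). auto.
  - destruct (@isolating_avoided D R Inf n) as (R' & He & Hav).
    { intros A HA. apply NNPP. intros Hn'. apply Hno. apply finitely_many_isolating with (A := A); auto.
      intros rho Hr. apply NNPP. intros Hn2. apply Hn'. exists rho. split; auto.
      intros a Ha Hs. apply Hn2. eauto. }
    destruct (U R' He) as [h Hh]. apply Hn. destruct Hh as [[Hi Hsu] HR] eqn:EH.
    assert (Hg : exists g, forall e, h (g e) = e).
    { exists (fun e => proj1_sig (constructive_indefinite_description _ (Hsu e))).
      intros e. destruct (constructive_indefinite_description _ (Hsu e)). auto. }
    destruct Hg as [g Hg]. exists g. split.
    + intros i j _ _ E. rewrite <- (Hg i), <- (Hg j). congruence.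
    + intros a Ha Hs. apply (Hav a Ha). apply (fsat_iso Hh) in Hs. revert Hs. apply fsat_ext. auto.
Qed.

Lemma inj_below_envl {D} (a : list D) rho : inj_below (length a) (envl a rho) <-> NoDup a.
Proof.
  destruct a as [|d a'] eqn:E.
  - split; intros. constructor. intros i j Hi. simpl in Hi. lia.
  - rewrite <- E. rewrite NoDup_nth with (d := d). split; intros H i j Hi Hj Eq.
    + apply H; auto. rewrite !envl_lt with (d := d); auto.
    + apply H; auto. rewrite !envl_lt with (d := d) in Eq; auto.
Qed.

Lemma fsat_exn_inj {D} (R : D -> D -> Prop) n l rho : Forall (fbd n) l ->
  fsat R rho (exn n (FConj (dist n ++ l))) <-> cond R n l.
Proof.
  intros Hb. rewrite fsat_exn. split.
  - intros (w & Hw & H). rewrite fsat_FConj in H. split; auto. exists (envl w rho). split.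
    + apply (fsat_dist R). intros p Hp. apply H, in_or_app. auto.
    + intros p Hp. apply H, in_or_app. auto.
  - intros [_ (sg & Hi & H)]. exists (map sg (seq 0 n)).
    assert (Hlen : length (map sg (seq 0 n)) = n) by (rewrite length_map, length_seq; auto).
    assert (Ag : forall i, i < n -> sg i = envl (map sg (seq 0 n)) rho i).
    { intros i Hin. rewrite envl_lt with (d := sg 0) by (rewrite Hlen; auto).
      rewrite map_nth, seq_nth by auto. auto. }
    split; auto. apply fsat_FConj. intros p Hp.
    assert (Bp : fbd n p).
    { apply in_app_or in Hp. destruct Hp as [Hp|Hp].
      - pose proof (fbd_dist n) as Q. rewrite Forall_forall in Q. auto.
      - rewrite Forall_forall in Hb. auto. }
    apply (fsat_agree R p _ _ Bp Ag). apply in_app_or in Hp. destruct Hp as [Hp|Hp]; auto.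
    revert p Hp Bp. intros p Hp _. revert p Hp. apply (fsat_dist R). auto.
Qed.

Lemma cond_equiv {D E} (R : D -> D -> Prop) (R' : E -> E -> Prop) n l : inhabited D -> inhabited E ->
  elem_equiv R R' -> cond R n l -> cond R' n l.
Proof.
  intros [d] [e] He H. pose proof (proj1 H) as Hb.
  apply (@fsat_exn_inj _ R' n l (fun _ => e) Hb). apply (@fsat_exn_inj _ R n l (fun _ => d) Hb) in H. revert H.
  apply He. apply fbd_exn, fbd_FConj, Forall_app. rewrite Nat.add_0_r. split; auto. apply fbd_dist.
Qed.

(** Equivalence of formulas thereby becomes a statement about [cond], which single sentences
    express. It can then be transferred between elementarily equivalent structures and read off a
    decided theory. *)
Lemma equiv_cond {D} (R : D -> D -> Prop) n p q : fbd n p -> fbd n q ->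
  (forall rho, inj_below n rho -> (fsat R rho p <-> fsat R rho q)) <->
  ~ cond R n [p; FNeg q] /\ ~ cond R n [q; FNeg p].
Proof.
  intros Hp Hq. split.
  - intros H. split; intros [_ (rho & Hi & Hr)].
    + apply (Hr (FNeg q)); simpl; auto. apply H; auto. apply Hr; simpl; auto.
    + apply (Hr (FNeg p)); simpl; auto. apply H; auto. apply Hr; simpl; auto.
  - intros [H1 H2] rho Hi. split; intros H; apply NNPP; intros Hn.
    + apply H1. split. repeat constructor; simpl; auto. exists rho. split; auto. intros r [<-|[<-|[]]]; auto.
    + apply H2. split. repeat constructor; simpl; auto. exists rho. split; auto. intros r [<-|[<-|[]]]; auto.
Qed.

Lemma equiv_transfer {D E} (R : D -> D -> Prop) (R' : E -> E -> Prop) n p q :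
  inhabited D -> inhabited E -> elem_equiv R R' -> fbd n p -> fbd n q ->
  (forall rho, inj_below n rho -> (fsat R rho p <-> fsat R rho q)) ->
  (forall rho, inj_below n rho -> (fsat R' rho p <-> fsat R' rho q)).
Proof.
  intros HD HE He Hp Hq. assert (He' : elem_equiv R' R).
  { intros r Hr rho rho'. symmetry. apply He; auto. }
  rewrite !equiv_cond by auto. intros [H1 H2]. split; intros K; [apply H1|apply H2]; eapply cond_equiv; eauto.
Qed.

Lemma few_types_transfer {D E} (R : D -> D -> Prop) (R' : E -> E -> Prop) :
  inhabited D -> inhabited E -> elem_equiv R R' -> few_types R -> few_types R'.
Proof.
  intros HD HE He H n. destruct (H n) as (F & HF & HB). exists F. split; auto.
  intros p Hp. destruct (HB p Hp) as (q & Hq & Heq). exists q. split; auto.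
  rewrite Forall_forall in HF. apply (@equiv_transfer _ _ R R' n p q HD HE He Hp (HF q Hq) Heq).
Qed.

(** * Back and forth *)

Definition partial_iso {D E} (R : D -> D -> Prop) (R' : E -> E -> Prop) (d : D) (e : E) (l : list (D * E)) : Prop :=
  NoDup (map fst l) /\ NoDup (map snd l) /\
  forall p, fbd (length l) p ->
    (fsat R (envl (map fst l) (fun _ => d)) p <-> fsat R' (envl (map snd l) (fun _ => e)) p).

(** By [few_types] the type of [x] over the tuple is given by finitely many formulas [G]: each
    member of [F] or its negation. That an element with these properties exists is a formula true of
    the first tuple, hence of the second. *)
Lemma forth {D E} (R : D -> D -> Prop) (R' : E -> E -> Prop) d e l x :
  elem_equiv R R' -> few_types R -> partial_iso R R' d e l -> ~ In x (map fst l) ->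
  exists y, partial_iso R R' d e ((x, y) :: l).
Proof.
  intros He Hf (N1 & N2 & Hl) Hx. set (k := length l) in *.
  destruct (Hf (S k)) as (F & HF & HB). rewrite Forall_forall in HF.
  set (r1 := envl (x :: map fst l) (fun _ => d)).
  assert (HG : exists G, Forall (fbd (S k)) G /\ (forall g, In g G -> fsat R r1 g) /\
     forall q, In q F -> (fsat R r1 q -> In q G) /\ (~ fsat R r1 q -> In (FNeg q) G)).
  { clear HB. induction F as [|q F IH].
    - exists []. split; auto. split; intros g [].
    - destruct IH as (G & G1 & G2 & G3). { intros; apply HF; simpl; auto. }
      destruct (classic (fsat R r1 q)) as [Hs|Hs].
      + exists (q :: G). split; [constructor; auto; apply HF; simpl; auto|]. split.
        * intros g [<-|Hg]; auto.
        * intros q' [<-|Hq']; simpl. tauto. destruct (G3 q' Hq'). tauto.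
      + exists (FNeg q :: G). split; [constructor; auto; simpl; split; auto; apply HF; simpl; auto|]. split.
        * intros g [<-|Hg]; auto.
        * intros q' [<-|Hq']; simpl. tauto. destruct (G3 q' Hq'). tauto. }
  destruct HG as (G & G1 & G2 & G3).
  (* The formulas [dist (S k)] make the element found on the other side differ from those already
     matched. *)
  pose (b := FEx (FConj (dist (S k) ++ G))).
  assert (Hb : fbd k b).
  { simpl. split; auto. split; auto. apply fbd_FConj, Forall_app. split; auto. apply fbd_dist. }
  assert (L1 : length (x :: map fst l) = S k) by (simpl; rewrite length_map; auto).
  assert (S1 : fsat R (envl (map fst l) (fun _ => d)) b).
  { apply fsat_ex. exists x. apply fsat_FConj. intros p Hp. apply in_app_or in Hp. destruct Hp as [Hp|Hp].
    - revert p Hp. apply (fsat_dist R). rewrite <- L1. apply (inj_below_envl (x :: map fst l)). constructor; auto.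
    - apply G2. auto. }
  apply (Hl b Hb) in S1. apply fsat_ex in S1. destruct S1 as [y Sy]. rewrite fsat_FConj in Sy.
  assert (L2 : length (y :: map snd l) = S k) by (simpl; rewrite length_map; auto).
  assert (I2 : inj_below (S k) (envl (y :: map snd l) (fun _ => e))).
  { apply (fsat_dist R'). intros p Hp. apply Sy, in_or_app. auto. }
  assert (ND1 : NoDup (x :: map fst l)) by (constructor; auto).
  assert (I1 : inj_below (S k) r1). { rewrite <- L1. apply inj_below_envl. auto. }
  exists y. split; [auto|split].
  - simpl. rewrite <- L2 in I2. apply inj_below_envl in I2. auto.
  - simpl length. fold k. intros p Hp. change (fsat R r1 p <-> fsat R' (envl (y :: map snd l) (fun _ => e)) p).
    destruct (HB p Hp) as (q & Hq & Heq).
    assert (Heq' : forall rho, inj_below (S k) rho -> (fsat R' rho p <-> fsat R' rho q)).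
    { apply (@equiv_transfer _ _ R R' (S k) p q (inhabits d) (inhabits e) He Hp (HF q Hq) Heq). }
    rewrite (Heq _ I1), (Heq' _ I2). destruct (G3 q Hq) as [Q1 Q2]. split; intros H.
    + apply Sy, in_or_app. auto.
    + apply NNPP. intros Hn. apply (Sy (FNeg q)); auto. apply in_or_app. auto.
Qed.

Definition swap {A B} (p : A * B) : B * A := (snd p, fst p).

Lemma partial_iso_swap {D E} (R : D -> D -> Prop) (R' : E -> E -> Prop) d e l :
  partial_iso R R' d e l -> partial_iso R' R e d (map swap l).
Proof.
  intros (N1 & N2 & H). unfold partial_iso. rewrite !map_map, length_map. simpl.
  split; auto. split; auto. intros p Hp. symmetry. apply H. auto.
Qed.

Lemma map_swap {A B} (l : list (A * B)) : map swap (map swap l) = l.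
Proof. rewrite map_map. rewrite <- (map_id l) at 2. apply map_ext. intros []; auto. Qed.

Theorem back_and_forth {D E} (R : D -> D -> Prop) (R' : E -> E -> Prop) (e1 : nat -> D) (e2 : nat -> E) :
  (forall x, exists n, e1 n = x) -> (forall y, exists n, e2 n = y) ->
  elem_equiv R R' -> few_types R -> exists h, graph_iso R R' h.
Proof.
  intros S1 S2 He Hf.
  assert (He' : elem_equiv R' R). { intros r Hr rho rho'. symmetry. apply He; auto. }
  assert (Hf' : few_types R').
  { exact (few_types_transfer (inhabits (e1 0)) (inhabits (e2 0)) He Hf). }
  set (P := partial_iso R R' (e1 0) (e2 0)).
  assert (Fo : forall l x, P l -> exists l', P l' /\ incl l l' /\ In x (map fst l')).
  { intros l x Hl. destruct (classic (In x (map fst l))) as [Hx|Hx].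
    - exists l. split; auto. split; auto. apply incl_refl.
    - destruct (@forth _ _ R R' (e1 0) (e2 0) l x He Hf Hl Hx) as [y Hy]. exists ((x, y) :: l). split; auto. split.
      apply incl_tl, incl_refl. simpl; auto. }
  assert (Ba : forall l y, P l -> exists l', P l' /\ incl l l' /\ In y (map snd l')).
  { intros l y Hl. destruct (classic (In y (map snd l))) as [Hy|Hy].
    - exists l. split; auto. split; auto. apply incl_refl.
    - apply partial_iso_swap in Hl.
      assert (Hy' : ~ In y (map fst (map swap l))) by (rewrite map_map; auto).
      destruct (@forth _ _ R' R (e2 0) (e1 0) (map swap l) y He' Hf' Hl Hy') as [x Hx]. apply partial_iso_swap in Hx. simpl in Hx. rewrite map_swap in Hx.
      exists ((x, y) :: l). split; auto. split. apply incl_tl, incl_refl. simpl; auto. }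
  assert (P0 : P []).
  { split; [constructor|split; [constructor|]]. intros p Hp. apply He. auto. }
  destruct (@generic_sequence {l | P l} (fun s t => incl (proj1_sig s) (proj1_sig t))
    (fun j s => In (e1 j) (map fst (proj1_sig s)) /\ In (e2 j) (map snd (proj1_sig s))) (exist _ [] P0))
    as (f & _ & Fs & FD).
  { intros j [l Hl]. destruct (Fo l (e1 j) Hl) as (l1 & H1 & I1 & J1).
    destruct (Ba l1 (e2 j) H1) as (l2 & H2 & I2 & J2). exists (exist _ l2 H2). simpl. split.
    - eapply incl_tran; eauto.
    - split; auto. apply in_map_iff in J1. destruct J1 as (q & <- & Hq). apply in_map. auto. }
  assert (Mono : forall i j, i <= j -> incl (proj1_sig (f i)) (proj1_sig (f j))).
  { apply (@chain_le {l | P l} (fun s t => incl (proj1_sig s) (proj1_sig t))); auto.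
    intros; apply incl_refl. intros; eapply incl_tran; eauto. }
  pose (g := fun x y => exists i, In (x, y) (proj1_sig (f i))).
  assert (Two : forall x y x' y', g x y -> g x' y' -> exists l, P l /\ In (x, y) l /\ In (x', y') l).
  { intros x y x' y' [i Hi] [j Hj]. exists (proj1_sig (f (i + j))). split. apply (proj2_sig (f (i + j))).
    split; [apply (Mono i (i + j))|apply (Mono j (i + j))]; auto; lia. }
  assert (ND : forall A B (l : list (A * B)) x y y', NoDup (map fst l) -> In (x, y) l -> In (x, y') l -> y = y').
  { intros A B l x y y'. induction l as [|[a b] l IH]; simpl; [tauto|]. intros Hn. inversion Hn; subst.
    intros [Q|Q] [Q'|Q']; try congruence; auto.
    - injection Q as -> ->. exfalso. apply H1. apply in_map_iff. exists (x, y'). auto.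
    - injection Q' as -> ->. exfalso. apply H1. apply in_map_iff. exists (x, y). auto. }
  assert (Tot : forall x, exists y, g x y).
  { intros x. destruct (S1 x) as [n <-]. destruct (FD n) as [Q _]. apply in_map_iff in Q.
    destruct Q as ([a b] & <- & Q). exists b. exists (S n). auto. }
  assert (Sur : forall y, exists x, g x y).
  { intros y. destruct (S2 y) as [n <-]. destruct (FD n) as [_ Q]. apply in_map_iff in Q.
    destruct Q as ([a b] & <- & Q). exists a. exists (S n). auto. }
  pose (h := fun x => proj1_sig (constructive_indefinite_description _ (Tot x))).
  assert (Hh : forall x, g x (h x)).
  { intros x. unfold h. destruct (constructive_indefinite_description _ (Tot x)). auto. }
  exists h. split; [split|].
  - intros x y Exy. pose proof (Hh x) as Q1. pose proof (Hh y) as Q2. rewrite Exy in Q1.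
    destruct (Two _ _ _ _ Q1 Q2) as (l & (_ & N2 & _) & I1 & I2).
    apply (ND _ _ (map swap l) (h y)).
    + rewrite map_map. auto.
    + apply in_map_iff. exists (x, h y). auto.
    + apply in_map_iff. exists (y, h y). auto.
  - intros y. destruct (Sur y) as [x Hx]. exists x.
    destruct (Two _ _ _ _ Hx (Hh x)) as (l & (N1 & _) & I1 & I2). symmetry. eapply ND; eauto.
  - intros x y. destruct (Two _ _ _ _ (Hh x) (Hh y)) as (l & (_ & _ & Hl) & I1 & I2).
    apply In_nth with (d := (e1 0, e2 0)) in I1, I2.
    destruct I1 as (i & Hi & Ei), I2 as (j & Hj & Ej).
    specialize (Hl (FRel i j)). simpl in Hl.
    rewrite !envl_lt with (d := e1 0) in Hl by (rewrite length_map; auto).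
    rewrite !envl_lt with (d := e2 0) in Hl by (rewrite length_map; auto).
    assert (A1 : forall i, nth i (map fst l) (e1 0) = fst (nth i l (e1 0, e2 0))) by (intros; apply (map_nth fst l (e1 0, e2 0))).
    assert (A2 : forall i, nth i (map snd l) (e2 0) = snd (nth i l (e1 0, e2 0))) by (intros; apply (map_nth snd l (e1 0, e2 0))).
    rewrite !A1, !A2, Ei, Ej in Hl. simpl in Hl. apply Hl. auto.
Qed.

Lemma infinite_nat : infinite nat.
Proof.
  intros l. exists (S (list_max l)). intros H.
  pose proof (proj1 (list_max_le l (list_max l)) (le_n _)) as Q. rewrite Forall_forall in Q.
  apply Q in H. lia.
Qed.

(** * From graphs to structures of the official language *)

Lemma models_theory {D} (R : D -> D -> Prop) (M : structure digraph) : inhabited D ->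
  models M (theory R) -> elem_equiv R (@edge M).
Proof.
  intros [d] HM.
  assert (T : forall p, fbd 0 p -> forall rho rho', fsat R rho p -> fsat (@edge M) rho' p).
  { intros p Hp rho rho' H. rewrite <- sat_to. apply HM. split.
    - apply sentence_of. rewrite of_to. auto.
    - intros rho2. rewrite of_to. revert H. apply fsat_sentence; auto. }
  intros p Hp rho rho'. split.
  - apply T. auto.
  - intros H. apply NNPP. intros Hn. assert (Hp' : fbd 0 (FNeg p)) by (simpl; auto).
    apply (T (FNeg p) Hp' rho rho' Hn H).
Qed.

Lemma isomorphic_of_iso (M N : structure digraph) h :
  graph_iso (@edge M) (@edge N) h -> isomorphic M N.
Proof.
  intros [Hb Hr]. exists h. split; auto. split.
  - intros f. inversion f.
  - intros R v. simpl in R. pose proof (fin1 R). subst R. simpl in v.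
    rewrite (vec2 v). apply Hr.
Qed.

Lemma iso_of_isomorphic (M N : structure digraph) :
  isomorphic M N -> exists h, graph_iso (@edge M) (@edge N) h.
Proof.
  intros (h & Hb & _ & Hr). exists h. split; auto. intros x y. apply (Hr Fin.F1).
Qed.

(** The countable model of [T] is moved to the universe [nat], and completeness of [T] makes [T] its
    whole theory. Uniqueness of the countable model then feeds [few_types_of_categorical];
    conversely back-and-forth gives uniqueness. *)
Theorem categorical_theory (T : form digraph -> Prop) :
  complete_theory T /\ omega_categorical T <->
  exists R : nat -> nat -> Prop, (forall p, T p <-> theory R p) /\ few_types R.
Proof.
  split.
  - intros [CT OC]. destruct (oc_exists OC) as (M & HM & h & Hh).
    pose (R := fun x y => edge M (h x) (h y)).
    assert (HI : graph_iso R (@edge M) h) by (split; auto; reflexivity).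
    assert (HT : forall p, T p -> theory R p).
    { intros p Hp. split. apply (ct_sentences CT); auto. intros rho. rewrite (fsat_iso HI).
      rewrite <- sat_to, to_of. apply HM; auto. }
    assert (HT' : forall p, T p <-> theory R p).
    { intros p. split; auto. intros [Hs Hr]. destruct (ct_complete CT p Hs) as [|Hn]; auto.
      apply HT in Hn. exfalso. destruct Hn as [_ Hn]. apply (Hn (fun x => x)). apply Hr. }
    exists R. split; auto. apply few_types_of_categorical. apply infinite_nat.
    intros R' He.
    assert (Mod : forall Q : nat -> nat -> Prop, elem_equiv R Q -> models (str (inhabits 0) Q) T).
    { intros Q HQ p Hp rho. apply sat_str. apply HT in Hp. destruct Hp as [Hs Hr].
      apply sentence_of in Hs. apply (HQ _ Hs rho). apply Hr. }
    assert (CI : countably_infinite nat).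
    { exists (fun x => x). split; eauto. }
    destruct (oc_unique OC (M := str (inhabits 0) R) (N := str (inhabits 0) R')) as (k & Hk); auto.
    + apply Mod. intros p Hp rho rho'. split; apply fsat_sentence; auto.
    + apply (@iso_of_isomorphic (str (inhabits 0) R) (str (inhabits 0) R')). exists k; auto.
  - intros (R & HT & Hf).
    assert (T = theory R) as ->.
    { apply functional_extensionality. intros p. apply propositional_extensionality. auto. }
    split. exact (theory_complete 0 R). constructor.
    + intros M HM [l Hl]. apply models_theory in HM; [|repeat constructor].
      (* That [S (length l)] distinct elements exist is a sentence true in [nat], hence in [M],
         which contradicts the enumeration [l]. *)
      assert (K : cond (@edge M) (S (length l)) []).
      { apply (@cond_equiv nat _ R (@edge M) _ [] (inhabits 0) (carrier_nonempty M) HM).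
        split; auto. exists (fun x => x). split; auto. intros i j; auto. intros p []. }
      destruct K as [_ (rho & Hi & _)].
      assert (Q : length (map rho (seq 0 (S (length l)))) <= length l).
      { apply NoDup_incl_length; [|intros x _; auto].
        apply NoDup_map_NoDup_ForallPairs; [|apply seq_NoDup].
        intros i j Hin Hjn Eq. apply in_seq in Hin, Hjn. apply Hi; auto; lia. }
      rewrite length_map, length_seq in Q. lia.
    + exists (str (inhabits 0) R). split.
      * intros p [Hs Hp] rho. apply sat_str. auto.
      * exists (fun x => x). split; eauto.
    + intros M N HM [h1 H1] HN [h2 H2].
      apply models_theory in HM, HN; try (repeat constructor).
      assert (He : elem_equiv (@edge M) (@edge N)).
      { intros p Hp rho rho'. rewrite <- (HM p Hp (fun _ => 0)). apply HN; auto. }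
      destruct (@back_and_forth _ _ (@edge M) (@edge N) h1 h2) as [h Hh].
      * apply H1.
      * apply H2.
      * auto.
      * exact (few_types_transfer (inhabits 0) (inhabits (h1 0)) HM Hf).
      * apply isomorphic_of_iso with h. auto.
Qed.

(** * Computable operations on formulas, with Gödel numbers as codes *)

#[global] Instance Enc_fm : Enc fm := {| enc := fcode; enc_inj := fcode_inj |}.

Lemma cmp_as_code {D} `{Enc D} (f : D -> fm) (g : D -> nat) :
  (forall d, fcode (f d) = g d) -> computable g -> computable f.
Proof. intros E [c Hc]. exists c. intros d. change (enc (f d)) with (fcode (f d)). rewrite E. apply Hc. Qed.

Section FmOps.
Context {D : Type} `{Enc D}.

Lemma cmp_FImp (f g : D -> fm) : computable f -> computable g -> computable (fun d => FImp (f d) (g d)).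
Proof.
  intros Hf Hg. apply cmp_as_code with (g := fun d => ⟨2, ⟨enc (f d), enc (g d)⟩⟩). reflexivity. cmp.
Qed.
Lemma cmp_FAll (f : D -> fm) : computable f -> computable (fun d => FAll (f d)).
Proof.
  intros Hf. apply cmp_as_code with (g := fun d => ⟨3, enc (f d)⟩). reflexivity. cmp.
Qed.
Lemma cmp_FEq (f g : D -> nat) : computable f -> computable g -> computable (fun d => FEq (f d) (g d)).
Proof.
  intros Hf Hg. apply cmp_as_code with (g := fun d => ⟨1, ⟨⟨0, f d⟩, ⟨0, g d⟩⟩⟩). reflexivity. cmp.
Qed.
Lemma cmp_FRel (f g : D -> nat) : computable f -> computable g -> computable (fun d => FRel (f d) (g d)).
Proof.
  intros Hf Hg. apply cmp_as_code with (g := fun d => ⟨4, S ⟨⟨0, f d⟩, S ⟨⟨0, g d⟩, 0⟩⟩⟩). reflexivity. cmp.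
Qed.
Lemma cmp_FNeg (f : D -> fm) : computable f -> computable (fun d => FNeg (f d)).
Proof. intros. apply cmp_FImp; auto. apply cmp_const. Qed.
End FmOps.

Ltac cmp_more ::= first
  [ simple apply cmp_FNeg | simple apply cmp_FImp | simple apply cmp_FAll | simple apply cmp_FEq
  | simple apply cmp_FRel | simple apply cmp_enc ].

Section FmRec.
Context {P B : Type} `{Enc P} `{Enc B}.
Variables (b : P -> B) (e r : P -> nat -> nat -> B) (i : P -> B -> B -> B)
  (a : P -> list B -> B) (ups : P -> list P).

(** A quantifier evaluates its body at a whole list [ups z] of parameters: a single one for renaming
    and for bounding variables, one for each branch in the evaluator of sentences. *)
Fixpoint fmrec (p : fm) (z : P) : B :=
  match p with
  | FBot => b z
  | FEq x y => e z x y
  | FRel x y => r z x y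
  | FImp p q => i z (fmrec p z) (fmrec q z)
  | FAll p => a z (map (fmrec p) (ups z))
  end.

Let deps (q : P * nat) : list (P * nat) :=
  if Nat.eqb (cpi1 (snd q)) 2 then [(fst q, cpi1 (cpi2 (snd q))); (fst q, cpi2 (cpi2 (snd q)))]
  else if Nat.eqb (cpi1 (snd q)) 3 then map (fun z => (z, cpi2 (snd q))) (ups (fst q)) else [].

Let step (q : P * nat) (rs : list B) : B :=
  if Nat.eqb (cpi1 (snd q)) 1 then e (fst q) (cpi2 (cpi1 (cpi2 (snd q)))) (cpi2 (cpi2 (cpi2 (snd q))))
  else if Nat.eqb (cpi1 (snd q)) 2 then i (fst q) (nth 0 rs (b (fst q))) (nth 1 rs (b (fst q)))
  else if Nat.eqb (cpi1 (snd q)) 3 then a (fst q) rs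
  else if Nat.eqb (cpi1 (snd q)) 4 then
    r (fst q) (cpi2 (cpi1 (pred (cpi2 (snd q))))) (cpi2 (cpi1 (pred (cpi2 (pred (cpi2 (snd q)))))))
  else b (fst q).

Lemma fmrec_frec p : forall s z, fsize p < s -> frec (fun q => b (fst q)) deps step s (z, fcode p) = fmrec p z.
Proof.
  induction p; intros s z Hs; destruct s as [|s]; try lia; cbn [frec]; unfold step, deps; cbn [fst snd fcode fsize] in *;
    rewrite cpi1_pair, ?cpi2_pair; cbn [Nat.eqb]; rewrite ?cpi1_pair, ?cpi2_pair; cbn [pred];
    rewrite ?cpi1_pair, ?cpi2_pair; cbn [pred]; rewrite ?cpi1_pair, ?cpi2_pair; try reflexivity.
  - cbn [map nth]. rewrite IHp1, IHp2 by lia. reflexivity.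
  - rewrite map_map. cbn [fmrec]. f_equal. apply map_ext. intros z'. apply IHp. lia.
Qed.

Lemma fsize_fcode p : fsize p <= fcode p.
Proof.
  induction p; cbn [fsize fcode]; try lia.
  - pose proof (Cantor.to_nat_non_decreasing 2 ⟨fcode p1, fcode p2⟩).
    pose proof (Cantor.to_nat_non_decreasing (fcode p1) (fcode p2)). lia.
  - pose proof (Cantor.to_nat_non_decreasing 3 (fcode p)). lia.
Qed.

Lemma cmp_fmrec D `{Enc D} (p : D -> fm) (z : D -> P) :
  computable b ->
  computable (fun q : P * (nat * nat) => e (fst q) (fst (snd q)) (snd (snd q))) ->
  computable (fun q : P * (nat * nat) => r (fst q) (fst (snd q)) (snd (snd q))) ->
  computable (fun q : P * (B * B) => i (fst q) (fst (snd q)) (snd (snd q))) ->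
  computable (fun q : P * list B => a (fst q) (snd q)) ->
  computable ups ->
  computable p -> computable z -> computable (fun d => fmrec (p d) (z d)).
Proof.
  intros Hb He Hr Hi Ha Hu Hp Hz.
  apply cmp_ext with (f := fun d => frec (fun q => b (fst q)) deps step (S (enc (p d))) (z d, enc (p d))).
  { intros d. apply fmrec_frec. apply Nat.lt_succ_r, fsize_fcode. }
  assert (Hbf : forall X (HX : Enc X) (f : X -> P), computable f -> computable (fun x => b (f x))).
  { intros. apply cmp_comp; auto. }
  apply cmp_frec; auto.
  - apply cmp_comp; cmps.
  - unfold deps. cmps. apply cmp_comp; cmps.
  - unfold step. repeat simple apply cmp_if; cmps.
    + refine (cmp_comp (f := fun q : P * (nat * nat) => e (fst q) (fst (snd q)) (snd (snd q)))
        (g := fun p => (fst (fst p), (cpi2 (cpi1 (cpi2 (snd (fst p)))), cpi2 (cpi2 (cpi2 (snd (fst p))))))) He _); cmps.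
    + refine (cmp_comp (f := fun q : P * (B * B) => i (fst q) (fst (snd q)) (snd (snd q)))
        (g := fun p => (fst (fst p), (nth 0 (snd p) (b (fst (fst p))), nth 1 (snd p) (b (fst (fst p)))))) Hi _); cmps;
      apply Hbf; cmps.
    + refine (cmp_comp (f := fun q : P * list B => a (fst q) (snd q))
        (g := fun p => (fst (fst p), snd p)) Ha _); cmps.
    + refine (cmp_comp (f := fun q : P * (nat * nat) => r (fst q) (fst (snd q)) (snd (snd q)))
        (g := fun p => (fst (fst p), (cpi2 (cpi1 (pred (cpi2 (snd (fst p))))), cpi2 (cpi1 (pred (cpi2 (pred (cpi2 (snd (fst p)))))))))) Hr _); cmps.
    + apply Hbf; cmps.
  - cmps.
  - cmps.
Qed.
End FmRec.

Fixpoint fdec (s c : nat) : fm :=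
  match s with
  | 0 => FBot
  | S s => let t := cpi1 c in let r := cpi2 c in
    if Nat.eqb t 1 then FEq (cpi2 (cpi1 r)) (cpi2 (cpi2 r))
    else if Nat.eqb t 2 then FImp (fdec s (cpi1 r)) (fdec s (cpi2 r))
    else if Nat.eqb t 3 then FAll (fdec s r)
    else if Nat.eqb t 4 then FRel (cpi2 (cpi1 (pred r))) (cpi2 (cpi1 (pred (cpi2 (pred r)))))
    else FBot
  end.

Lemma fdec_fcode p : forall s, fsize p < s -> fdec s (fcode p) = p.
Proof.
  induction p; intros s Hs; destruct s as [|s]; try lia; cbn [fdec]; cbn [fcode fsize] in *; cbn zeta;
    rewrite cpi1_pair, ?cpi2_pair; cbn [Nat.eqb]; rewrite ?cpi1_pair, ?cpi2_pair; cbn [pred];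
    rewrite ?cpi1_pair, ?cpi2_pair; cbn [pred]; rewrite ?cpi1_pair, ?cpi2_pair; try reflexivity.
  - rewrite IHp1, IHp2 by lia. reflexivity.
  - rewrite IHp by lia. reflexivity.
Qed.

#[global] Instance Cod_fm : Cod fm.
Proof.
  refine {| dcd := fun c => fdec (S c) c |}.
  (* All possible parts of a code are dependencies regardless of its tag: entries 0 and 1 serve
     implications, entry 2 serves universal formulas. *)
  - apply cmp_ext with (f := fun c : nat => frec (fun _ => FBot) (fun c => [cpi1 (cpi2 c); cpi2 (cpi2 c); cpi2 c])
      (fun c rs =>
    if Nat.eqb (cpi1 c) 1 then FEq (cpi2 (cpi1 (cpi2 c))) (cpi2 (cpi2 (cpi2 c)))
    else if Nat.eqb (cpi1 c) 2 then FImp (nth 0 rs FBot) (nth 1 rs FBot)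
    else if Nat.eqb (cpi1 c) 3 then FAll (nth 2 rs FBot)
    else if Nat.eqb (cpi1 c) 4 then FRel (cpi2 (cpi1 (pred (cpi2 c)))) (cpi2 (cpi1 (pred (cpi2 (pred (cpi2 c))))))
    else FBot) (S c) c).
    + intros c. set (s := S c). clearbody s. revert c. induction s as [|s IH]; intros c; [reflexivity|].
      cbn [frec fdec map nth]. rewrite !IH. reflexivity.
    + apply cmp_frec; cmps.
  - intros p. exists (fcode p). apply fdec_fcode. pose proof (fsize_fcode p). lia.
Defined.

Definition fbdb (n : nat) (p : fm) : bool :=
  fmrec (fun _ => true) (fun n x y => Nat.ltb x n && Nat.ltb y n) (fun n x y => Nat.ltb x n && Nat.ltb y n)
    (fun _ => andb) (fun _ rs => forallb (fun c => c) rs) (fun n => [S n]) p n.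

Lemma fbdb_spec p : forall n, fbdb n p = true <-> fbd n p.
Proof.
  unfold fbdb. induction p; intros n; simpl.
  - tauto.
  - rewrite andb_true_iff, !Nat.ltb_lt. tauto.
  - rewrite andb_true_iff, !Nat.ltb_lt. tauto.
  - rewrite andb_true_iff, IHp1, IHp2. tauto.
  - rewrite andb_true_r. apply IHp.
Qed.

Lemma cmp_fbdb {D} `{Enc D} (n : D -> nat) (p : D -> fm) :
  computable n -> computable p -> computable (fun d => fbdb (n d) (p d)).
Proof. intros. unfold fbdb. apply cmp_fmrec; unfold Nat.ltb; cmps. Qed.

(** The renaming [instf x] under [d] binders, for [z = (d, x)]: a function with two numeric
    parameters takes the place of iterated [up]. *)
Definition liftinst (z : nat * nat) (k : nat) : nat :=
  if Nat.ltb k (fst z) then k else if Nat.eqb k (fst z) then snd z + fst z else pred k.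

Lemma ren_ext p : forall f g, (forall k, f k = g k) -> ren f p = ren g p.
Proof.
  induction p; intros f g E; simpl; rewrite ?E; auto.
  - rewrite (IHp1 f g), (IHp2 f g); auto.
  - rewrite (IHp (up f) (up g)); auto. intros [|k]; simpl; auto.
Qed.

Lemma finst_fmrec x p : finst x p = fmrec (fun _ => FBot) (fun z k l => FEq (liftinst z k) (liftinst z l))
  (fun z k l => FRel (liftinst z k) (liftinst z l)) (fun _ => FImp) (fun _ rs => FAll (nth 0 rs FBot))
  (fun z => [(S (fst z), snd z)]) p (0, x).
Proof.
  unfold finst. rewrite (ren_ext p) with (g := liftinst (0, x)).
  - set (F := fmrec _ _ _ _ _ _). generalize 0 at 1 2. unfold F. clear F.
    induction p; intros d; simpl; auto.
    + rewrite IHp1, IHp2. auto.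
    + rewrite <- IHp. f_equal. apply ren_ext. intros [|k]; auto. simpl. unfold liftinst. cbn [fst snd].
      destruct (Nat.ltb_spec k d), (Nat.ltb_spec (S k) (S d)), (Nat.eqb_spec k d), (Nat.eqb_spec (S k) (S d)); lia.
  - intros [|k]; unfold liftinst; simpl; auto.
Qed.

Lemma cmp_finst {D} `{Enc D} (x : D -> nat) (p : D -> fm) :
  computable x -> computable p -> computable (fun d => finst (x d) (p d)).
Proof.
  intros. apply cmp_ext with (f := fun d => fmrec (fun _ => FBot) (fun z k l => FEq (liftinst z k) (liftinst z l))
    (fun z k l => FRel (liftinst z k) (liftinst z l)) (fun _ => FImp) (fun _ rs => FAll (nth 0 rs FBot))
    (fun z => [(S (fst z), snd z)]) (p d) (0, x d)).
  { intros d. symmetry. apply finst_fmrec. }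
  apply cmp_fmrec; unfold liftinst, Nat.ltb; cmps.
Qed.

(** [refuted n l] says that no [n] distinct elements satisfy the formulas of [l]. *)
Definition alln (n : nat) (p : fm) : fm := nat_rect (fun _ => fm) p (fun _ q => FAll q) n.
Definition refuted (n : nat) (l : list fm) : fm := alln n (fold_right FImp FBot (l ++ dist n)).

Lemma cmp_refuted {D} `{Enc D} (n : D -> nat) (l : D -> list fm) :
  computable n -> computable l -> computable (fun d => refuted (n d) (l d)).
Proof.
  intros. unfold refuted, alln, dist. cmps.
Qed.

Ltac cmp_more ::= first
  [ simple apply cmp_FNeg | simple apply cmp_FImp | simple apply cmp_FAll | simple apply cmp_FEq
  | simple apply cmp_FRel | simple apply cmp_enc | simple apply cmp_finst | simple apply cmp_fbdb
  | simple apply cmp_refuted ].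

(** * Membership in Pi03 *)

(** Acceptance and rejection are two positive statements, hence both recursively enumerable even
    when [phi e] is partial. *)
Definition yes (e : nat) (p : fm) : Prop := exists y, phi e (fcode p) (S y).
Definition no (e : nat) (p : fm) : Prop := phi e (fcode p) 0.
Definition bounded (n : nat) (l : list fm) : Prop := forallb (fbdb n) l = true.

Lemma bounded_spec n l : bounded n l <-> Forall (fbd n) l.
Proof.
  unfold bounded. rewrite forallb_forall, Forall_forall. split; intros H p Hp; apply fbdb_spec; auto.
Qed.

Definition total_on_sentences (e : nat) : Prop :=
  forall x, exists y, phi e x y /\ (y = 0 \/ exists p, fbdb 0 p = true /\ fcode p = x).

(** Failure of one of the closure conditions that make [fun n l => ~ T (refuted n l)]
    a consistency property whose models satisfy [T]. *)
Definition defect (e : nat) : Prop :=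
  (exists p, fbdb 0 p = true /\ no e p /\ no e (FNeg p)) \/
  (exists n l p, bounded n l /\ fbdb 0 p = true /\ yes e p /\ In (FNeg p) l /\ no e (refuted n l)) \/
  yes e FBot \/
  (exists n l q, bounded n l /\ fbdb n q = true /\
     yes e (refuted n (q :: l)) /\ yes e (refuted n (FNeg q :: l)) /\ no e (refuted n l)) \/
  (exists n l, bounded n l /\ clash n l /\ no e (refuted n l)) \/
  (exists n l q, bounded n l /\ In (FNeg (FAll q)) l /\
     (forall x, In x (seq 0 n) -> yes e (refuted n (FNeg (finst x q) :: l))) /\
     yes e (refuted (S n) (FNeg (finst n q) :: l)) /\ no e (refuted n l)) \/
  (exists n l, bounded n l /\ yes e (refuted (S n) l) /\ no e (refuted n l)).

Definition not_representing (e n : nat) (F : list fm) : Prop :=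
  forallb (fbdb n) F = false \/
  exists p, fbdb n p = true /\ forall q, In q F ->
    no e (refuted n [p; FNeg q]) \/ no e (refuted n [q; FNeg p]).

Lemma fsat_alln {D} (R : D -> D -> Prop) n p : forall rho,
  fsat R rho (alln n p) <-> forall w, length w = n -> fsat R (envl w rho) p.
Proof.
  induction n as [|n IH]; intros rho.
  - change (alln 0 p) with p. split.
    + intros H [|] Hw; [auto|discriminate].
    + intros H. apply (H []). auto.
  - change (alln (S n) p) with (FAll (alln n p)). cbn [fsat]. split.
    + intros H w Hw. destruct (rev w) as [|d w'] eqn:E.
      * apply (f_equal (@length D)) in E. rewrite length_rev in E. simpl in E. lia.
      * apply (f_equal (@rev D)) in E. rewrite rev_involutive in E. simpl in E. subst w.
        rewrite length_app, length_rev in Hw. simpl in Hw.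
        unfold envl. rewrite fold_right_app. simpl. apply (IH (env_cons d rho)); auto.
        rewrite length_rev. lia.
    + intros H d. apply IH. intros w Hw. specialize (H (w ++ [d])). unfold envl in H.
      rewrite fold_right_app in H. apply H. rewrite length_app. simpl. lia.
Qed.

Lemma fsat_chain {D} (R : D -> D -> Prop) l rho :
  fsat R rho (fold_right FImp FBot l) <-> ~ forall p, In p l -> fsat R rho p.
Proof.
  induction l as [|p l IH]; simpl.
  - split; [tauto|]. intros H. apply H. intros _ [].
  - rewrite IH. split.
    + intros H K. apply H; auto.
    + intros H Hp K. apply H. intros q [<-|Hq]; auto.
Qed.

Lemma fsat_refuted {D} (R : D -> D -> Prop) n l rho : Forall (fbd n) l ->
  fsat R rho (refuted n l) <-> ~ cond R n l.
Proof.
  intros Hb. rewrite <- (@fsat_exn_inj _ R n l rho Hb). unfold refuted. rewrite fsat_alln, fsat_exn. split.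
  - intros H (w & Hw & K). rewrite fsat_FConj in K. specialize (H w Hw). rewrite fsat_chain in H.
    apply H. intros p Hp. apply K. apply in_app_or in Hp. apply in_or_app. tauto.
  - intros H w Hw. rewrite fsat_chain. intros K. apply H. exists w. split; auto. apply fsat_FConj.
    intros p Hp. apply K. apply in_app_or in Hp. apply in_or_app. tauto.
Qed.

Lemma fbd_alln n p : forall m, fbd (n + m) p -> fbd m (alln n p).
Proof.
  induction n as [|n IH]; intros m H; auto. change (fbd (S m) (alln n p)). apply IH.
  replace (n + S m) with (S n + m) by lia. auto.
Qed.

Lemma fbd_refuted n l : Forall (fbd n) l -> fbd 0 (refuted n l).
Proof.
  intros H. apply fbd_alln. rewrite Nat.add_0_r. assert (K : Forall (fbd n) (l ++ dist n)).
  { apply Forall_app. split; auto. apply fbd_dist. }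
  induction K; simpl; auto.
Qed.

Definition presents (e : nat) (R : nat -> nat -> Prop) : Prop :=
  is_char_fun (sgn_phi e) (index_set (theory R)).

Lemma index_set_fcode (R : nat -> nat -> Prop) p : index_set (theory R) (fcode p) <->
  fbd 0 p /\ fsat R (fun x => x) p.
Proof.
  split.
  - intros (q & [Hs Hq] & E). rewrite <- (to_of q), form_index_to in E. apply fcode_inj in E. subst p.
    split. apply sentence_of; auto. apply Hq.
  - intros [Hb Hs]. exists (to_form p). split; [|apply form_index_to]. split.
    + apply sentence_of. rewrite of_to. auto.
    + rewrite of_to. intros rho. revert Hs. apply fsat_sentence. auto.
Qed.

Lemma presents_yes e R p : presents e R -> fbd 0 p -> yes e p <-> fsat R (fun x => x) p.
Proof.
  intros HP Hb. destruct (HP (fcode p)) as [[H1 (y & Hy & E)]|[H1 (y & Hy & E)]]; rewrite index_set_fcode in H1.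
  - split; intros _. tauto. destruct y; [discriminate|]. exists y. auto.
  - split; [|tauto]. intros [z Hz]. destruct y; [|discriminate]. pose proof (phi_fun Hy Hz). discriminate.
Qed.

Lemma presents_no e R p : presents e R -> fbd 0 p -> no e p <-> ~ fsat R (fun x => x) p.
Proof.
  intros HP Hb. destruct (HP (fcode p)) as [[H1 (y & Hy & E)]|[H1 (y & Hy & E)]]; rewrite index_set_fcode in H1.
  - split; [|tauto]. intros Hz. destruct y; [discriminate|]. pose proof (phi_fun Hy Hz). discriminate.
  - split; intros _. tauto. destruct y; [|discriminate]. auto.
Qed.

Section Presented.
Variables (e : nat) (R : nat -> nat -> Prop).
Hypothesis HP : presents e R.

Lemma presents_yes_refuted n l : Forall (fbd n) l -> yes e (refuted n l) <-> ~ cond R n l.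
Proof. intros H. rewrite (presents_yes _ HP) by (apply fbd_refuted; auto). apply fsat_refuted; auto. Qed.

Lemma presents_no_refuted n l : Forall (fbd n) l -> no e (refuted n l) <-> cond R n l.
Proof.
  intros H. rewrite (presents_no _ HP) by (apply fbd_refuted; auto). rewrite fsat_refuted; auto.
  split; [apply NNPP|tauto].
Qed.

Lemma presents_total : total_on_sentences e.
Proof.
  intros x. destruct (HP x) as [[H1 (y & Hy & E)]|[H1 (y & Hy & E)]]; exists y; split; auto.
  - right. destruct H1 as (p & [Hs _] & <-). exists (of_form p). split.
    + apply fbdb_spec, sentence_of. auto.
    + rewrite <- form_index_to, to_of. auto.
  - left. destruct y; auto. discriminate.
Qed.

Lemma presents_no_defect : ~ defect e.
Proof.
  pose proof (cond_consistency R infinite_nat) as C.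
  intros [B|[B|[B|[B|[B|[B|B]]]]]].
  - destruct B as (p & Hb & H1 & H2). apply fbdb_spec in Hb.
    assert (Hb' : fbd 0 (FNeg p)) by (simpl; auto).
    apply (presents_no _ HP Hb) in H1. apply (presents_no _ HP Hb') in H2. apply H2. exact H1.
  - destruct B as (n & l & p & Hl & Hb & H1 & H2 & H3). apply fbdb_spec in Hb. apply bounded_spec in Hl.
    rewrite presents_no_refuted in H3 by auto. rewrite (presents_yes _ HP) in H1 by auto.
    destruct H3 as [_ (rho & _ & H3)]. apply (H3 _ H2). revert H1. apply fsat_sentence. auto.
  - rewrite (presents_yes _ HP) in B by (simpl; auto). auto.
  - destruct B as (n & l & q & Hl & Hb & H1 & H2 & H3). apply fbdb_spec in Hb. apply bounded_spec in Hl.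
    rewrite presents_yes_refuted in H1, H2 by (constructor; simpl; auto).
    rewrite presents_no_refuted in H3 by auto. destruct (cp_dec C _ _ _ H3 Hb); auto.
  - destruct B as (n & l & Hl & Hc & H3). apply bounded_spec in Hl. rewrite presents_no_refuted in H3 by auto.
    apply (cp_clash C H3 Hc).
  - destruct B as (n & l & q & Hl & Hq & H1 & H2 & H3). apply bounded_spec in Hl.
    assert (Bq : fbd (S n) q) by (rewrite Forall_forall in Hl; apply (Hl _ Hq)).
    rewrite presents_no_refuted in H3 by auto.
    destruct (cp_wit C _ _ q H3 Hq) as [(x & Hx & K)|K].
    + specialize (H1 x). rewrite presents_yes_refuted in H1.
      * apply H1; auto. apply in_seq. lia.
      * apply K.
    + rewrite presents_yes_refuted in H2; auto. apply K.
  - destruct B as (n & l & Hl & H1 & H3). apply bounded_spec in Hl. rewrite presents_no_refuted in H3 by auto.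
    pose proof (cp_ext C _ _ H3) as K. rewrite presents_yes_refuted in H1; auto. apply K.
Qed.

(** Through [equiv_cond], inequivalence of two formulas is the consistency of one of two conditions,
    which [e] confirms by rejecting a sentence [refuted n _]. *)
Lemma few_types_presented :
  few_types R <-> forall n, exists F, ~ not_representing e n F.
Proof.
  split; intros H n; destruct (H n) as [F HF]; exists F.
  - destruct HF as [HF HB]. intros [K|(p & Hp & K)].
    + apply bounded_spec in HF. congruence.
    + apply fbdb_spec in Hp. destruct (HB p Hp) as (q & Hq & E). rewrite Forall_forall in HF.
      apply equiv_cond in E; auto.
      specialize (K q Hq). rewrite !presents_no_refuted in K by (repeat constructor; simpl; auto). tauto.
  - assert (HF' : Forall (fbd n) F).
    { apply bounded_spec. apply not_false_is_true. intros K. apply HF. left. auto. }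
    split; auto. intros p Hp. apply NNPP. intros Hn. apply HF. right. exists p. split. apply fbdb_spec; auto.
    intros q Hq. rewrite Forall_forall in HF'. rewrite !presents_no_refuted by (repeat constructor; simpl; auto).
    apply NNPP. intros Hn'. apply Hn. exists q. split; auto. apply equiv_cond; auto; tauto.
Qed.
End Presented.

(** A condition is accepted when [e] rejects [refuted n l]; each clause of a consistency property
    fails only through a defect. The second clause of [defect] makes the resulting model satisfy
    every accepted sentence, and the first makes it falsify every rejected one. *)
Lemma presented_of_no_defect e : total_on_sentences e -> ~ defect e -> exists R, presents e R.
Proof.
  intros HT HD. unfold defect in HD.
  assert (Tri : forall p, yes e p \/ no e p).
  { intros p. destruct (HT (fcode p)) as (y & Hy & _). destruct y; [right|left]; auto. exists y. auto. }
  assert (Exc : forall p, yes e p -> no e p -> False).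
  { intros p [y Hy] Hn. pose proof (phi_fun Hy Hn). discriminate. }
  assert (Tri' : forall p, ~ yes e p -> no e p) by (intros p; destruct (Tri p); tauto).
  pose (Con := fun n l => bounded n l /\ no e (refuted n l)).
  assert (Bc : forall n p l, bounded n (p :: l) <-> fbd n p /\ bounded n l).
  { intros. rewrite !bounded_spec. split; [intros K; inversion K; auto|]. intros []; constructor; auto. }
  assert (C : consistency Con).
  { constructor.
    - intros n l q [Hl Hc] Hq. apply NNPP. intros Hn. apply HD. do 3 right. left. exists n, l, q.
      split; auto. split; [apply fbdb_spec; auto|].
      split; [|split]; auto; apply NNPP; intros K; apply Tri' in K; apply Hn; [left|right]; split; auto; apply Bc; simpl; auto.
    - intros n l q [Hl Hc] Hq. apply NNPP. intros Hn. apply HD. do 5 right. left. exists n, l, q.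
      assert (Bq : fbd (S n) q). { apply bounded_spec in Hl. rewrite Forall_forall in Hl. apply (Hl _ Hq). }
      split; auto. split; auto. split; [|split]; auto.
      + intros x Hx. apply in_seq in Hx. apply NNPP. intros K. apply Tri' in K. apply Hn. left. exists x.
        split; [lia|]. split; auto. apply Bc. split; auto. simpl. split; auto. apply fbd_finst; auto. lia.
      + apply NNPP. intros K. apply Tri' in K. apply Hn. right. split; auto. apply Bc. split.
        * simpl. split; auto. apply fbd_finst; auto. eapply fbd_mono; [|exact Bq]. lia.
        * apply bounded_spec. apply bounded_spec in Hl. eapply Forall_impl; [|exact Hl]. intros p. apply fbd_mono. lia.
    - intros n l [Hl Hc]. split.
      + apply bounded_spec. apply bounded_spec in Hl. eapply Forall_impl; [|exact Hl]. intros p. apply fbd_mono. lia.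
      + apply Tri'. intros K. apply HD. do 6 right. exists n, l. auto.
    - intros n l [Hl Hc] K. apply HD. do 4 right. left. exists n, l. auto. }
  assert (C0 : Con 0 []).
  (* [refuted 0 []] computes to [FBot]. *)
  { split. reflexivity. apply Tri'. intros K. apply HD. do 2 right. left. exact K. }
  destruct (@model_existence Con (fun _ _ _ => True) 0 [] C) as (R & N & G & _ & _ & HC & _ & _ & Hd & Ht); auto.
  { intros _ m l Hc. exists m, l. split; auto. split; auto. apply incl_refl. }
  exists R.
  assert (Y : forall p, fbd 0 p -> yes e p -> fsat R (fun x => x) p).
  { intros p Hb Hy. destruct (Hd p) as [i [Hi|Hi]]; eauto. exfalso. apply HD. do 1 right. left.
    exists (N i), (G i), p. destruct (HC i) as [H1 H2]. split; auto. split; auto. apply fbdb_spec; auto. }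
  assert (NN : forall p, fbd 0 p -> no e p -> ~ fsat R (fun x => x) p).
  { intros p Hb Hn. apply (Y (FNeg p)). simpl; auto. apply NNPP. intros K. apply Tri' in K.
    apply HD. left. exists p. split; auto. apply fbdb_spec; auto. }
  intros x. destruct (HT x) as (y & Hy & Hp). destruct y as [|y].
  - right. split; [|exists 0; auto]. intros (p & [Hs Hr] & E).
    rewrite <- (to_of p), form_index_to in E. subst x. apply (NN (of_form p)); auto. apply sentence_of; auto.
  - left. split; [|exists (S y); auto]. destruct Hp as [Hp|(p & Hb & <-)]; [discriminate|].
    apply fbdb_spec in Hb. apply index_set_fcode. split; auto. apply Y; auto. exists y. auto.
Qed.

Definition categorical_index (e : nat) : Prop :=
  exists T : form digraph -> Prop,
    complete_theory T /\ omega_categorical T /\ is_char_fun (sgn_phi e) (index_set T).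

Lemma categorical_index_presents e :
  categorical_index e <-> exists R, presents e R /\ few_types R.
Proof.
  split.
  - intros (T & CT & OC & HC). destruct (proj1 (categorical_theory T) (conj CT OC)) as (R & HT & Hf).
    exists R. split; auto. intros x. destruct (HC x) as [[(p & Hp & E) H]|[Hn H]].
    + left. split; auto. exists p. split; auto. apply HT; auto.
    + right. split; auto. intros (p & Hp & E). apply Hn. exists p. split; auto. apply HT; auto.
  - intros (R & HP & Hf). destruct (proj2 (categorical_theory (theory R))) as [CT OC].
    + exists R. split; auto. tauto.
    + exists (theory R). auto.
Qed.

(** As [defect] and [not_representing] are recursively enumerable, the three conjuncts have the
    shapes forall-exists, forall, and forall-exists-forall over decidable matrices. *)
Theorem categorical_index_spec e : categorical_index e <->
  total_on_sentences e /\ ~ defect e /\ forall n, exists F, ~ not_representing e n F.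
Proof.
  rewrite categorical_index_presents. split.
  - intros (R & HP & Hf). split; [|split].
    + eapply presents_total; eauto.
    + eapply presents_no_defect; eauto.
    + eapply few_types_presented; eauto.
  - intros (H1 & H2 & H3). destruct (presented_of_no_defect H1 H2) as [R HP]. exists R. split; auto.
    apply (few_types_presented HP). auto.
Qed.

Lemma re_In {A D} `{Enc A} `{Enc D} (x : D -> A) (l : D -> list A) :
  computable x -> computable l -> RE (fun d => In (x d) (l d)).
Proof.
  intros. apply re_ext with (P := fun d => mem (x d) (l d) = true). intros; apply mem_In.
  apply re_dec. cmp.
Qed.

Lemma re_no {D} `{Enc D} (e : D -> nat) (p : D -> fm) : computable e -> computable p -> RE (fun d => no (e d) (p d)).
Proof. intros. apply re_phi; auto. apply cmp_const. Qed.

Lemma re_yes {D} `{Enc D} (e : D -> nat) (p : D -> fm) : computable e -> computable p -> RE (fun d => yes (e d) (p d)).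
Proof.
  intros. unfold yes. apply re_ex with (P := fun d y => phi (e d) (fcode (p d)) (S y)). apply re_phi.
  - apply cmp_comp with (f := e); cmps.
  - assert (K : computable (fun q : D * nat => p (fst q))) by (apply cmp_comp; cmps). exact K.
  - cmps.
Qed.

Lemma re_eq {A D} `{Enc A} `{Enc D} (x y : D -> A) : computable x -> computable y -> RE (fun d => x d = y d).
Proof.
  intros. apply re_ext with (P := fun d => enc_eqb (x d) (y d) = true). intros; apply enc_eqb_spec.
  apply re_dec. cmp.
Qed.

Lemma re_neq {A D} `{Enc A} `{Enc D} (x y : D -> A) : computable x -> computable y -> RE (fun d => x d <> y d).
Proof.
  intros. apply re_ext with (P := fun d => negb (enc_eqb (x d) (y d)) = true).
  - intros d. rewrite negb_true_iff, <- not_true_iff_false, enc_eqb_spec. tauto.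
  - apply re_dec. cmp.
Qed.

Lemma re_lt {D} `{Enc D} (x y : D -> nat) : computable x -> computable y -> RE (fun d => x d < y d).
Proof.
  intros. apply re_ext with (P := fun d => Nat.leb (S (x d)) (y d) = true).
  - intros d. apply Nat.leb_le.
  - apply re_dec. cmp.
Qed.

Ltac re_step := cbn beta; first
  [ simple apply re_no | simple apply re_yes | simple apply re_In | simple apply re_lt
  | simple apply re_and | simple apply re_or
  | simple apply re_ex | simple apply re_all_list
  | simple apply re_neq | simple apply re_dec | simple apply re_eq ].
Ltac res := repeat re_step; cmps.

Lemma re_defect : RE defect.
Proof. unfold defect, clash, bounded. res. Qed.

Lemma re_not_representing : RE (fun q : nat * (nat * list fm) => not_representing (fst q) (fst (snd q)) (snd (snd q))).
Proof. unfold not_representing, bounded. res. Qed.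

Lemma re_total : RE (fun q : nat * nat => exists y, phi (fst q) (snd q) y /\ (y = 0 \/ exists p, fbdb 0 p = true /\ fcode p = snd q)).
Proof.
  apply re_ex. apply re_and. apply re_phi; cmps. apply re_or. res.
  apply re_ex. apply re_and. res. apply re_eq; cmps.
  assert (K : computable (fun d : nat * nat * nat * fm => snd d)) by cmps. exact K.
Qed.

Lemma computable_set_bool (f : nat -> bool) : computable f -> computable_set (fun x => f x = true).
Proof.
  intros [c Hc]. exists (pc_index c). intros x. specialize (Hc x).
  destruct (f x) eqn:E; [left|right]; (split; [congruence|exists c; auto]).
Qed.

Lemma Pi03_of_RE (P : nat -> Prop) (Q : nat * (nat * nat) -> Prop) : RE Q ->
  (forall e, P e <-> forall a, exists b, ~ Q (e, (a, b))) -> Pi03 P.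
Proof.
  intros (f & Hf & Hs) HP.
  exists (fun x => negb (f ((cpi1 x, (cpi1 (cpi2 x), cpi1 (cpi2 (cpi2 x)))), cpi2 (cpi2 (cpi2 x)))) = true). split.
  - apply computable_set_bool. apply cmp_negb. apply cmp_comp with (f := f); cmps.
  - intros e. rewrite HP. split; intros H a; destruct (H a) as [b Hb]; exists b.
    + intros c. rewrite !cpi2_pair, !cpi1_pair. apply negb_true_iff, not_true_iff_false.
      intros E. apply Hb, Hs. eauto.
    + intros HQ. apply Hs in HQ. destruct HQ as [w Hw]. specialize (Hb w).
      rewrite !cpi2_pair, !cpi1_pair in Hb. rewrite Hw in Hb. discriminate.
Qed.

Theorem categorical_index_Pi03 : Pi03 categorical_index.
Proof.
  destruct re_total as (f & Hf & Hs).
  (* The outer variable is a pair whose first component selects one of the three conjuncts, and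
     other selectors hold trivially. The existential variable is a search witness in the first case
     and a code of [F] in the third. *)
  apply Pi03_of_RE with (Q := fun q : nat * (nat * nat) =>
    (cpi1 (fst (snd q)) = 0 /\ negb (f ((fst q, cpi2 (fst (snd q))), snd (snd q))) = true) \/
    (cpi1 (fst (snd q)) = 1 /\ defect (fst q)) \/
    (cpi1 (fst (snd q)) = 2 /\ not_representing (fst q) (cpi2 (fst (snd q))) (dcd (snd (snd q))))).
  - apply re_or; [|apply re_or]; apply re_and; try (apply re_eq; cmps).
    + apply cmp_comp with (f := f); cmps.
    + apply re_sub with (P := defect); cmps. apply re_defect.
    + apply (@re_sub _ _ _ _ (fun q : nat * (nat * list fm) => not_representing (fst q) (fst (snd q)) (snd (snd q)))
        (fun q : nat * (nat * nat) => (fst q, (cpi2 (fst (snd q)), dcd (snd (snd q)))))); cmps.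
      apply re_not_representing.
  - intros e. rewrite categorical_index_spec. cbn [fst snd]. split.
    + intros (H1 & H2 & H3) a. destruct (cpi1 a) as [|[|[|k]]].
      * destruct (proj1 (Hs (e, cpi2 a)) (H1 (cpi2 a))) as [w Hw]. exists w. rewrite Hw. simpl. intuition discriminate.
      * exists 0. intuition discriminate.
      * destruct (H3 (cpi2 a)) as [F HF]. destruct (dcd_surj F) as [b <-]. exists b. intuition discriminate.
      * exists 0. intuition discriminate.
    + intros H. split; [|split].
      * intros x. apply (Hs (e, x)). destruct (H ⟨0, x⟩) as [w Hw]. exists w. rewrite cpi1_pair, cpi2_pair in Hw.
        apply NNPP. intros Hn. apply Hw. left. split; auto. apply negb_true_iff, not_true_iff_false. auto.
      * intros D. destruct (H ⟨1, 0⟩) as [w Hw]. apply Hw. rewrite cpi1_pair. auto.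
      * intros n. destruct (H ⟨2, n⟩) as [w Hw]. exists (dcd w). intros K. apply Hw. rewrite cpi1_pair, cpi2_pair. auto.
Qed.

(** * Graphs with prescribed clique ranks *)

(** The rank of a finite set of vertices (given by a list) is the maximal size of a clique
    containing it: [None] for infinity, [Some 0] for sets that are not cliques. *)
Definition ole (a b : option nat) : Prop :=
  match b with None => True | Some t => match a with None => False | Some s => s <= t end end.

Lemma ole_refl a : ole a a.
Proof. destruct a; simpl; auto. Qed.
Lemma ole_trans a b c : ole a b -> ole b c -> ole a c.
Proof. destruct a, b, c; simpl; try tauto; lia. Qed.
Lemma ole_antisym a b : ole a b -> ole b a -> a = b.
Proof. destruct a, b; simpl; intros; try tauto. f_equal. lia. Qed.
Lemma ole_zero a : ole (Some 0) a.
Proof. destruct a; simpl; auto. lia. Qed.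

Section Labels.
Variable g : nat -> nat.

(** By [g_clique], rank [Some 0] is a matter of pairs, so the edges determine which sets have it.
    With [+ 2], the empty set and single vertices can only have rank [None], and finite positive
    ranks begin with pairs. *)
Record good (dom : nat -> Prop) (rk : list nat -> option nat) : Prop := {
  g_anti X Y : (forall i, In i Y -> dom i) -> incl X Y -> ole (rk Y) (rk X);
  g_val X t : (forall i, In i X -> dom i) -> NoDup X -> rk X = Some t ->
    t = 0 \/ (length X <= t /\ g t + 2 <= length X);
  g_clique X : (forall i, In i X -> dom i) ->
    (forall i j, In i X -> In j X -> i <> j -> rk [i; j] <> Some 0) -> rk X <> Some 0
}.

(** [h X] is the rank requested for the union of [X] and a new vertex. *)
Record request (rk : list nat -> option nat) (P : list nat) (h : list nat -> option nat) : Prop := {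
  h_anti X Y : incl Y P -> incl X Y -> ole (h Y) (h X);
  h_le X : incl X P -> ole (h X) (rk X);
  h_val X t : incl X P -> NoDup X -> h X = Some t ->
    t = 0 \/ (S (length X) <= t /\ g t + 2 <= S (length X));
  h_clique X : incl X P -> (forall i, In i X -> h [i] <> Some 0) -> rk X <> Some 0 -> h X <> Some 0
}.

Definition del (m : nat) (X : list nat) : list nat := filter (fun i => negb (Nat.eqb i m)) X.
Definition inclb (X Y : list nat) : bool := forallb (fun i => mem i Y) X.

Lemma inclb_spec X Y : inclb X Y = true <-> incl X Y.
Proof.
  unfold inclb. rewrite forallb_forall. split; intros H i Hi; [apply mem_In|apply mem_In]; auto.
Qed.

Lemma In_del m X i : In i (del m X) <-> In i X /\ i <> m.
Proof.
  unfold del. rewrite filter_In, negb_true_iff, Nat.eqb_neq. tauto.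
Qed.

Lemma length_del m X : NoDup X -> In m X -> length X = S (length (del m X)).
Proof.
  induction X as [|x X IH]; intros Hn Hm; [destruct Hm|]. inversion Hn; subst. unfold del. simpl.
  destruct (Nat.eqb_spec x m) as [->|Hx]; simpl.
  - f_equal. clear -H1. induction X as [|y X IH]; simpl; auto.
    destruct (Nat.eqb_spec y m) as [->|]; simpl. exfalso; apply H1; simpl; auto. rewrite <- IH; auto.
    intros K. apply H1. simpl; auto.
  - destruct Hm as [|Hm]; [congruence|]. rewrite (IH H2 Hm). auto.
Qed.

Lemma NoDup_del m X : NoDup X -> NoDup (del m X).
Proof. apply NoDup_filter. Qed.

(** Sets containing [m] and a vertex outside [P] get rank [Some 0]: the new vertex [m] is joined to
    nothing outside [P]. *)
Definition extend (m : nat) (rk : list nat -> option nat) (P : list nat) (h : list nat -> option nat) (X : list nat) :=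
  if mem m X then (if inclb (del m X) P then h (del m X) else Some 0) else rk X.

Lemma extend_good m rk P h : good (fun i => i < m) rk -> (forall i, In i P -> i < m) -> request rk P h ->
  good (fun i => i < S m) (extend m rk P h).
Proof.
  intros G HP H.
  assert (Md : forall X, mem m X = false -> (forall i, In i X -> i < S m) -> forall i, In i X -> i < m).
  { intros X Hm Hb i Hi. assert (i <> m); [|specialize (Hb i Hi); lia]. intros ->.
    apply mem_In in Hi. congruence. }
  constructor.
  - intros X Y HY I. unfold extend. destruct (mem m Y) eqn:EY.
    + destruct (inclb (del m Y) P) eqn:EP; [|apply ole_zero]. apply inclb_spec in EP.
      destruct (mem m X) eqn:EX.
      * assert (I' : incl (del m X) (del m Y)).
        { intros i Hi. rewrite In_del in *. intuition. }
        replace (inclb (del m X) P) with true. apply (h_anti H); auto.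
        symmetry. apply inclb_spec. eapply incl_tran; eauto.
      * eapply ole_trans; [apply (h_le H); auto|]. apply (g_anti G).
        -- intros i Hi. apply HP, EP, Hi.
        -- intros i Hi. apply In_del. split; auto. intros ->. apply mem_In in Hi. congruence.
    + replace (mem m X) with false. apply (g_anti G); auto. apply Md; auto.
      symmetry. apply not_true_iff_false. rewrite mem_In. intros Hm. apply I in Hm. apply mem_In in Hm. congruence.
  - intros X t HX Hn. unfold extend. destruct (mem m X) eqn:EX.
    + apply mem_In in EX. rewrite (@length_del m X Hn EX).
      destruct (inclb (del m X) P) eqn:EP; [|intros Q; injection Q; auto].
      apply (h_val H). apply inclb_spec; auto. apply NoDup_del; auto.
    + apply (g_val G); auto. apply Md; auto.
  - intros X HX Hc. unfold extend. destruct (mem m X) eqn:EX.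
    + apply mem_In in EX.
      assert (Q : forall i, In i (del m X) -> In i P /\ h [i] <> Some 0).
      { intros i Hi. apply In_del in Hi. destruct Hi as [Hi Him].
        specialize (Hc m i EX Hi ltac:(auto)). unfold extend in Hc.
        replace (mem m [m; i]) with true in Hc by (symmetry; apply mem_In; simpl; auto).
        assert (E : del m [m; i] = [i]).
        { unfold del. simpl. rewrite Nat.eqb_refl. simpl. destruct (Nat.eqb_spec i m); auto. congruence. }
        rewrite E in Hc. destruct (inclb [i] P) eqn:EP; [|congruence].
        apply inclb_spec in EP. split; auto. apply EP. simpl; auto. }
      assert (IP : incl (del m X) P) by (intros i Hi; apply Q; auto).
      rewrite (proj2 (inclb_spec _ _) IP). apply (h_clique H); auto.
      * intros i Hi. apply Q; auto.
      * apply (g_clique G).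
        -- intros i Hi. apply HP; auto.
        -- intros i j Hi Hj Hij. apply In_del in Hi, Hj. destruct Hi as [Hi Him], Hj as [Hj Hjm].
           specialize (Hc i j Hi Hj Hij). unfold extend in Hc.
           replace (mem m [i; j]) with false in Hc; auto. symmetry. apply not_true_iff_false. rewrite mem_In.
           simpl. intuition.
    + apply (g_clique G). apply Md; auto. intros i j Hi Hj Hij. specialize (Hc i j Hi Hj Hij).
      unfold extend in Hc. replace (mem m [i; j]) with false in Hc; auto. symmetry. apply not_true_iff_false.
      rewrite mem_In. intros [<-|[<-|[]]]; [apply mem_In in Hi|apply mem_In in Hj]; congruence.
Qed.

Lemma extend_old m rk P h X : (forall i, In i X -> i < m) -> extend m rk P h X = rk X.
Proof.
  intros H. unfold extend. replace (mem m X) with false; auto. symmetry. apply not_true_iff_false.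
  rewrite mem_In. intros K. apply H in K. lia.
Qed.

Lemma extend_new m rk P h X : (forall i, In i P -> i < m) -> incl X P -> extend m rk P h (m :: X) = h X.
Proof.
  intros HP HX. unfold extend. replace (mem m (m :: X)) with true by (symmetry; apply mem_In; simpl; auto).
  assert (E : del m (m :: X) = X).
  { unfold del. simpl. rewrite Nat.eqb_refl. simpl.
    assert (Q : forall i, In i X -> i <> m). { intros i Hi ->. apply HX, HP in Hi. lia. }
    clear -Q. induction X as [|x X IH]; simpl; auto. destruct (Nat.eqb_spec x m) as [->|].
    exfalso. apply (Q m); simpl; auto. simpl. f_equal. apply IH. intros; apply Q; simpl; auto. }
  rewrite E, (proj2 (inclb_spec _ _) HX). auto.
Qed.

Lemma rank_nil dom rk : good dom rk -> rk [] = None.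
Proof.
  intros G. destruct (rk []) as [t|] eqn:E; auto. exfalso.
  destruct (g_val G (X := []) ltac:(simpl; tauto) ltac:(constructor) E) as [->|[_ K]].
  - revert E. apply (g_clique G); simpl; tauto.
  - simpl in K. lia.
Qed.

Fixpoint sublists (P : list nat) : list (list nat) :=
  match P with [] => [[]] | x :: P => sublists P ++ map (cons x) (sublists P) end.

Lemma sublists_filter f P : In (filter f P) (sublists P).
Proof.
  induction P as [|x P IH]; simpl; auto. apply in_or_app. destruct (f x); auto.
  right. apply in_map. auto.
Qed.

Definition lookup (tab : list (list nat * nat)) (X : list nat) : nat :=
  fold_right (fun e r => if enc_eqb (fst e) X then snd e else r) 0 tab.

Lemma lookup_map (f : list nat -> nat) Xs X : In X Xs -> lookup (map (fun Y => (Y, f Y)) Xs) X = f X.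
Proof.
  induction Xs as [|Y Xs IH]; simpl; [tauto|]. intros H.
  destruct (enc_eqb Y X) eqn:E.
  - apply (enc_eqb_spec Y X) in E. congruence.
  - destruct H as [->|H]; auto. pose proof (proj2 (enc_eqb_spec X X) eq_refl). congruence.
Qed.

(** By antitonicity a request depends only on the set underlying a list, so its values on the
    sublists of [P] form a finite table, and all requests can be enumerated. Entry [0] stands for
    infinity and [S t] for rank [t]. *)
Definition coded_request (P : list nat) (tab : list (list nat * nat)) (X : list nat) : option nat :=
  match lookup tab (filter (fun i => mem i X) P) with 0 => None | S t => Some t end.

Lemma request_coded rk P h : request rk P h ->
  exists tab, forall X, incl X P -> coded_request P tab X = h X.
Proof.
  intros H. exists (map (fun Y => (Y, match h Y with None => 0 | Some t => S t end)) (sublists P)).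
  intros X HX. unfold coded_request.
  rewrite (lookup_map (fun Y => match h Y with None => 0 | Some t => S t end)) by apply sublists_filter.
  replace (h (filter (fun i => mem i X) P)) with (h X).
  - destruct (h X); auto.
  - apply ole_antisym; apply (h_anti H); auto.
    + intros i Hi. apply filter_In in Hi. apply mem_In. tauto.
    + intros i Hi. apply filter_In in Hi. tauto.
    + intros i Hi. apply filter_In. split; auto. apply mem_In. auto.
Qed.

Lemma request_ext rk rk' P h h' : (forall X, incl X P -> rk X = rk' X) -> (forall X, incl X P -> h X = h' X) ->
  request rk P h -> request rk' P h'.
Proof.
  intros E E' H. constructor.
  - intros X Y HY I. rewrite <- !E'; auto. apply (h_anti H); auto. eapply incl_tran; eauto.
  - intros X HX. rewrite <- E, <- E'; auto. apply (h_le H); auto.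
  - intros X t HX. rewrite <- E'; auto. apply (h_val H); auto.
  - intros X HX Hi Hc. rewrite <- E'; auto. apply (h_clique H); auto.
    + intros i Hin. rewrite E'. apply Hi; auto. intros j [<-|[]]. auto.
    + rewrite E; auto.
Qed.

(** One vertex is added at a time, and every coded request gets its turn. Ranks of old sets never
    change, so the union of the stages is well defined and inherits [good]. *)
Theorem generic_ranks : exists rk, good (fun _ => True) rk /\
  forall P h, request rk P h -> exists d, ~ In d P /\ forall X, incl X P -> rk (d :: X) = h X.
Proof.
  pose (St := {s : nat * (list nat -> option nat) | good (fun i => i < fst s) (snd s)}).
  pose (mm := fun s : St => fst (proj1_sig s)). pose (rr := fun s : St => snd (proj1_sig s)).
  pose (le := fun s t : St => mm s <= mm t /\ forall X, (forall i, In i X -> i < mm s) -> rr t X = rr s X).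
  (* Stage [j] first contains all of [P]; from then on the ranks of subsets of [P] are final, and
     with them whether [h] is a request. One visit to each coded request therefore suffices. *)
  pose (D := fun j (s : St) => j < mm s /\ let q := dcd j : list nat * list (list nat * nat) in
     let P := fst q in let h := coded_request P (snd q) in
     (forall i, In i P -> i < mm s) /\
     (request (rr s) P h -> exists d, d < mm s /\ ~ In d P /\ forall X, incl X P -> rr s (d :: X) = h X)).
  assert (le_trans : forall a b c, le a b -> le b c -> le a c).
  { intros a b c [A1 A2] [B1 B2]. split. lia. intros X HX. rewrite B2, A2; auto.
    intros i Hi. specialize (HX i Hi). lia. }
  assert (Pad1 : forall s, exists s', le s s' /\ mm s' = S (mm s)).
  { intros [[m rk] G]. simpl in G.
    (* The request over the empty set adds a vertex joined to no earlier one, which serves as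
       padding. *)
    assert (H : request rk [] (fun _ => None)).
    { constructor; simpl; auto; try discriminate. intros X HX. apply incl_l_nil in HX. subst.
      rewrite (rank_nil G). exact I. }
    exists (exist _ (S m, extend m rk [] (fun _ => None)) (extend_good G (P := []) (fun i (Hi : In i []) => False_ind _ Hi) H)).
    unfold le, mm, rr. simpl. split; auto. split; auto. intros X HX. apply extend_old; auto. }
  assert (Pad : forall n s, exists s', le s s' /\ n <= mm s').
  { induction n as [|n IH]; intros s.
    - exists s. split; [|lia]. split; auto.
    - destruct (IH s) as (s1 & L1 & M1). destruct (Pad1 s1) as (s2 & L2 & M2). exists s2. split; [|lia].
      eapply le_trans; eauto. }
  assert (G0 : good (fun i => i < fst (0, fun _ : list nat => @None nat)) (snd (0, fun _ : list nat => @None nat))).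
  { constructor; simpl; auto; discriminate. }
  destruct (@generic_sequence St le D (exist _ _ G0)) as (f & _ & Fs & FD).
  { intros j s. set (q := dcd j : list nat * list (list nat * nat)). set (P := fst q). set (h := coded_request P (snd q)).
    destruct (Pad (S j + S (list_max P)) s) as (s1 & L1 & M1).
    assert (HP : forall i, In i P -> i < mm s1).
    { intros i Hi. pose proof (proj1 (list_max_le P (list_max P)) (le_n _)) as Q. rewrite Forall_forall in Q.
      apply Q in Hi. lia. }
    destruct (classic (request (rr s1) P h)) as [H|H].
    - destruct s1 as [[m rk] G] eqn:Es. unfold mm, rr in *. simpl in *.
      exists (exist _ (S m, extend m rk P h) (extend_good G HP H)). split.
      + eapply le_trans; eauto. split; unfold mm, rr; simpl; auto. intros X HX. apply extend_old; auto.
      + unfold D, mm, rr; simpl. split; [lia|]. split.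
        * intros i Hi. specialize (HP i Hi). lia.
        * intros _. exists m. split; auto. split. intros Hm. specialize (HP m Hm). lia.
          intros X HX. apply extend_new; auto.
    - exists s1. split; auto. split; [lia|]. split; auto. intros K. exfalso. apply H. exact K. }
  assert (Mono : forall i j, i <= j -> le (f i) (f j)).
  { apply (@chain_le St le); [|exact le_trans|exact Fs]. intros s. split; auto. }
  pose (rk := fun X => rr (f (S (list_max X))) X).
  assert (Hm : forall j, j < mm (f (S j))) by (intros j; exact (proj1 (FD j))).
  assert (Bd : forall X i, In i X -> i <= list_max X).
  { intros X i Hi. pose proof (proj1 (list_max_le X (list_max X)) (le_n _)) as Q. rewrite Forall_forall in Q. auto. }
  assert (Stab : forall X i, (forall x, In x X -> x < mm (f i)) -> rk X = rr (f i) X).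
  { intros X i HX. unfold rk. set (k := S (list_max X)).
    assert (HX' : forall x, In x X -> x < mm (f k)).
    { intros x Hx. specialize (Hm (list_max X)). specialize (Bd X x Hx). unfold k. lia. }
    destruct (Nat.le_ge_cases i k) as [L|L]; apply Mono in L; destruct L as [_ L]; rewrite L; auto. }
  assert (Stage : forall X, exists i, forall x, In x X -> x < mm (f i)).
  { intros X. exists (S (list_max X)). intros x Hx. specialize (Hm (list_max X)). specialize (Bd X x Hx). lia. }
  assert (Gs : forall i, good (fun x => x < mm (f i)) (rr (f i))) by (intros i; exact (proj2_sig (f i))).
  exists rk. split.
  - constructor.
    + intros X Y _ I. destruct (Stage Y) as [i Hi]. rewrite (Stab Y i), (Stab X i); auto.
      apply (g_anti (Gs i)); auto.
    + intros X t _ Hn. destruct (Stage X) as [i Hi]. rewrite (Stab X i); auto. apply (g_val (Gs i)); auto.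
    + intros X _ Hc. destruct (Stage X) as [i Hi]. rewrite (Stab X i); auto. apply (g_clique (Gs i)); auto.
      intros x y Hx Hy Hxy. rewrite <- (Stab [x; y] i); auto. intros z [<-|[<-|[]]]; auto.
  - intros P h H. destruct (request_coded H) as [tab Ht].
    destruct (dcd_surj (P, tab)) as [j Hj]. destruct (FD j) as (_ & HP & HD). cbn zeta in HP, HD. rewrite Hj in HP, HD. cbn [fst snd] in HP, HD.
    destruct HD as (d & Hd & Hn & He).
    + revert H. apply request_ext.
      * intros X HX. apply Stab. intros x Hx. apply HP, HX, Hx.
      * intros X HX. symmetry. apply Ht; auto.
    + exists d. split; auto. intros X HX. rewrite (Stab (d :: X) (S j)).
      * rewrite He; auto.
      * intros x [<-|Hx]; auto.
Qed.
End Labels.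

(** * Deciding the theory of a generic graph *)

(** [index_sets k] lists the subsets of [{0 .. k-1}] as decreasing lists; a table assigns to each
    of them the rank of the corresponding set of vertices, truncated at [B]. *)
Fixpoint index_sets (k : nat) : list (list nat) :=
  match k with 0 => [[]] | S k => index_sets k ++ map (cons k) (index_sets k) end.

Fixpoint desc (k : nat) : list nat := match k with 0 => [] | S k => k :: desc k end.

Lemma In_desc k i : In i (desc k) <-> i < k.
Proof. induction k; simpl. lia. rewrite IHk. lia. Qed.

Lemma index_sets_lt k : forall X i, In X (index_sets k) -> In i X -> i < k.
Proof.
  induction k as [|k IH]; simpl; intros X i HX Hi.
  - destruct HX as [<-|[]]. destruct Hi.
  - apply in_app_or in HX. destruct HX as [HX|HX].
    + specialize (IH X i HX Hi). lia.
    + apply in_map_iff in HX. destruct HX as (Y & <- & HY). destruct Hi as [<-|Hi]. lia.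
      specialize (IH Y i HY Hi). lia.
Qed.

Lemma index_sets_NoDup k : forall X, In X (index_sets k) -> NoDup X.
Proof.
  induction k as [|k IH]; simpl; intros X HX.
  - destruct HX as [<-|[]]. constructor.
  - apply in_app_or in HX. destruct HX as [HX|HX]; auto.
    apply in_map_iff in HX. destruct HX as (Y & <- & HY). constructor; auto.
    intros Hk. apply (index_sets_lt k) in Hk; auto. lia.
Qed.

Lemma index_sets_filter k f : In (filter f (desc k)) (index_sets k).
Proof.
  induction k as [|k IH]; simpl; auto. apply in_or_app. destruct (f k); auto.
  right. apply in_map. auto.
Qed.

Lemma index_sets_nil k : In [] (index_sets k).
Proof. induction k; simpl; auto. apply in_or_app. auto. Qed.

Lemma index_sets_single k i : i < k -> In [i] (index_sets k).
Proof.
  induction k; simpl; intros H. lia. apply in_or_app. assert (i = k \/ i < k) as [->|L] by lia; auto.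
  right. apply in_map. apply index_sets_nil.
Qed.

Lemma index_sets_pair k i j : j < i -> i < k -> In [i; j] (index_sets k).
Proof.
  induction k; simpl; intros H1 H2. lia. apply in_or_app. assert (i = k \/ i < k) as [->|L] by lia; auto.
  right. apply in_map. apply index_sets_single. auto.
Qed.

Lemma index_sets_length k X : In X (index_sets k) -> length X <= k.
Proof.
  intros H. rewrite <- (length_seq k 0). apply NoDup_incl_length. eapply index_sets_NoDup; eauto.
  intros i Hi. apply in_seq. pose proof (index_sets_lt _ _ _ H Hi). lia.
Qed.

Definition choices (B : nat) (Xs : list (list nat)) : list (list (list nat * nat)) :=
  fold_right (fun X acc => flat_map (fun v => map (cons (X, v)) acc) (seq 0 (S B))) [[]] Xs.

Lemma choices_keys B Xs : forall t, In t (choices B Xs) -> map fst t = Xs.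
Proof.
  induction Xs as [|X Xs IH]; simpl; intros t Ht.
  - destruct Ht as [<-|[]]. auto.
  - assert (K : In t (flat_map (fun v => map (cons (X, v)) (choices B Xs)) (seq 0 (S B)))) by exact Ht.
    apply in_flat_map in K. destruct K as (v & _ & K). apply in_map_iff in K. destruct K as (t' & <- & K).
    simpl. f_equal. auto.
Qed.

Lemma choices_map B f Xs : (forall X, f X <= B) -> In (map (fun X => (X, f X)) Xs) (choices B Xs).
Proof.
  intros Hf. induction Xs as [|X Xs IH]; simpl; auto.
  change (In ((X, f X) :: map (fun X => (X, f X)) Xs) (flat_map (fun v => map (cons (X, v)) (choices B Xs)) (seq 0 (S B)))).
  apply in_flat_map. exists (f X). split. apply in_seq. specialize (Hf X). lia. apply in_map. auto.
Qed.

Section Tables.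
Variable g : nat -> nat.

Definition valid (B k : nat) (t : list (list nat * nat)) : bool :=
  forallb (fun X =>
    forallb (fun Y => negb (inclb X Y) || Nat.leb (lookup t Y) (lookup t X)) (index_sets k)
    && Nat.leb (lookup t X) B
    && (Nat.eqb (lookup t X) 0
        || Nat.leb (length X) (lookup t X)
           && (Nat.eqb (lookup t X) B || Nat.leb (g (lookup t X) + 2) (length X)))
    && (existsb (fun i => existsb (fun j => Nat.ltb j i && Nat.eqb (lookup t [i; j]) 0) X) X
        || negb (Nat.eqb (lookup t X) 0))) (index_sets k).

(** These are the axioms [good] seen through truncation. The value [B] stands for every rank at
    least [B], including infinity, and is therefore exempt from the constraint by [g]. Pairs are
    listed with [j < i] because keys are decreasing lists. *)
Record valid_table (B k : nat) (v : list nat -> nat) : Prop := {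
  vt_anti X Y : In X (index_sets k) -> In Y (index_sets k) -> incl X Y -> v Y <= v X;
  vt_le X : In X (index_sets k) -> v X <= B;
  vt_val X : In X (index_sets k) -> v X = 0 \/ (length X <= v X /\ (v X = B \/ g (v X) + 2 <= length X));
  vt_clique X : In X (index_sets k) -> (forall i j, In i X -> In j X -> j < i -> v [i; j] <> 0) -> v X <> 0
}.

Lemma valid_spec B k t : valid B k t = true <-> valid_table B k (lookup t).
Proof.
  unfold valid. rewrite forallb_forall. split.
  - intros H. assert (K : forall X, In X (index_sets k) ->
      ((forall Y, In Y (index_sets k) -> incl X Y -> lookup t Y <= lookup t X) /\ lookup t X <= B /\
       (lookup t X = 0 \/ (length X <= lookup t X /\ (lookup t X = B \/ g (lookup t X) + 2 <= length X))) /\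
       ((forall i j, In i X -> In j X -> j < i -> lookup t [i; j] <> 0) -> lookup t X <> 0))).
    { intros X HX. specialize (H X HX). rewrite !andb_true_iff, !orb_true_iff, forallb_forall, andb_true_iff, orb_true_iff,
        !Nat.leb_le, !Nat.eqb_eq, negb_true_iff, Nat.eqb_neq in H.
      destruct H as [[[H1 H2] H3] H4]. split; [|split; [|split]]; auto.
      - intros Y HY I. specialize (H1 Y HY). apply inclb_spec in I. rewrite I in H1. simpl in H1. apply Nat.leb_le. auto.
      - intros Hc. destruct H4 as [H4|H4]; auto. exfalso. apply existsb_exists in H4. destruct H4 as (i & Hi & H4).
        apply existsb_exists in H4. destruct H4 as (j & Hj & H4). rewrite andb_true_iff, Nat.ltb_lt, Nat.eqb_eq in H4.
        apply (Hc i j); tauto. }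
    constructor; intros X; intros.
    + apply K; auto.
    + apply K; auto.
    + apply K; auto.
    + apply K; auto.
  - intros V X HX. rewrite !andb_true_iff, !orb_true_iff, forallb_forall, andb_true_iff, orb_true_iff,
        !Nat.leb_le, !Nat.eqb_eq, negb_true_iff, Nat.eqb_neq. repeat split.
    + intros Y HY. destruct (inclb X Y) eqn:E; auto. apply inclb_spec in E. simpl. apply Nat.leb_le. apply (vt_anti V); auto.
    + apply (vt_le V); auto.
    + apply (vt_val V); auto.
    + destruct (existsb (fun i => existsb (fun j => Nat.ltb j i && Nat.eqb (lookup t [i; j]) 0) X) X) eqn:E; auto.
      right. apply (vt_clique V); auto. intros i j Hi Hj Hij K.
      apply not_true_iff_false in E. apply E. apply existsb_exists. exists i. split; auto. apply existsb_exists.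
      exists j. split; auto. rewrite andb_true_iff, Nat.ltb_lt, Nat.eqb_eq. auto.
Qed.

Definition exts (B k : nat) (t : list (list nat * nat)) : list (list (list nat * nat)) :=
  filter (valid B (S k)) (map (fun u => t ++ u) (choices B (map (cons k) (index_sets k)))).

Lemma lookup_app_l t u X : In X (map fst t) -> lookup (t ++ u) X = lookup t X.
Proof.
  induction t as [|[Y v] t IH]; simpl; [tauto|]. intros H. destruct (enc_eqb Y X) eqn:E; auto.
  destruct H as [->|H]; auto. pose proof (proj2 (enc_eqb_spec X X) eq_refl). congruence.
Qed.

Lemma lookup_app_r t u X : ~ In X (map fst t) -> lookup (t ++ u) X = lookup u X.
Proof.
  induction t as [|[Y v] t IH]; simpl; auto. intros H. destruct (enc_eqb Y X) eqn:E; auto.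
  apply (enc_eqb_spec Y X) in E. tauto.
Qed.

Definition cap (B : nat) (o : option nat) : nat := match o with None => B | Some t => Nat.min t B end.

Lemma cap_mono B a b : ole a b -> cap B a <= cap B b.
Proof. destruct a, b; simpl; intros; try lia. Qed.

Lemma cap_le B a : cap B a <= B.
Proof. destruct a; simpl; lia. Qed.

Lemma cap_zero B a : 0 < B -> cap B a = 0 <-> a = Some 0.
Proof. destruct a as [t|]; simpl; intros; split; intros; try lia; try discriminate. f_equal. lia. injection H0; lia. Qed.

(** * Simulation of tuples by tables *)

Variable rk : list nat -> option nat.
Hypothesis G : good g (fun _ => True) rk.
Hypothesis E : forall P h, request g rk P h -> exists d, ~ In d P /\ forall X, incl X P -> rk (d :: X) = h X.

Definition rank_edge (u v : nat) : Prop := u <> v /\ rk [u; v] <> Some 0.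

Lemma rk_anti X Y : incl X Y -> ole (rk Y) (rk X).
Proof. apply (g_anti G). auto. Qed.

Lemma rk_same X Y : incl X Y -> incl Y X -> rk X = rk Y.
Proof. intros. apply ole_antisym; apply rk_anti; auto. Qed.

Lemma rk_swap u v : rk [u; v] = rk [v; u].
Proof. apply rk_same; intros i [<-|[<-|[]]]; simpl; auto. Qed.

Definition simulates (B k : nat) (t : list (list nat * nat)) (p : nat -> nat) : Prop :=
  map fst t = index_sets k /\ inj_below k p /\ forall X, In X (index_sets k) -> lookup t X = cap B (rk (map p X)).

Lemma NoDup_map_inj k (p : nat -> nat) X : inj_below k p -> In X (index_sets k) -> NoDup (map p X).
Proof.
  intros Hp HX. apply NoDup_map_NoDup_ForallPairs; [|eapply index_sets_NoDup; eauto].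
  intros i j Hi Hj. apply Hp; eapply index_sets_lt; eauto.
Qed.

(** The bound [k <= B] keeps truncated values at least the size of their set, as [vt_val]
    demands. *)
Lemma table_of_tuple B k p : 0 < B -> k <= B -> inj_below k p -> valid_table B k (fun X => cap B (rk (map p X))).
Proof.
  intros HB0 HB Hp. constructor.
  - intros X Y HX HY I. apply cap_mono, rk_anti. intros i Hi. apply in_map_iff in Hi. destruct Hi as (j & <- & Hj).
    apply in_map. auto.
  - intros. apply cap_le.
  - intros X HX. pose proof (index_sets_length _ _ HX) as L. destruct (rk (map p X)) as [t|] eqn:Et; simpl.
    + apply (g_val G) in Et; auto; [|eapply NoDup_map_inj; eauto]. rewrite length_map in Et.
      destruct Et as [->|[E1 E2]]; auto. right. split. lia.
      destruct (Nat.le_gt_cases B t). left; lia. right. rewrite Nat.min_l; lia.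
    + right. split; auto. lia.
  - intros X HX Hc. rewrite cap_zero by auto. apply (g_clique G); auto. intros u v Hu Hv Huv.
    apply in_map_iff in Hu, Hv. destruct Hu as (i & <- & Hi), Hv as (j & <- & Hj).
    assert (i <> j) by congruence. destruct (Nat.lt_ge_cases j i) as [L|L].
    + specialize (Hc i j Hi Hj L). rewrite cap_zero in Hc by auto. exact Hc.
    + specialize (Hc j i Hj Hi ltac:(lia)). rewrite cap_zero in Hc by auto. rewrite rk_swap. exact Hc.
Qed.

Lemma valid_table_ext B k v w : (forall X, In X (index_sets k) -> v X = w X) -> valid_table B k v -> valid_table B k w.
Proof.
  intros H V. constructor.
  - intros X Y HX HY I. rewrite <- !H by auto. apply (vt_anti V); auto.
  - intros X HX. rewrite <- H by auto. apply (vt_le V); auto.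
  - intros X HX. rewrite <- !H by auto. apply (vt_val V); auto.
  - intros X HX Hc. rewrite <- H by auto. apply (vt_clique V); auto. intros i j Hi Hj Hij.
    rewrite H. apply Hc; auto. apply index_sets_pair; auto. eapply index_sets_lt; eauto.
Qed.

Lemma map_upd_old {D} (p : nat -> D) k d X : In X (index_sets k) -> map (upd p k d) X = map p X.
Proof.
  intros HX. apply map_ext_in. intros i Hi. apply upd_lt. eapply index_sets_lt; eauto.
Qed.

Lemma map_upd_new {D} (p : nat -> D) k d X : In X (index_sets k) -> map (upd p k d) (k :: X) = d :: map p X.
Proof. intros HX. simpl. rewrite upd_eq, map_upd_old; auto. Qed.

Lemma In_cons_sets k X : ~ In (k :: X) (index_sets k).
Proof. intros H. apply (index_sets_lt k) with (i := k) in H; simpl; auto. lia. Qed.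

Lemma simulates_step B k t p d : S k <= B -> simulates B k t p -> (forall i, i < k -> p i <> d) ->
  exists t', In t' (exts B k t) /\ simulates B (S k) t' (upd p k d).
Proof.
  intros HB (K & Hp & Hl) Hd.
  pose (u := map (fun Y => (Y, cap B (rk (map (upd p k d) Y)))) (map (cons k) (index_sets k))).
  assert (Hu : In u (choices B (map (cons k) (index_sets k)))) by (apply (choices_map (fun Y => cap B (rk (map (upd p k d) Y)))); intros; apply cap_le).
  assert (Hp' : inj_below (S k) (upd p k d)) by (apply inj_upd; auto).
  assert (L : forall X, In X (index_sets (S k)) -> lookup (t ++ u) X = cap B (rk (map (upd p k d) X))).
  { intros X HX. simpl in HX. apply in_app_or in HX. destruct HX as [HX|HX].
    - rewrite lookup_app_l by (rewrite K; auto). rewrite Hl by auto. rewrite map_upd_old by auto. auto.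
    - rewrite lookup_app_r.
      + unfold u. apply (lookup_map (fun Y => cap B (rk (map (upd p k d) Y)))). auto.
      + rewrite K. apply in_map_iff in HX. destruct HX as (Y & <- & _). apply In_cons_sets. }
  exists (t ++ u). split.
  - unfold exts. apply filter_In. split.
    + apply in_map_iff. exists u. auto.
    + apply valid_spec. eapply valid_table_ext; [|apply table_of_tuple with (p := upd p k d); auto; lia].
      intros X HX. symmetry. auto.
  - split; [|split; auto]. rewrite map_app, K, (choices_keys _ _ _ Hu). auto.
Qed.

(** The new row of the table is turned into a request over the tuple, and genericity realises it.
    This is the only place where the evaluator depends on genericity. *)
Lemma simulates_back B k t p t' : S k <= B -> simulates B k t p -> In t' (exts B k t) ->
  exists d, (forall i, i < k -> p i <> d) /\ simulates B (S k) t' (upd p k d).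
Proof.
  intros HB (K & Hp & Hl) Ht'. unfold exts in Ht'. apply filter_In in Ht'. destruct Ht' as [Ht' V].
  apply in_map_iff in Ht'. destruct Ht' as (u & <- & Hu). apply valid_spec in V. set (t' := t ++ u) in *.
  assert (Ll : forall X, In X (index_sets k) -> lookup t' X = cap B (rk (map p X))).
  { intros X HX. unfold t'. rewrite lookup_app_l by (rewrite K; auto). auto. }
  assert (Io : forall X, In X (index_sets k) -> In X (index_sets (S k))).
  { intros X HX. simpl. apply in_or_app. auto. }
  assert (In' : forall X, In X (index_sets k) -> In (k :: X) (index_sets (S k))).
  { intros X HX. simpl. apply in_or_app. right. apply in_map. auto. }
  pose (P := map p (desc k)).
  (* Translates a list of vertices of the tuple into the decreasing list of their indices, which is
     a key of the table. *)
  pose (ix := fun X => filter (fun i => mem (p i) X) (desc k)).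
  assert (Ix : forall X, In (ix X) (index_sets k)) by (intros; apply index_sets_filter).
  assert (Ixi : forall X i, In i (ix X) <-> i < k /\ In (p i) X).
  { intros X i. unfold ix. rewrite filter_In, mem_In, In_desc. tauto. }
  assert (IP : forall X u, incl X P -> In u X -> exists i, i < k /\ p i = u).
  { intros X x HX Hx. apply HX in Hx. apply in_map_iff in Hx. destruct Hx as (i & <- & Hi). exists i.
    apply In_desc in Hi. auto. }
  assert (Rix : forall X, incl X P -> rk (map p (ix X)) = rk X).
  { intros X HX. apply rk_same; intros x Hx.
    - apply in_map_iff in Hx. destruct Hx as (i & <- & Hi). apply Ixi in Hi. tauto.
    - destruct (IP X x HX Hx) as (i & Hi & <-). apply in_map. apply Ixi. auto. }
  assert (Lix : forall X, incl X P -> lookup t' (ix X) = cap B (rk X)).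
  { intros X HX. rewrite Ll by auto. rewrite Rix; auto. }
  assert (Len : forall X, incl X P -> NoDup X -> length X = length (ix X)).
  { intros X HX Hn. apply Nat.le_antisymm.
    - rewrite <- (length_map p (ix X)). apply NoDup_incl_length; auto. intros x Hx.
      destruct (IP X x HX Hx) as (i & Hi & <-). apply in_map. apply Ixi. auto.
    - rewrite <- (length_map p (ix X)). apply NoDup_incl_length.
      + eapply NoDup_map_inj; eauto.
      + intros x Hx. apply in_map_iff in Hx. destruct Hx as (i & <- & Hi). apply Ixi in Hi. tauto. }
  pose (v := fun X => lookup t' (k :: ix X)).
  assert (Vle : forall X, incl X P -> v X <= cap B (rk X)).
  { intros X HX. rewrite <- Lix by auto. apply (vt_anti V); auto. apply incl_tl, incl_refl. }
  assert (Vanti : forall X Y, incl Y P -> incl X Y -> v Y <= v X).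
  { intros X Y HY I. apply (vt_anti V); auto. intros i [<-|Hi]; simpl; auto. right.
    apply Ixi. apply Ixi in Hi. destruct Hi; auto. }
  (* Below the cap the table prescribes the rank exactly. At the cap any rank at least [B] would do,
     and that of [X] itself is requested, the largest one that [h_le] permits. *)
  pose (h := fun X => if Nat.ltb (v X) B then Some (v X) else rk X).
  assert (H : request g rk P h).
  { constructor.
    - intros X Y HY I. specialize (Vanti X Y HY I). assert (HX : incl X P) by (eapply incl_tran; eauto). unfold h.
      destruct (Nat.ltb_spec (v X) B), (Nat.ltb_spec (v Y) B); try lia.
      + simpl. auto.
      + pose proof (Vle X HX) as Q. destruct (rk X) as [s|]; simpl in *; auto. lia.
      + apply rk_anti; auto.
    - intros X HX. unfold h. destruct (Nat.ltb_spec (v X) B); [|apply ole_refl].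
      pose proof (Vle X HX) as Q. destruct (rk X) as [s|]; simpl in *; auto. lia.
    - intros X s HX Hn. unfold h. destruct (Nat.ltb_spec (v X) B).
      + intros Q. injection Q as <-. destruct (vt_val V _ (In' _ (Ix X))) as [Q|[Q1 Q2]]; [left; auto|right].
        fold (v X) in *. simpl in Q1, Q2. rewrite (Len X HX Hn). split; auto. destruct Q2; auto. lia.
      (* Here [v X] is [B], whence [B <= s]. As [X] has at most [k] elements and [S k <= B], there
         is room for one more vertex in a clique of size [s]. *)
      + intros Es. pose proof (Vle X HX) as Q. rewrite Es in Q. simpl in Q.
        apply (g_val G) in Es; auto. destruct Es as [->|[E1 E2]]; auto. right. split; [|lia].
        rewrite (Len X HX Hn). pose proof (index_sets_length _ _ (Ix X)). lia.
    - intros X HX Hi Hc. unfold h. destruct (Nat.ltb_spec (v X) B); auto.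
      intros Q. assert (Qv : v X = 0) by congruence. revert Qv. apply (vt_clique V); auto.
      intros i j Hii Hjj Hij. destruct Hjj as [<-|Hj].
      + exfalso. destruct Hii as [<-|Hii]. lia. apply Ixi in Hii. lia.
      + destruct Hii as [<-|Hii].
        * apply Ixi in Hj. destruct Hj as [Hj Hpj]. specialize (Hi (p j) Hpj). unfold h in Hi.
          assert (Vj : v [p j] = lookup t' [k; j]).
          { unfold v. apply Nat.le_antisymm; apply (vt_anti V); auto using index_sets_single.
            - intros x [<-|[<-|[]]]; simpl; auto. right. apply Ixi. simpl. auto.
            - intros x [<-|Hx]; simpl; auto. right. left. apply Ixi in Hx. destruct Hx as [Hx [Ex|[]]].
              apply Hp in Ex; auto. }
          rewrite Vj in Hi. destruct (Nat.ltb_spec (lookup t' [k; j]) B); [congruence|lia].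
        * apply Ixi in Hii, Hj. rewrite Ll by (apply index_sets_pair; tauto). rewrite cap_zero by lia.
          intros Ez. apply Hc. apply ole_antisym; [|apply ole_zero].
          change (map p [i; j]) with [p i; p j] in Ez. rewrite <- Ez. apply rk_anti.
          intros x [<-|[<-|[]]]; tauto. }
  destruct (E H) as (d & Hd & He). exists d.
  assert (Hpd : forall i, i < k -> p i <> d).
  { intros i Hi <-. apply Hd. apply in_map. apply In_desc. auto. }
  split; auto. split; [|split].
  - unfold t'. rewrite map_app, K, (choices_keys _ _ _ Hu). auto.
  - apply inj_upd; auto.
  - intros X HX. cbn [index_sets] in HX. apply in_app_or in HX. destruct HX as [HX|HX].
    + rewrite Ll, map_upd_old by auto. auto.
    + apply in_map_iff in HX. destruct HX as (Y & <- & HY). rewrite map_upd_new by auto.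
      assert (IY : incl (map p Y) P).
      { intros x Hx. apply in_map_iff in Hx. destruct Hx as (i & <- & Hi). apply in_map. apply In_desc.
        eapply index_sets_lt; eauto. }
      rewrite He by auto.
      assert (Ev : lookup t' (k :: Y) = v (map p Y)).
      { unfold v. apply Nat.le_antisymm; apply (vt_anti V); auto; intros x [<-|Hx]; simpl; auto; right.
        - apply Ixi in Hx. destruct Hx as [Hx Hpx]. apply in_map_iff in Hpx. destruct Hpx as (y & Ey & Hy).
          apply Hp in Ey; subst; auto. eapply index_sets_lt; eauto.
        - apply Ixi. split. eapply index_sets_lt; eauto. apply in_map; auto. }
      rewrite Ev. unfold h. pose proof (vt_le V _ (In' _ (Ix (map p Y)))) as Q1. fold (v (map p Y)) in Q1.
      pose proof (Vle _ IY) as Q2. pose proof (cap_le B (rk (map p Y))) as Q3.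
      destruct (Nat.ltb_spec (v (map p Y)) B).
      * simpl. lia.
      * lia.
Qed.
End Tables.

(** * The evaluator *)

(** Components: the input [n], the cap [B], the number [k] of vertices named so far, their table,
    and the list of the indices that the variables denote. *)
Notation tstate := (nat * (nat * (nat * (list (list nat * nat) * list nat))))%type.

Section Eval.
Variable gg : nat -> nat -> nat.

Definition st_n (z : tstate) := fst z.
Definition st_B (z : tstate) := fst (snd z).
Definition st_k (z : tstate) := fst (snd (snd z)).
Definition st_t (z : tstate) := fst (snd (snd (snd z))).
Definition st_r (z : tstate) := snd (snd (snd (snd z))).
Definition mk (n B k : nat) t r : tstate := (n, (B, (k, (t, r)))).

Definition adjacent (t : list (list nat * nat)) (i j : nat) : bool :=
  negb (Nat.eqb i j) && negb (Nat.eqb (lookup t (if Nat.ltb j i then [i; j] else [j; i])) 0).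

(** A quantifier ranges over the vertices already named and over all valid ways to add one more; by
    [simulates_step] and [simulates_back] the latter are exactly the ways realised by new
    vertices. *)
Definition branches (z : tstate) : list tstate :=
  map (fun i => mk (st_n z) (st_B z) (st_k z) (st_t z) (i :: st_r z)) (seq 0 (st_k z))
  ++ map (fun t => mk (st_n z) (st_B z) (S (st_k z)) t (st_k z :: st_r z)) (exts (gg (st_n z)) (st_B z) (st_k z) (st_t z)).

Definition evaluate : fm -> tstate -> bool :=
  fmrec (fun _ => false)
    (fun z x y => Nat.eqb (nth x (st_r z) 0) (nth y (st_r z) 0))
    (fun z x y => adjacent (st_t z) (nth x (st_r z) 0) (nth y (st_r z) 0))
    (fun _ a b => negb a || b)
    (fun _ rs => forallb (fun c => c) rs)
    branches.

Variables (n : nat) (rk : list nat -> option nat).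
Hypothesis G : good (gg n) (fun _ => True) rk.
Hypothesis E : forall P h, request (gg n) rk P h -> exists d, ~ In d P /\ forall X, incl X P -> rk (d :: X) = h X.

Lemma adjacent_spec B k t p i j : 0 < B -> simulates rk B k t p -> i < k -> j < k ->
  adjacent t i j = true <-> rank_edge rk (p i) (p j).
Proof.
  intros HB (K & Hp & Hl) Hi Hj. unfold adjacent, rank_edge.
  rewrite andb_true_iff, !negb_true_iff, !Nat.eqb_neq.
  destruct (Nat.eq_dec i j) as [->|Hij]. tauto.
  assert (p i <> p j) by (intros Q; apply Hp in Q; auto).
  assert (L : lookup t (if Nat.ltb j i then [i; j] else [j; i]) = cap B (rk [p i; p j])).
  { destruct (Nat.ltb_spec j i).
    - rewrite Hl by (apply index_sets_pair; auto). reflexivity.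
    - rewrite Hl by (apply index_sets_pair; lia). simpl. f_equal. apply (rk_swap G). }
  rewrite L, cap_zero by auto. tauto.
Qed.

(** Passing a quantifier raises [k] by at most one and lowers [fsize] by one, so [k + fsize f < B]
    persists and tables always have room for a new vertex. *)
Lemma evaluate_spec f : forall B k t p r, simulates rk B k t p -> fbd (length r) f ->
  (forall i, In i r -> i < k) -> k + fsize f < B ->
  evaluate f (mk n B k t r) = true <-> fsat (rank_edge rk) (fun x => p (nth x r 0)) f.
Proof.
  induction f; intros B k t p r Hs Hb Hr HB.
  - simpl. intuition discriminate.
  - simpl in Hb. change (Nat.eqb (nth x r 0) (nth y r 0) = true <-> p (nth x r 0) = p (nth y r 0)).
    rewrite Nat.eqb_eq. split. congruence. apply Hs; apply Hr, nth_In; tauto.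
  - simpl in Hb. apply (@adjacent_spec B k t p); auto; try lia; apply Hr, nth_In; tauto.
  - simpl in Hb, HB. change (negb (evaluate f1 (mk n B k t r)) || evaluate f2 (mk n B k t r) = true <->
      (fsat (rank_edge rk) (fun x => p (nth x r 0)) f1 -> fsat (rank_edge rk) (fun x => p (nth x r 0)) f2)).
    rewrite <- (IHf1 B k t p r), <- (IHf2 B k t p r) by (try tauto; try lia).
    destruct (evaluate f1 _), (evaluate f2 _); simpl; intuition.
  - simpl in Hb, HB.
    change (forallb (fun c => c) (map (evaluate f) (branches (mk n B k t r))) = true <->
      forall d, fsat (rank_edge rk) (env_cons d (fun x => p (nth x r 0))) f).
    rewrite forallb_forall.
    assert (Old : forall i, i < k -> evaluate f (mk n B k t (i :: r)) = true <->
      fsat (rank_edge rk) (env_cons (p i) (fun x => p (nth x r 0))) f).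
    { intros i Hi. rewrite (IHf B k t p (i :: r)); auto; try lia.
      - apply fsat_ext. intros [|x]; auto.
      - intros j [<-|Hj]; auto. }
    assert (New : forall t' d, simulates rk B (S k) t' (upd p k d) -> evaluate f (mk n B (S k) t' (k :: r)) = true <->
      fsat (rank_edge rk) (env_cons d (fun x => p (nth x r 0))) f).
    { intros t' d Hs'. rewrite (IHf B (S k) t' (upd p k d) (k :: r)); auto; try lia.
      - apply (fsat_agree _ f (n := S (length r))); auto. intros [|x] Hx; simpl.
        + apply upd_eq.
        + apply upd_lt. apply Hr, nth_In. lia.
      - intros j [<-|Hj]; [lia|specialize (Hr j Hj); lia]. }
    split.
    + intros H d. destruct (classic (exists i, i < k /\ p i = d)) as [(i & Hi & <-)|Hn].
      * apply Old; auto. apply H. apply in_map. apply in_or_app. left. apply in_map_iff. exists i. split; auto.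
        apply in_seq. unfold st_k, mk. simpl. lia.
      * destruct (@simulates_step (gg n) rk G B k t p d) as (t' & Ht' & Hs'); auto; try lia.
        { intros i Hi Eq. apply Hn. eauto. }
        apply (New t' d Hs'). apply H. apply in_map. apply in_or_app. right. apply in_map_iff. exists t'. auto.
    + intros H c Hc. apply in_map_iff in Hc. destruct Hc as (z & <- & Hz). apply in_app_or in Hz.
      destruct Hz as [Hz|Hz]; apply in_map_iff in Hz.
      * destruct Hz as (i & <- & Hi). apply in_seq in Hi. apply Old; auto. unfold st_k, mk in Hi. simpl in Hi. lia.
      * destruct Hz as (t' & <- & Ht').
        destruct (@simulates_back (gg n) rk G E B k t p t') as (d & _ & Hs'); auto; try lia.
        apply (New t' d Hs'). auto.
Qed.

(** The cap [S (enc f)] exceeds [fsize f]. In the initial table the empty set has the value of the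
    cap, that is, infinite rank. *)
Definition decide (f : fm) : bool := evaluate f (mk n (S (enc f)) 0 [([], S (enc f))] []).

Lemma decide_spec f rho : fbd 0 f -> decide f = true <-> fsat (rank_edge rk) rho f.
Proof.
  intros Hb. unfold decide. rewrite (evaluate_spec f (p := fun _ => 0)).
  - split; apply fsat_sentence; auto.
  - split; [|split].
    + reflexivity.
    + intros i j Hi. lia.
    + intros X [<-|[]]. change (map (fun _ => 0) []) with (@nil nat). rewrite (rank_nil G). reflexivity.
  - auto.
  - intros i [].
  - pose proof (fsize_fcode f). change (enc f) with (fcode f). lia.
Qed.
End Eval.

(** * Finitely many types amounts to divergence of [gg n] *)

Section Types.
Variable gg : nat -> nat -> nat.
Variables (n : nat) (rk : list nat -> option nat).
Hypothesis G : good (gg n) (fun _ => True) rk.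
Hypothesis E : forall P h, request (gg n) rk P h -> exists d, ~ In d P /\ forall X, incl X P -> rk (d :: X) = h X.

Definition tuple_table (B k : nat) (p : nat -> nat) : list (list nat * nat) :=
  map (fun X => (X, cap B (rk (map p X)))) (index_sets k).

Lemma tuple_table_simulates B k p : inj_below k p -> simulates rk B k (tuple_table B k p) p.
Proof.
  intros Hp. split; [|split; auto].
  - unfold tuple_table. rewrite map_map. apply map_id.
  - intros X HX. unfold tuple_table. apply (lookup_map (fun X => cap B (rk (map p X)))). auto.
Qed.

(** A finite positive rank [t] of a subset of a [k]-tuple satisfies [gg n t + 2 <= k], so divergence
    puts all such [t] below one bound [B0]. The table truncated at [B0] then determines all ranks
    exactly, and there are finitely many such tables. *)
Lemma few_types_of_divergence : (forall a, exists N, forall t, N <= t -> a < gg n t) -> few_types (rank_edge rk).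
Proof.
  intros Hg k. destruct (Hg k) as [B1 HB1]. set (B0 := S B1).
  assert (HB0 : forall t, B0 <= t -> k < gg n t) by (intros t Ht; apply HB1; unfold B0 in Ht; lia).
  pose (Sat := fun f t => exists p, inj_below k p /\ tuple_table B0 k p = t /\ fsat (rank_edge rk) p f).
  destruct (@finite_classes _ (choices B0 (index_sets k)) Sat (fbd k)) as (F & HF & HB).
  assert (Tr : forall f p q, fbd k f -> inj_below k p -> inj_below k q -> tuple_table B0 k p = tuple_table B0 k q ->
    fsat (rank_edge rk) p f -> fsat (rank_edge rk) q f).
  { intros f p q Hf Hp Hq Et Hs.
    assert (Er : forall X, In X (index_sets k) -> rk (map p X) = rk (map q X)).
    { intros X HX. pose proof (tuple_table_simulates B0 Hp) as (_ & _ & L1).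
      pose proof (tuple_table_simulates B0 Hq) as (_ & _ & L2). specialize (L1 X HX). specialize (L2 X HX).
      rewrite Et, L2 in L1.
      assert (Sm : forall r t, inj_below k r -> rk (map r X) = Some t -> t < B0 \/ t = 0).
      { intros r t Hr Ht. apply (g_val G) in Ht; auto; [|eapply NoDup_map_inj; eauto].
        destruct Ht as [|[_ Ht]]; auto. left. rewrite length_map in Ht. pose proof (index_sets_length _ _ HX).
        destruct (Nat.lt_ge_cases t B0) as [|K]; auto. apply HB0 in K. lia. }
      assert (Z : B0 <> 0) by (unfold B0; lia).
      destruct (rk (map p X)) as [s|] eqn:Es, (rk (map q X)) as [t|] eqn:Et'; simpl in L1; auto.
      + apply Sm in Es, Et'; auto. f_equal. lia.
      + apply Sm in Es; auto. lia.
      + apply Sm in Et'; auto. lia. }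
    (* The evaluator serves as a proof tool: equal ranks give equal tables at every cap, hence equal
       answers at a cap large enough for [f]. *)
    assert (Et2 : forall B, tuple_table B k p = tuple_table B k q).
    { intros B. unfold tuple_table. apply map_ext_in. intros X HX. rewrite Er; auto. }
    set (B := S (k + fsize f)).
    assert (Ev : forall r, inj_below k r -> evaluate gg f (mk n B k (tuple_table B k r) (seq 0 k)) = true <-> fsat (rank_edge rk) r f).
    { intros r Hr. rewrite (evaluate_spec gg n G E f (p := r)).
      - apply (fsat_agree _ f (n := k)); auto. intros i Hi. rewrite seq_nth; auto.
      - apply tuple_table_simulates; auto.
      - rewrite length_seq. auto.
      - intros i Hi. apply in_seq in Hi. lia.
      - unfold B. lia. }
    apply Ev; auto. rewrite <- Et2. apply Ev; auto. }
  exists F. split. apply Forall_forall; auto. intros f Hf. destruct (HB f Hf) as (q & Hq & Eq). exists q. split; auto.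
  intros rho Hr. specialize (Eq (tuple_table B0 k rho)).
  assert (I : In (tuple_table B0 k rho) (choices B0 (index_sets k))).
  { apply (choices_map (fun X => cap B0 (rk (map rho X)))). intros. apply cap_le. }
  specialize (Eq I). split; intros Hs.
  - destruct (proj1 Eq) as (p & Hp & Et & Hps). exists rho; auto. eapply Tr; eauto.
  - destruct (proj2 Eq) as (p & Hp & Et & Hps). exists rho; auto. eapply Tr; eauto.
Qed.

(** The request is [rk] itself. It is admissible because subsets of [X] have rank at least that of
    [X], so they too leave room for one more vertex. *)
Lemma extend_same X : NoDup X -> (forall t, rk X = Some t -> length X < t) ->
  exists d, ~ In d X /\ rk (d :: X) = rk X.
Proof.
  intros Hn Ht. destruct (E (P := X) (h := rk)) as (d & Hd & He).
  - constructor.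
    + intros Y Z _ I. apply (rk_anti G); auto.
    + intros. apply ole_refl.
    + intros Y t HY HnY Et. pose proof (rk_anti G HY) as A. rewrite Et in A.
      apply (g_val G) in Et; auto. destruct Et as [->|[Q1 Q2]]; auto. right. split; [|lia].
      destruct (rk X) as [s|] eqn:Es; [|destruct A]. simpl in A. specialize (Ht s eq_refl).
      pose proof (NoDup_incl_length HnY HY). lia.
    + auto.
  - exists d. split; auto. apply He. apply incl_refl.
Qed.

(** Rank [t] is requested only for the union with all of [X]; unions with smaller subsets keep
    infinite rank. *)
Lemma extend_to X t : NoDup X -> rk X = None -> S (length X) <= t -> gg n t + 2 <= S (length X) ->
  exists d, ~ In d X /\ rk (d :: X) = Some t.
Proof.
  intros Hn Hr Ht Hg.
  assert (Nn : forall Y, incl Y X -> rk Y = None).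
  { intros Y HY. pose proof (rk_anti G HY) as A. rewrite Hr in A. destruct (rk Y); auto. destruct A. }
  destruct (E (P := X) (h := fun Y => if inclb X Y then Some t else None)) as (d & Hd & He).
  - constructor.
    + intros Y Z HZ I. destruct (inclb X Y) eqn:EY; [|simpl; auto].
      replace (inclb X Z) with true. apply ole_refl. symmetry. apply inclb_spec. apply inclb_spec in EY.
      eapply incl_tran; eauto.
    + intros Y HY. rewrite (Nn Y HY). simpl. auto.
    + intros Y s HY HnY. destruct (inclb X Y) eqn:EY; [|discriminate]. intros Q. injection Q as <-. right.
      apply inclb_spec in EY. pose proof (NoDup_incl_length HnY HY). pose proof (NoDup_incl_length Hn EY).
      lia.
    + intros Y HY _ _. destruct (inclb X Y); try discriminate. intros Q. injection Q. lia.
  - exists d. split; auto. rewrite He by apply incl_refl. rewrite (proj2 (inclb_spec X X) (incl_refl X)). auto.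
Qed.

Lemma unranked_clique m : exists X, NoDup X /\ length X = m /\ rk X = None.
Proof.
  induction m as [|m (X & Hn & Hl & Hr)].
  - exists []. split. constructor. split; auto. apply (rank_nil G).
  - destruct (@extend_same X Hn) as (d & Hd & He). { intros t Ht. congruence. }
    exists (d :: X). split. constructor; auto. split; simpl; auto. congruence.
Qed.

Lemma ranked_clique t k : S k <= t -> gg n t + 2 <= S k -> exists X, NoDup X /\ length X = S k /\ rk X = Some t.
Proof.
  intros Ht Hg. destruct (unranked_clique k) as (X & Hn & Hl & Hr).
  destruct (@extend_to X t) as (d & Hd & He); auto; try lia.
  exists (d :: X). split. constructor; auto. simpl. auto.
Qed.

Lemma grow_clique t m : forall X, NoDup X -> rk X = Some t -> length X + m <= t ->
  exists W, length W = m /\ NoDup (W ++ X) /\ rk (W ++ X) = Some t.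
Proof.
  induction m as [|m IH]; intros X Hn Hr Hl.
  - exists []. auto.
  - destruct (IH X Hn Hr ltac:(lia)) as (W & HW & HnW & HrW).
    destruct (@extend_same (W ++ X) HnW) as (d & Hd & He).
    { intros s Es. rewrite length_app. assert (s = t) by congruence. lia. }
    exists (d :: W). split. simpl; auto. split. simpl. constructor; auto. simpl. congruence.
Qed.

Definition clique_fm (t : nat) : list fm :=
  flat_map (fun i => map (fun j => FRel i j) (seq 0 i)) (seq 0 t).

Lemma In_clique_fm t p : In p (clique_fm t) <-> exists i j, j < i /\ i < t /\ p = FRel i j.
Proof.
  unfold clique_fm. rewrite in_flat_map. split.
  - intros (i & Hi & Hp). apply in_map_iff in Hp. destruct Hp as (j & <- & Hj).
    apply in_seq in Hi, Hj. exists i, j. repeat split; auto; lia.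
  - intros (i & j & H1 & H2 & ->). exists i. split. apply in_seq; lia.
    apply in_map_iff. exists j. split; auto. apply in_seq; lia.
Qed.

Definition in_clique (k t : nat) : fm := exn (t - k) (FConj (clique_fm t)).

Lemma fbd_in_clique k t : k <= t -> fbd k (in_clique k t).
Proof.
  intros H. apply fbd_exn, fbd_FConj. apply Forall_forall. intros p Hp. apply In_clique_fm in Hp.
  destruct Hp as (i & j & H1 & H2 & ->). simpl. lia.
Qed.

Definition list_env (X : list nat) (i : nat) : nat := nth i X 0.

Lemma envl_list_env W X i : envl W (list_env X) i = nth i (W ++ X) 0.
Proof.
  destruct (Nat.lt_ge_cases i (length W)).
  - rewrite envl_lt with (d := 0), app_nth1 by auto. auto.
  - rewrite app_nth2 by auto. change (nth (i - length W) X 0) with (list_env X (i - length W)).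
    rewrite <- (envl_ge W (list_env X) (i - length W)). f_equal. lia.
Qed.

(** Ranks are visible to formulas. A clique of size [t] around [X] has nonzero rank, at least [t]
    and at most that of [X]; conversely a set of rank [s] grows vertex by vertex, keeping its rank,
    until it has [s] elements. *)
Lemma in_clique_spec X s t : rk X = Some s -> s <> 0 -> NoDup X -> length X <= s -> length X <= t ->
  fsat (rank_edge rk) (list_env X) (in_clique (length X) t) <-> t <= s.
Proof.
  intros Hr Hs Hn Hls Hlt. unfold in_clique. rewrite fsat_exn. split.
  - intros (W & HW & H). rewrite fsat_FConj in H. set (Z := W ++ X).
    assert (LZ : length Z = t) by (unfold Z; rewrite length_app; lia).
    assert (HE : forall i j, j < i -> i < t -> rank_edge rk (nth i Z 0) (nth j Z 0)).
    { intros i j Hj Hi. specialize (H (FRel i j)). simpl in H. rewrite !envl_list_env in H. apply H.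
      apply In_clique_fm. exists i, j. auto. }
    assert (NZ : NoDup Z).
    { apply NoDup_nth with (d := 0). intros i j Hi Hj Eq. rewrite LZ in Hi, Hj.
      destruct (Nat.lt_trichotomy i j) as [L|[L|L]]; auto; exfalso.
      - exact (proj1 (HE j i L Hj) (eq_sym Eq)).
      - exact (proj1 (HE i j L Hi) Eq). }
    assert (RZ : rk Z <> Some 0).
    { apply (g_clique G); auto. intros u v Hu Hv Huv. apply In_nth with (d := 0) in Hu, Hv.
      destruct Hu as (i & Hi & <-), Hv as (j & Hj & <-). rewrite LZ in Hi, Hj.
      destruct (Nat.lt_trichotomy i j) as [L|[L|L]].
      - rewrite (rk_swap G). apply (HE j i L Hj).
      - subst. congruence.
      - apply (HE i j L Hi). }
    assert (A : ole (rk Z) (rk X)) by (apply (rk_anti G); apply incl_appr, incl_refl).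
    rewrite Hr in A. destruct (rk Z) as [z|] eqn:Ez; [|destruct A]. simpl in A.
    apply (g_val G) in Ez; auto. destruct Ez as [->|[Q _]]; [congruence|]. lia.
  - intros Hts. destruct (@grow_clique s (t - length X) X) as (W & HW & HnW & HrW); auto; try lia.
    exists W. split; auto. apply fsat_FConj. intros p Hp. apply In_clique_fm in Hp.
    destruct Hp as (i & j & Hj & Hi & ->). simpl. rewrite !envl_list_env.
    assert (LZ : length (W ++ X) = t) by (rewrite length_app; lia). split.
    + intros Eq. rewrite NoDup_nth with (d := 0) in HnW. apply HnW in Eq; lia.
    + intros Ez. assert (A : ole (rk (W ++ X)) (rk [nth i (W ++ X) 0; nth j (W ++ X) 0])).
      { apply (rk_anti G). intros x [<-|[<-|[]]]; apply nth_In; lia. }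
      rewrite HrW, Ez in A. simpl in A. lia.
Qed.

(** The infinite pigeonhole principle, once for each formula of [F]: of an infinite set and its
    complement within [T], one is infinite. *)
Lemma homogeneous (F : list fm) (Sat : fm -> nat -> Prop) : forall T : nat -> Prop,
  (forall N, exists t, N <= t /\ T t) ->
  exists T' : nat -> Prop, (forall t, T' t -> T t) /\ (forall N, exists t, N <= t /\ T' t) /\
    forall q, In q F -> forall s t, T' s -> T' t -> (Sat q s <-> Sat q t).
Proof.
  induction F as [|q F IH]; intros T HT.
  - exists T. split; auto. split; auto. intros q [].
  - destruct (classic (forall N, exists t, N <= t /\ T t /\ Sat q t)) as [H|H].
    + destruct (IH (fun t => T t /\ Sat q t) H) as (T' & S1 & S2 & S3). exists T'. split; [|split]; auto.
      intros; apply S1; auto.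
      intros q' [<-|Hq] s t Hs Ht; auto. apply S1 in Hs, Ht. tauto.
    + apply not_all_ex_not in H. destruct H as [N0 H].
      destruct (IH (fun t => T t /\ ~ Sat q t)) as (T' & S1 & S2 & S3).
      * intros N. destruct (HT (N + N0)) as (t & Ht & Tt). exists t. split. lia. split; auto.
        intros K. apply H. exists t. split; auto. lia.
      * exists T'. split; [|split]; auto. intros; apply S1; auto.
        intros q' [<-|Hq] s t Hs Ht; auto. apply S1 in Hs, Ht. tauto.
Qed.

(** Otherwise there are cliques [tup t] of one fixed size with infinitely many ranks [t]. The
    finitely many representatives cannot tell apart two of them, with ranks [s < t], but lying in a
    clique of size [t] does. *)
Lemma divergence_of_few_types : few_types (rank_edge rk) -> forall a, exists N, forall t, N <= t -> a < gg n t.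
Proof.
  intros Hf a. apply NNPP. intros Hno. destruct (Hf (a + 2)) as (F & HF & HB).
  (* These are the ranks available to sets of size [a + 2]: [gg n t + 2 <= a + 2] admits the rank,
     and [a + 2 <= t] leaves room for the set. *)
  pose (T := fun t => a + 2 <= t /\ gg n t <= a).
  assert (HT : forall N, exists t, N <= t /\ T t).
  { intros N. apply NNPP. intros K. apply Hno. exists (N + (a + 2)). intros t Ht. apply NNPP. intros K'.
    apply K. exists t. unfold T. lia. }
  pose (ok := fun t X => NoDup X /\ length X = a + 2 /\ rk X = Some t).
  assert (Hok : forall t, T t -> ok t (epsilon (inhabits []) (ok t))).
  { intros t [H1 H2]. apply epsilon_spec. destruct (@ranked_clique t (a + 1)) as (X & HX); try lia.
    exists X. unfold ok. replace (a + 2) with (S (a + 1)) by lia. auto. }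
  set (tup := fun t => epsilon (inhabits []) (ok t)) in *.
  destruct (homogeneous F (fun q t => fsat (rank_edge rk) (list_env (tup t)) q) T HT) as (T' & S1 & S2 & S3).
  destruct (S2 0) as (s & _ & Hs). destruct (S2 (S s)) as (t & Hst & Ht).
  assert (Bf : fbd (a + 2) (in_clique (a + 2) t)).
  { apply fbd_in_clique. apply S1 in Ht. apply Ht. }
  destruct (HB _ Bf) as (q & Hq & Eq).
  assert (Inj : forall u, T' u -> inj_below (a + 2) (list_env (tup u))).
  { intros u Hu. destruct (Hok u (S1 u Hu)) as (N1 & N2 & _). intros i j Hi Hj E1.
    fold (tup u) in N1, N2. rewrite NoDup_nth with (d := 0) in N1. apply N1; [lia|lia|exact E1]. }
  assert (K : fsat (rank_edge rk) (list_env (tup s)) (in_clique (a + 2) t)).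
  { apply Eq. apply Inj; auto. apply (S3 q Hq s t); auto. apply Eq. apply Inj; auto.
    destruct (Hok t (S1 t Ht)) as (N1 & N2 & N3). fold (tup t) in N1, N2, N3.
    pose proof (S1 t Ht) as [Q1 Q2]. rewrite <- N2. apply (in_clique_spec (s := t)); auto; lia. }
  destruct (Hok s (S1 s Hs)) as (N1 & N2 & N3). fold (tup s) in N1, N2, N3.
  pose proof (S1 s Hs) as [Q1 Q2]. rewrite <- N2 in K. apply (in_clique_spec (s := s)) in K; auto; lia.
Qed.
End Types.

(** * Computability of the decision procedure *)

Lemma cmp_index_sets {D} `{Enc D} (k : D -> nat) : computable k -> computable (fun d => index_sets (k d)).
Proof.
  intros. apply cmp_ext with (f := fun d => nat_rect (fun _ => list (list nat)) [[]] (fun k r => r ++ map (cons k) r) (k d)).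
  - intros d. induction (k d) as [|m IH]; [reflexivity|]. cbn [index_sets nat_rect]. rewrite IH. reflexivity.
  - cmps.
Qed.

Lemma cmp_lookup {D} `{Enc D} (t : D -> list (list nat * nat)) (X : D -> list nat) :
  computable t -> computable X -> computable (fun d => lookup (t d) (X d)).
Proof. intros. unfold lookup. cmps. apply cmp_comp with (f := X); cmps. Qed.

Lemma cmp_choices {D} `{Enc D} (B : D -> nat) (Xs : D -> list (list nat)) :
  computable B -> computable Xs -> computable (fun d => choices (B d) (Xs d)).
Proof. intros. unfold choices. cmps. apply cmp_comp with (f := B); cmps. Qed.

Lemma cmp_inclb {D} `{Enc D} (X Y : D -> list nat) : computable X -> computable Y -> computable (fun d => inclb (X d) (Y d)).
Proof. intros. unfold inclb. cmps. apply cmp_comp with (f := Y); cmps. Qed.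

Ltac cmp_more ::= first
  [ simple apply cmp_FNeg | simple apply cmp_FImp | simple apply cmp_FAll | simple apply cmp_FEq
  | simple apply cmp_FRel | simple apply cmp_enc | simple apply cmp_finst | simple apply cmp_fbdb
  | simple apply cmp_refuted | simple apply cmp_index_sets | simple apply cmp_lookup
  | simple apply cmp_choices | simple apply cmp_inclb ].

Lemma cmp_decide (gg : nat -> nat -> nat) : computable (fun q : nat * nat => gg (fst q) (snd q)) ->
  computable (fun q : nat * fm => decide gg (fst q) (snd q)).
Proof.
  intros Hg. unfold decide, evaluate. apply cmp_fmrec.
  - cmps.
  - unfold st_r. cmps.
  - unfold st_t, st_r, adjacent, Nat.ltb. cmps.
  - cmps.
  - cmps.
  - unfold branches, exts, valid, mk, st_n, st_B, st_k, st_t, st_r, Nat.ltb. cmps.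
    match goal with |- computable (fun d => gg (@?a d) (@?b d)) =>
      refine (cmp_comp (f := fun q : nat * nat => gg (fst q) (snd q)) (g := fun d => (a d, b d)) Hg _) end.
    cmps.
  - cmps.
  - unfold mk. cmps.
Qed.

(** * Hardness *)

(** The boolean function is chosen classically, yet the code of the given characteristic function
    computes it. *)
Lemma computable_set_char (A : nat -> Prop) : computable_set A ->
  exists chi : nat -> bool, computable chi /\ forall x, A x <-> chi x = true.
Proof.
  intros [e He]. pose (chi := fun x => if excluded_middle_informative (A x) then true else false).
  exists chi. split.
  - assert (Hc : exists c, pc_index c = e).
    { destruct (He 0) as [[_ (c & Hc & _)]|[_ (c & Hc & _)]]; eauto. }
    destruct Hc as [c Hc]. exists c. intros x. change (pc_eval c x (if chi x then 1 else 0)).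
    destruct (He x) as [[HA (c' & Hc' & Ev)]|[HA (c' & Hc' & Ev)]];
      assert (c' = c) as -> by (apply pc_index_inj; congruence);
      unfold chi; destruct (excluded_middle_informative (A x)); tauto.
  - intros x. unfold chi. destruct (excluded_middle_informative (A x)); split; intros; try discriminate; tauto.
Qed.

Section Events.
Variable chi : nat -> bool.

(** Taking the least [c] makes it unique, so that for each [a] the events form a single chain of
    lists, at most one of each length. *)
Definition least_counterexample (n a i c : nat) : bool :=
  negb (chi ⟨n, ⟨a, ⟨i, c⟩⟩⟩) && forallb (fun d => chi ⟨n, ⟨a, ⟨i, d⟩⟩⟩) (seq 0 c).

Definition event (n a : nat) (w : list nat) : bool :=
  forallb (fun i => least_counterexample n a i (nth i w 0)) (seq 0 (length w)).

(** The rank [u = ⟨a, w⟩] is admitted early, for sets of size [a + 2], exactly when the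
    list [w] is an event witnessing progress towards the failure of [exists b, forall c] for [a]. *)
Definition delay (n u : nat) : nat :=
  if Nat.eqb (enc (unlist (cpi2 u))) (cpi2 u) && event n (cpi1 u) (unlist (cpi2 u)) then cpi1 u else u.

Lemma least_unique n a i c d :
  least_counterexample n a i c = true -> least_counterexample n a i d = true -> c = d.
Proof.
  unfold least_counterexample. rewrite !andb_true_iff, !forallb_forall, !negb_true_iff.
  intros [H1 H2] [H3 H4]. destruct (Nat.lt_trichotomy c d) as [L|[L|L]]; auto.
  - rewrite (H4 c) in H1. discriminate. apply in_seq. lia.
  - rewrite (H2 d) in H3. discriminate. apply in_seq. lia.
Qed.

Lemma least_exists n a i : (exists c, chi ⟨n, ⟨a, ⟨i, c⟩⟩⟩ = false) -> exists c, least_counterexample n a i c = true.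
Proof.
  intros H. apply NNPP. intros Hn.
  assert (K : forall c, chi ⟨n, ⟨a, ⟨i, c⟩⟩⟩ = true).
  { induction c as [c IH] using lt_wf_ind. apply not_false_iff_true. intros Hc. apply Hn. exists c.
    unfold least_counterexample. rewrite Hc. simpl. apply forallb_forall. intros d Hd. apply in_seq in Hd.
    apply IH. lia. }
  destruct H as [c Hc]. rewrite K in Hc. discriminate.
Qed.

(** [f] is the sequence of least counterexamples, with arbitrary values where there is none; events
    are initial segments of it. *)
Lemma event_canonical n a : exists f : nat -> nat,
  (forall w, event n a w = true -> w = map f (seq 0 (length w))) /\
  ((forall i, exists c, chi ⟨n, ⟨a, ⟨i, c⟩⟩⟩ = false) -> forall l, event n a (map f (seq 0 l)) = true).
Proof.
  pose (f := fun i => epsilon (inhabits 0) (fun c => least_counterexample n a i c = true)).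
  assert (Hf : forall i, (exists c, least_counterexample n a i c = true) -> least_counterexample n a i (f i) = true).
  { intros i H. apply (epsilon_spec (inhabits 0) (fun c => least_counterexample n a i c = true)). auto. }
  exists f. split.
  - intros w Hw. unfold event in Hw. rewrite forallb_forall in Hw.
    apply nth_ext with (d := 0) (d' := 0). rewrite length_map, length_seq. auto.
    intros i Hi. rewrite nth_indep with (d := 0) (d' := f 0) (l := map f _) by (rewrite length_map, length_seq; auto).
    rewrite map_nth, seq_nth by auto. simpl.
    assert (K : least_counterexample n a i (nth i w 0) = true) by (apply Hw, in_seq; lia).
    eapply least_unique; eauto.
  - intros H l. unfold event. rewrite length_map, length_seq. apply forallb_forall. intros i Hi. apply in_seq in Hi.
    rewrite nth_indep with (d := 0) (d' := f 0) (l := map f _) by (rewrite length_map, length_seq; lia).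
    rewrite map_nth, seq_nth by lia. simpl. apply Hf, least_exists, H.
Qed.

(** A good [b] has no counterexample, so no event has length greater than [b]; being initial
    segments of one sequence, the events are finite in number. *)
Lemma events_bounded n a b : (forall c, chi ⟨n, ⟨a, ⟨b, c⟩⟩⟩ = true) ->
  exists M, forall w, event n a w = true -> ⟨a, enc w⟩ < M.
Proof.
  intros Hb. destruct (event_canonical n a) as (f & Hf & _).
  exists (S (list_max (map (fun l => ⟨a, enc (map f (seq 0 l))⟩) (seq 0 (S b))))).
  intros w Hw. apply Nat.lt_succ_r.
  pose proof (proj1 (list_max_le (map (fun l => ⟨a, enc (map f (seq 0 l))⟩) (seq 0 (S b))) _) (le_n _)) as Q.
  rewrite Forall_forall in Q. apply Q. apply in_map_iff. exists (length w). split.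
  - rewrite <- Hf; auto.
  - apply in_seq. assert (length w <= b); [|lia]. apply Nat.nlt_ge. intros L.
    unfold event in Hw. rewrite forallb_forall in Hw. specialize (Hw b). rewrite in_seq in Hw. specialize (Hw ltac:(lia)).
    unfold least_counterexample in Hw. rewrite Hb in Hw. discriminate.
Qed.

Lemma delay_diverges n : (forall a, exists b, forall c, chi ⟨n, ⟨a, ⟨b, c⟩⟩⟩ = true) <->
  forall N, exists M, forall u, M <= u -> N < delay n u.
Proof.
  split.
  - intros H N.
    assert (K : exists M, forall a, a <= N -> forall w, event n a w = true -> ⟨a, enc w⟩ < M).
    { induction N as [|N [M IH]].
      - destruct (H 0) as [b Hb]. destruct (events_bounded n 0 b Hb) as [M HM]. exists M.
        intros a Ha. replace a with 0 by lia. auto.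
      - destruct (H (S N)) as [b Hb]. destruct (events_bounded n (S N) b Hb) as [M' HM]. exists (M + M').
        intros a Ha w Hw. assert (a = S N \/ a <= N) as [->|L] by lia.
        + specialize (HM w Hw). lia.
        + specialize (IH a L w Hw). lia. }
    destruct K as [M HM]. exists (S (M + N)). intros u Hu. unfold delay.
    destruct (_ && _) eqn:Ev; [|lia]. apply andb_true_iff in Ev. destruct Ev as [E1 E2]. apply Nat.eqb_eq in E1.
    destruct (Nat.lt_ge_cases N (cpi1 u)) as [|L]; auto. specialize (HM _ L _ E2).
    (* The test in [delay] that [cpi2 u] really is the code of the list turns the bound on codes of
       events into a bound on [u]. *)
    rewrite E1, cpi_eta in HM. lia.
  - intros H a. apply NNPP. intros Hn. destruct (H a) as [M HM].
    destruct (event_canonical n a) as (f & _ & Hf).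
    assert (K : forall i, exists c, chi ⟨n, ⟨a, ⟨i, c⟩⟩⟩ = false).
    { intros i. apply NNPP. intros K. apply Hn. exists i. intros c. apply not_false_iff_true. intros Q. apply K. eauto. }
    specialize (Hf K M). set (w := map f (seq 0 M)) in *. specialize (HM ⟨a, enc w⟩).
    (* A list of length [M] has a code at least [M], so this event lies in the range where [delay]
       was assumed to exceed [a], yet its delay is [a]. *)
    assert (L : M <= ⟨a, enc w⟩).
    { pose proof (Cantor.to_nat_non_decreasing a (enc w)). pose proof (enc_list_length w).
      unfold w in H1. rewrite length_map, length_seq in H1. fold w in H1. lia. }
    specialize (HM L). unfold delay in HM. rewrite cpi1_pair, cpi2_pair, unlist_enc, Hf, Nat.eqb_refl in HM.
    simpl in HM. lia.
Qed.

Lemma cmp_delay : computable chi -> computable (fun q : nat * nat => delay (fst q) (snd q)).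
Proof.
  intros Hc. assert (Hc' : forall D (HD : Enc D) (f : D -> nat), computable f -> computable (fun d => chi (f d))).
  { intros. apply cmp_comp; auto. }
  unfold delay, event, least_counterexample. cmps; apply Hc'; cmps.
Qed.
End Events.

(** The s-m-n theorem: [n] is wired in by a constant code, whose index is primitive recursive in
    [n]. *)
Lemma smn (F : nat * nat -> bool) : computable F -> exists f, computable_fun f /\
  forall n x, phi (f n) x (if F (n, x) then 1 else 0).
Proof.
  intros [c Hc].
  pose (code := fun n => pc_comp c (pc_pair (pc_const n) pc_id)).
  exists (fun n => pc_index (code n)). split.
  - assert (K : computable (fun n => pc_index (code n))).
    { apply cmp_ext with (f := fun n => ⟨5, ⟨pc_index c, ⟨4, ⟨nat_rect (fun _ => nat) ⟨0, 0⟩ (fun _ r => ⟨5, ⟨⟨1, 0⟩, r⟩⟩) n, pc_index pc_id⟩⟩⟩⟩).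
      - intros n.
        assert (En : nat_rect (fun _ => nat) ⟨0, 0⟩ (fun _ r => ⟨5, ⟨⟨1, 0⟩, r⟩⟩) n = pc_index (pc_const n)).
        { induction n as [|n IH]; [reflexivity|]. cbn [nat_rect pc_const pc_index]. rewrite IH. reflexivity. }
        rewrite En. reflexivity.
      - cmps. }
    destruct K as [d Hd]. exists (pc_index d). intros n. exists d. split; [reflexivity|exact (Hd n)].
  - intros n x. exists (code n). split; auto. unfold code. econstructor.
    + constructor. apply ev_const. apply ev_id.
    + apply (Hc (n, x)).
Qed.

Theorem categorical_index_hard Y : Pi03 Y -> many_one_reducible Y categorical_index.
Proof.
  intros (A & HA & HY). destruct (computable_set_char HA) as (chi & Hchi & Hspec).
  pose (gg := delay chi).
  (* Every number decodes to some formula, so the first test rejects numbers that are not Gödel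
     numbers; the other two ask for a sentence and for its truth. *)
  pose (F := fun q : nat * nat => enc_eqb (enc (dcd (snd q) : fm)) (snd q) && fbdb 0 (dcd (snd q)) && decide gg (fst q) (dcd (snd q))).
  assert (HF : computable F).
  { unfold F. cmps. apply (cmp_comp (f := fun q : nat * fm => decide gg (fst q) (snd q))
      (g := fun q : nat * nat => (fst q, dcd (snd q)))); cmps. apply cmp_decide. apply cmp_delay. auto. }
  destruct (smn HF) as (f & Hf & Hph). exists f. split; auto. intros n.
  destruct (generic_ranks (gg n)) as (rk & G & E).
  assert (HP : presents (f n) (rank_edge rk)).
  { intros x. assert (K : index_set (theory (rank_edge rk)) x <-> F (n, x) = true).
    { unfold F. cbn [fst snd]. rewrite !andb_true_iff, enc_eqb_spec, fbdb_spec. split.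
      - intros Hx. assert (Ex : exists p : fm, fcode p = x).
        { destruct Hx as (p & _ & <-). exists (of_form p). rewrite <- form_index_to, to_of. auto. }
        destruct Ex as [p <-]. apply index_set_fcode in Hx. destruct Hx as [Hb Hs].
        assert (Dp : dcd (fcode p) = p).
        { change (fdec (S (fcode p)) (fcode p) = p). apply fdec_fcode. pose proof (fsize_fcode p). lia. }
        rewrite Dp. split; auto. apply (decide_spec gg n G E _ (fun x => x) Hb). auto.
      - intros [[Ex Hb] Hd]. rewrite <- Ex. apply index_set_fcode. split; auto.
        apply (decide_spec gg n G E _ (fun x => x) Hb). auto. }
    specialize (Hph n x). destruct (F (n, x)) eqn:EF; [left|right].
    - split. apply K; auto. exists 1. auto.
    - split. rewrite K. discriminate. exists 0. auto. }
  rewrite HY. rewrite categorical_index_presents.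
  assert (Q : (forall a, exists b, forall c, A ⟨n, ⟨a, ⟨b, c⟩⟩⟩) <-> forall N, exists M, forall u, M <= u -> N < gg n u).
  { unfold gg. rewrite <- delay_diverges. split; intros H a; destruct (H a) as [b Hb]; exists b; intros c; apply Hspec; auto. }
  rewrite Q. split.
  - intros H. exists (rank_edge rk). split; auto. exact (few_types_of_divergence gg n G E H).
  (* The graph [R] need not be the generic one, but both are presented by the same index, hence
     elementarily equivalent, and [few_types] transfers. *)
  - intros (R & HR & Hfew).
    apply (divergence_of_few_types gg n G E).
    apply few_types_transfer with (R := R); auto; try exact (inhabits 0).
    intros p Hp rho rho'. pose proof (presents_yes p HR Hp) as Y1. pose proof (presents_yes p HP Hp) as Y2.
    split; intros H.
    + assert (K : fsat (rank_edge rk) (fun x => x) p) by (apply Y2, Y1; revert H; apply fsat_sentence; auto).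
      revert K. apply fsat_sentence; auto.
    + assert (K : fsat R (fun x => x) p) by (apply Y1, Y2; revert H; apply fsat_sentence; auto).
      revert K. apply fsat_sentence; auto.
Qed.

Theorem theorem11 :
  exists L : language,
    Pi03_complete (fun e : nat =>
      exists T : form L -> Prop,
        complete_theory T /\
        omega_categorical T /\
        is_char_fun (sgn_phi e) (index_set T)).
Proof.
  exists digraph. split.
  - exact categorical_index_Pi03.
  - exact categorical_index_hard.
Qed.
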